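(* Let $K$ be a field, $R=K[x_1,\dots,x_n]$ the standard graded polynomial ring, and $A=R/I\neq 0$ with $I\subset R$ a homogeneous ideal. Then the graded Betti numbers of $A$ satisfy $$\beta^R_{i+1,i+j}(A)\le \beta_{i+1,i+j}(h_A,n)\qquad\text{for all } i,j\in\mathbb Z .$$ Furthermore, equality is attained for all integers $i,j$ if $I$ is a lex-segment ideal.
   Context: $h_A(j)=\dim_K[A]_j$ is the Hilbert function, $\beta^R_{i,j}(A)=\dim_K[\operatorname{Tor}^R_i(A,K)]_j$. For a homogeneous ideal $I$ let $I_{\langle d\rangle}$ be the ideal generated by all polynomials of degree $d$ in $I$; $I$ is a lex-segment ideal if for every $d$ the ideal $I_{\langle d\rangle}$ is generated by the first $\dim_K[I]_d$ monomials of degree $d$ in the lexicographic order of the monomials of $R$. Binomial coefficients: for $a\in\mathbb R$, $j\in\mathbb Z$, $\binom aj=\frac{a(a-1)\cdots(a-j+1)}{j!}$ if $j>0$, $=1$ if $j=0$, $=0$ if $j<0$. For positive integers $b,d$ the $d$-binomial expansion of $b$ is the unique expression $b=\sum_{k=s}^d\binom{m_k}{k}$ with integers $m_d>m_{d-1}>\dots>m_s\ge s\ge1$; for $b=0$ the expansion is the empty sum. The numbers $\beta_{i,j}(h,n)$: let $h$ be the Hilbert function of a standard graded $K$-algebra with $h(1)\le n$. For $i\ge0$ and $d\ge2$, with the $d$-binomial expansion $h(d)=\sum_{k=s}^d\binom{m_k}{k}$ and the $(d-1)$-binomial expansion $h(d-1)=\sum_{k=t}^{d-1}\binom{n_k}{k}$,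 $$\beta_{i+1,i+d}(h,n)=\sum_{k=t}^{d-1}\sum_{j=0}^{n_k-k}\binom{n_k-j}{k}\binom{n-1-j}{i}-\sum_{k=s}^{d}\sum_{j=0}^{m_k-k}\binom{m_k-1-j}{k-1}\binom{n-1-j}{i}$$ (sums attached to a zero value of $h$ are $0$). For $i\ge0$: $\beta_{i+1,i+1}(h,n)=\binom{n-h(1)}{i+1}$ and $\beta_{i+1,i+d}(h,n)=0$ if $d\le0$. For $i\le 0$: $\beta_{i,j}(h,n)=1$ if $(i,j)=(0,0)$ and $0$ otherwise. *)

(* Defs.v *)
(* Mathematical Components, with multinomials for K[x_1,...,x_n] = {mpoly K[n]}. *)
From HB Require Import structures.
From Stdlib Require Import ClassicalEpsilon.
From mathcomp Require Import all_boot all_order all_algebra.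
From mathcomp Require Import ring_quotient.
From mathcomp.multinomials Require Import mpoly.

Set Implicit Arguments.
Unset Strict Implicit.
Unset Printing Implicit Defensive.

Import Order.TTheory GRing.Theory Num.Theory.
Local Open Scope ring_scope.

(* The monomials of degree d in lexicographic order with x_1 > ... > x_n, the
   largest first.  The library's order on monomials compares degrees and then
   exponent vectors lexicographically, so it is lex in each fixed degree (the
   header of mpoly.v calls it degrevlex). *)
Definition monomials (n d : nat) : seq 'X_{1..n} :=
  sort (fun m1 m2 : 'X_{1..n} => (m2 <= m1)%O)
    [seq bmnm m | m : 'X_{1..n < d.+1} <- enum {: 'X_{1..n < d.+1}} & mdeg m == d].

Section HomogeneousIdeals.
Variables (K : fieldType) (n : nat).
Implicit Types (I : {pred {mpoly K[n]}}) (S : {mpoly K[n]} -> Prop) (d : nat).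

(* [idealr_closed] includes 1 \notin I, which is R/I <> 0. *)
Definition proper_homogeneous_ideal I : Prop :=
  idealr_closed I /\ forall f d, f \in I -> pihomog mdeg d f \in I.

(* [R]_d is represented by coordinates in its monomial basis (the library's
   vector space [dhomog] excludes n = 0). *)
Definition form_of_row d (v : 'rV[K]_(size (monomials n d))) : {mpoly K[n]} :=
  \sum_k v 0 k *: 'X_[nth 0%MM (monomials n d) k].

(* [I]_d as a subspace of [R]_d.  For an ideal I exactly one subspace has the
   stated property; choice is needed only because a predicate on vectors is not
   an element of {vspace _}. *)
Definition ideal_part I d : {vspace 'rV[K]_(size (monomials n d))} :=
  epsilon (inhabits 0%VS)
    (fun U : {vspace 'rV[K]_(size (monomials n d))} =>
       forall v, (v \in U) = (form_of_row v \in I)).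

(* dim_K [R/I]_d *)
Definition hilbert I d : nat :=
  (size (monomials n d) - \dim (ideal_part I d))%N.

Definition in_ideal_gen S (f : {mpoly K[n]}) : Prop :=
  exists s : seq ({mpoly K[n]} * {mpoly K[n]}),
    (forall c, c \in s -> S c.2) /\ f = \sum_(c <- s) c.1 * c.2.

Definition lex_segment_ideal I : Prop :=
  forall d (f : {mpoly K[n]}),
    in_ideal_gen (fun g => g \in I /\ g \is d.-homog) f <->
    in_ideal_gen (fun g => exists2 m,
        m \in take (\dim (ideal_part I d)) (monomials n d) & g = 'X_[m]) f.

End HomogeneousIdeals.

Section BettiNumbers.
Variables (K : fieldType) (n : nat).

Definition homog_of_degree (e : int) (f : {mpoly K[n]}) : Prop :=
  forall m, m \in msupp f -> (mdeg m)%:Z = e.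

(* A graded free resolution ... -> F_1 -> F_0 -> R/I -> 0 with
   F_p = \bigoplus_(k < res_rank p) R(- res_shift p k), the elements of F_p being row
   vectors and the differentials acting by right multiplication.  The
   augmentation F_0 -> R/I is given by representatives in R of the images of
   the basis elements. *)
Record graded_free_resolution (I : {pred {mpoly K[n]}}) := GradedFreeResolution {
  res_rank : nat -> nat;
  res_shift : forall p, 'I_(res_rank p) -> int;
  res_diff : forall p, 'M[{mpoly K[n]}]_(res_rank p.+1, res_rank p);
  res_aug : 'cV[{mpoly K[n]}]_(res_rank 0);
  diff_homog : forall p k l,
    homog_of_degree (res_shift k - res_shift l) (res_diff p k l);
  aug_homog : forall k, homog_of_degree (res_shift k) (res_aug k 0);
  aug_surj : forall f, exists u : 'rV_(res_rank 0), f - (u *m res_aug) 0 0 \in I;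
  exact_aug : forall u : 'rV_(res_rank 0),
    (u *m res_aug) 0 0 \in I <-> exists v, u = v *m res_diff 0;
  exact_diff : forall p (u : 'rV_(res_rank p.+1)),
    u *m res_diff p = 0 <-> exists v, u = v *m res_diff p.+1
}.

Section Tor.
Variables (I : {pred {mpoly K[n]}}) (F : graded_free_resolution I).

(* The complex F \otimes_R K: since K = R/(x_1,...,x_n), each entry of a
   differential is replaced by its constant coefficient. *)
Definition diffK p : 'M[K]_(res_rank F p.+1, res_rank F p) :=
  map_mx (fun f : {mpoly K[n]} => f@_0%MM) (res_diff F p).

Definition cycles p : 'M[K]_(res_rank F p) :=
  match p with 0 => 1%:M | q.+1 => kermx (diffK q) end.

(* The degree j part of F_p \otimes_R K, spanned by the basis elements of
   degree j. *)
Definition degree_part p (j : int) : 'M[K]_(res_rank F p) :=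
  diag_mx (\row_k (res_shift k == j)%:R).

(* dim_K [Tor^R_i(R/I, K)]_j, as the homology of F \otimes_R K; the boundaries
   lie in the cycles, so the subtraction is exact. *)
Definition betti (i j : int) : nat :=
  match i with
  | Posz p => (\rank (cycles p :&: degree_part p j)%MS -
               \rank (diffK p :&: degree_part p j)%MS)%N
  | Negz _ => 0%N
  end.

End Tor.
End BettiNumbers.

Definition binomial (a : rat) (j : int) : rat :=
  match j with
  | Posz k => (\prod_(l < k) (a - l%:R)) / k`!%:R
  | Negz _ => 0
  end.

(* e = (s, m) encodes b = \sum_(s <= k <= d) 'C(m k, k) with
   m d > ... > m s >= s >= 1; the values of m outside [s, d] are irrelevant.
   s = d + 1 gives the empty sum, which occurs exactly for b = 0. *)
Definition is_binomial_expansion (d b : nat) (e : nat * (nat -> nat)) : Prop :=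
  [/\ (1 <= e.1 <= d.+1)%N,
      forall k, (e.1 <= k < d)%N -> (e.2 k < e.2 k.+1)%N,
      (e.1 <= d)%N -> (e.1 <= e.2 e.1)%N
    & b = (\sum_(e.1 <= k < d.+1) 'C(e.2 k, k))%N].

Definition binomial_expansion (d b : nat) : nat * (nat -> nat) :=
  epsilon (inhabits (d.+1, id)) (is_binomial_expansion d b).

(* beta_(i+1, i+d)(h, n) for i >= 0 and d >= 2 *)
Definition beta_main (h : nat -> nat) (n i d : nat) : rat :=
  let (t, nn) := binomial_expansion d.-1 (h d.-1) in
  let (s, mm) := binomial_expansion d (h d) in
  \sum_(t <= k < d) \sum_(0 <= j < (nn k - k).+1)
     binomial ((nn k)%:R - j%:R) k * binomial (n%:R - 1 - j%:R) i
  - \sum_(s <= k < d.+1) \sum_(0 <= j < (mm k - k).+1)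
     binomial ((mm k)%:R - 1 - j%:R) (k%:Z - 1) * binomial (n%:R - 1 - j%:R) i.

(* beta_(p, q)(h, n), with p = i + 1 and q = i + d when p > 0 *)
Definition beta (h : nat -> nat) (n : nat) (p q : int) : rat :=
  match p with
  | Posz i.+1 =>
      match q - i%:Z with
      | Posz 0 => 0
      | Posz 1 => binomial (n%:R - (h 1%N)%:R) i.+1
      | Posz d => beta_main h n i d
      | Negz _ => 0
      end
  | _ => ((p == 0) && (q == 0))%:R
  end.

(* Main.v *)
Require Import Defs.
From Stdlib Require Import Classical ClassicalEpsilon FunctionalExtensionality.
From mathcomp Require Import all_boot all_order all_algebra.
From mathcomp.multinomials Require Import mpoly.
From mathcomp Require Import zify ring.
Set Implicit Arguments.
Unset Strict Implicit.
Unset Printing Implicit Defensive.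
Import Order.TTheory GRing.Theory Num.Theory.
Local Open Scope ring_scope.

(** The number beta_(i+1,i+j)(R/I) is the dimension of a Koszul homology space
    of A = R/I, and the bound arises by adjoining the variables to the Koszul
    complex one at a time.

    Resolutions.  The free modules of the resolution have no Koszul homology in
    positive degrees ([free_mod_acyclic]).  Dimension shifting ([kerhom_shift])
    therefore moves the (p+1)-st Koszul homology of A to the first one of a
    syzygy module, and this is the homology of the resolution tensored with K
    ([kerhom_last], [betti_koszul]).

    One variable.  The Koszul complex on n+1 elements is the mapping cone of
    the last one, x, acting on the complex on the first n.  A cycle maps to a
    cycle with coefficients in M/xM, and what is lost is carried by ker x:
      dim H_(i+1)(n+1; M) <= dim H_(i+1)(n; M/xM) + 'C(n, i) dim ker x
    ([koszul_betti_step]).  Koszul homology is invariant under linear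
    coordinate changes, because multiplication by a variable is null-homotopic
    ([koszul_betti_recoord]), and under field extension ([koszul_betti_map]), so
    the form that is divided out may be taken generic over an infinite field.
    With a_j and b_j the dimensions of A/(l_1,...,l_j) in two consecutive
    degrees e and e+1, iteration bounds the Betti number by
      sum_(j < n) 'C(n-1-j, i) (a_j - b_j + b_(j+1)).
    As the coefficients decrease with j, Abel summation shows that this sum
    grows with the a_j and the b_j as long as b_0 is kept ([bound_mono]).

    Green's theorem.  A generic linear form reduces a dimension
    sum_k 'C(m_k, k) in degree d to at most sum_k 'C(m_k - 1, k) ([green]), so j
    of them reduce it to at most sum_k 'C(m_k - j, k).  With these values the
    sum above is beta_(i+1,i+d)(h,n) ([beta_main_sum]).  In the linear strand
    e = 0, and a_j <= 1 replaces Green's theorem ([linear_bound]).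

    Lex-segment ideals.  Here the variables themselves are divided out, from the
    last to the first.  Monomials form a basis of A and of its quotients, so
    each quotient map splits for the remaining variables.  A lex segment is
    closed under replacing a variable by an earlier one, so whatever the last
    variable kills is killed by all of them ([link_is_split]).  Under these two
    conditions the inequality above is an equality ([koszul_betti_step_split]).
    Finally, among the last b monomials of degree d, exactly sum_k 'C(m_k - j, k)
    avoid the last j variables ([count_drop]), so all the bounds are attained. *)

(** * Binomial expansions and the numerical part of Green's theorem *)

Section BinomialExpansions.
Local Open Scope nat_scope.

(** Expansions are sequences indexed by all of 1, ..., d: a term with m k = k - 1
    contributes 0, so the terms that a binomial expansion lacks are filled up in
    this way. *)
Definition strict_upto (d : nat) (m : nat -> nat) : Prop :=
  forall k, 1 <= k < d -> m k < m k.+1.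

Definition weight (phi : nat -> nat -> nat) (d : nat) (m : nat -> nat) : nat :=
  \sum_(1 <= k < d.+1) phi k (m k).

(** For an expansion m of a dimension in degree d, Green's bound on the dimension
    after dividing by j generic linear forms; a lex-segment ideal attains it with
    the last j variables. *)
Definition shifted_sum (j d : nat) (m : nat -> nat) : nat :=
  weight (fun k a => 'C(a - j, k)) d m.

(** The property of binomial coefficients that makes [weight phi] respect the
    order of expansions: Pascal's rule as an inequality. *)
Definition growing (phi : nat -> nat -> nat) : Prop :=
  (forall k a b, 0 < k -> a <= b -> phi k a <= phi k b) /\
  (forall k a, 0 < k -> phi k.+1 a + phi k a <= phi k.+1 a.+1).

Lemma weightS phi d m : weight phi d.+1 m = weight phi d m + phi d.+1 (m d.+1).
Proof. by rewrite /weight big_nat_recr. Qed.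

Lemma weight0 phi m : weight phi 0 m = 0.
Proof. by rewrite /weight big_geq. Qed.

Lemma strict_uptoW d m : strict_upto d.+1 m -> strict_upto d m.
Proof. by move=> h k /andP[k1 kd]; apply: h; rewrite k1 ltnW. Qed.

(** The terms below the top one add up to at most one step of the top term, by
    repeated use of the growth condition. *)
Lemma weight_lead phi d m : growing phi -> strict_upto d.+1 m ->
  weight phi d.+1 m <= phi d.+1 (m d.+1).+1.
Proof.
move=> [mono step]; elim: d => [|d IH] sm.
  by rewrite weightS weight0 add0n; apply: mono.
rewrite weightS addnC; apply: leq_trans (step d.+1 (m d.+2) _) => //.
rewrite leq_add2l; apply: leq_trans (IH (strict_uptoW sm)) _.
by apply: mono => //; apply: sm; rewrite /= ltnS leqnn.
Qed.

Lemma growing_bin j : growing (fun k a => 'C(a - j, k)).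
Proof.
split=> [k a b _ ab | k a k0]; first by apply: leq_bin2l; apply: leq_sub2r.
have [ja | aj] := leqP j a; first by rewrite subSn // binS.
have -> : a - j = 0 by lia.
by rewrite !bin0n; case: k k0.
Qed.

Lemma shifted_sum0_lt d m : strict_upto d.+1 m -> shifted_sum 0 d.+1 m < 'C((m d.+1).+1, d.+1).
Proof.
elim: d => [|d IH] sm; rewrite /shifted_sum weightS subn0.
  by rewrite weight0 add0n !bin1.
rewrite binS addnC -addnS leq_add2l.
apply: leq_trans (IH (strict_uptoW sm)) _.
by apply: leq_bin2l; apply: sm; rewrite /= ltnS leqnn.
Qed.

(** Expansions are compared by value as they are compared lexicographically from
    the top index down, and every growing weight follows the same order. *)
Lemma weight_mono phi d m m' : growing phi -> strict_upto d m -> strict_upto d m' ->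
  shifted_sum 0 d m <= shifted_sum 0 d m' -> weight phi d m <= weight phi d m'.
Proof.
move=> gphi; elim: d => [|d IH] sm sm'; first by rewrite !weight0.
have [lt | gt | eqm] := ltngtP (m d.+1) (m' d.+1).
- move=> _; apply: leq_trans (weight_lead gphi sm) _.
  rewrite weightS; apply: leq_trans (leq_addl _ _); exact: gphi.1.
- move=> le; have := shifted_sum0_lt sm'; rewrite ltnNge; case/negP.
  apply: leq_trans le; rewrite /shifted_sum weightS subn0.
  by apply: leq_trans (leq_addl _ _); apply: leq_bin2l.
- rewrite /shifted_sum !weightS eqm !leq_add2r => le.
  exact: IH (strict_uptoW sm) (strict_uptoW sm') le.
Qed.

Lemma shifted_sum_mono j d m m' : strict_upto d m -> strict_upto d m' ->
  shifted_sum 0 d m <= shifted_sum 0 d m' -> shifted_sum j d m <= shifted_sum j d m'.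
Proof. exact: weight_mono (growing_bin j). Qed.

(** Greedy choice: the top term is the largest binomial coefficient that fits, and
    the remainder is too small to force a term of the same size below it. *)
Lemma expansion_exists d b : exists2 m, strict_upto d.+1 m & shifted_sum 0 d.+1 m = b.
Proof.
elim: d b => [|d IH] b.
  exists (fun=> b); first by move=> k; case: k => // k /andP[].
  by rewrite /shifted_sum weightS weight0 subn0 add0n bin1.
pose P a := 'C(a, d.+2) <= b.
have exP : exists a, P a by exists 0.
have ubP a : P a -> a <= b + d.+1.
  rewrite /P => le; rewrite leqNgt; apply/negP => lt.
  suff: b < 'C(a, d.+2) by rewrite ltnNge le.
  apply: leq_trans (leq_bin2l _ lt).
  elim: (b) => [|c IHc]; first by rewrite add0n binn.
  rewrite addSn binS -addn1; apply: leq_add IHc _.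
  by rewrite bin_gt0; lia.
case: (ex_maxnP exP ubP) => a Pa amax.
have [m sm vm] := IH (b - 'C(a, d.+2)).
pose m' k := if k == d.+2 then a else m k.
have mE k : k < d.+2 -> m' k = m k by rewrite /m'; case: eqP => // ->; rewrite ltnn.
have vE : shifted_sum 0 d.+1 m' = b - 'C(a, d.+2).
  rewrite -vm /shifted_sum /weight !big_nat; apply: eq_bigr => k /andP[_ kd].
  by rewrite mE.
have sm1 : strict_upto d.+1 m'.
  by move=> k /andP[k1 kd]; rewrite !mE ?sm ?k1 //; lia.
have lead : m' d.+2 = a by rewrite /m' eqxx.
exists m'; last by rewrite /shifted_sum weightS -/(shifted_sum 0 d.+1 m') vE lead subn0 subnK.
move=> k /andP[k1 kd]; have [kd' | kd'] := ltnP k d.+1.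
  by apply: sm1; rewrite k1.
have -> : k = d.+1 by lia.
rewrite lead ltnNge; apply/negP => le.
have : P a.+1.
  rewrite /P binS -leq_subRL // -vE /shifted_sum weightS subn0.
  by apply: leq_trans (leq_addl _ _); apply: leq_bin2l.
by move/amax; rewrite ltnn.
Qed.

(** Quantifying over all sequences of value at least b, not only the expansion of b
    itself, is what lets the bound be iterated with [down]. *)
Definition green_bound (d b c : nat) : Prop :=
  forall m, strict_upto d m -> b <= shifted_sum 0 d m -> c <= shifted_sum 1 d m.

(** Subtraction of j, stopped at k - 1: this keeps the sequence strict, and does not
    change any binomial coefficient, since those below the floor vanish. *)
Definition down (j : nat) (m : nat -> nat) (k : nat) : nat := maxn (m k - j) k.-1.

Lemma strict_down j d m : strict_upto d m -> strict_upto d (down j m).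
Proof. by move=> sm k kd; have := sm k kd; rewrite /down; lia. Qed.

Lemma bin_down j i m k : 0 < k -> 'C(down j m k - i, k) = 'C(m k - j - i, k).
Proof.
rewrite /down => k0; have [le | lt] := leqP k.-1 (m k - j); first by [].
by rewrite !bin_small //; lia.
Qed.

Lemma shifted_sum_down j i d m : shifted_sum i d (down j m) = shifted_sum (j + i) d m.
Proof.
rewrite /shifted_sum /weight !big_nat; apply: eq_bigr => k /andP[k1 _].
by rewrite bin_down // subnDA.
Qed.

Lemma green_bound_iter d (b : nat -> nat) m : strict_upto d m ->
  b 0 <= shifted_sum 0 d m -> (forall j, green_bound d (b j) (b j.+1)) ->
  forall j, b j <= shifted_sum j d m.
Proof.
move=> sm b0 gb; elim=> // j IH.
have := gb j _ (@strict_down j _ _ sm); rewrite !shifted_sum_down addn0 addn1; apply; exact: IH.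
Qed.

(** The loss of an expansion under one linear form.  It is again a growing weight,
    since 'C(a, k) - 'C(a - 1, k) = 'C(a - 1, k - 1). *)
Definition green_gap (d : nat) (m : nat -> nat) : nat :=
  weight (fun k a => 'C(a, k) - 'C(a - 1, k)) d m.

Lemma growing_green_gap : growing (fun k a => 'C(a, k) - 'C(a - 1, k)).
Proof.
have E k a : 'C(a.+1, k.+1) - 'C(a.+1 - 1, k.+1) = 'C(a, k).
  by rewrite subn1 /= binS addKn.
split=> [[|k] [|a] [|b] // _ ab | [|k] [|a] // _].
- by rewrite !E; apply: leq_bin2l.
- by rewrite !E binS.
Qed.

Lemma shifted_sum_green_gap d m : shifted_sum 1 d m + green_gap d m = shifted_sum 0 d m.
Proof.
rewrite /shifted_sum /green_gap /weight -big_split; apply: eq_bigr => k _ /=.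
by rewrite subn0 subnKC //; apply: leq_bin2l; lia.
Qed.

(** Weak monotonicity is [shifted_sum_mono]; strictness fails in general because a
    term with m k = k - 1 can grow to m k = k while 'C(m k - 1, k) remains 0. *)
Lemma shifted_sum1_strict d m m' : strict_upto d m -> strict_upto d m' ->
  (forall k, 1 <= k <= d -> k <= m k) ->
  shifted_sum 0 d m < shifted_sum 0 d m' -> shifted_sum 1 d m < shifted_sum 1 d m'.
Proof.
elim: d => [|d IH] sm sm' pos; first by rewrite /shifted_sum !weight0.
have [lt | gt | eqm] := ltngtP (m d.+1) (m' d.+1).
- move=> _; have := shifted_sum0_lt (@strict_down 1 _ _ sm);
  rewrite shifted_sum_down addn0 => lead.
  apply: leq_trans lead _; rewrite /shifted_sum weightS.
  apply: leq_trans (leq_addl _ _); apply: leq_bin2l.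
  by have := pos d.+1; rewrite /down leqnn /=; lia.
- move=> le; have := shifted_sum0_lt sm'; rewrite ltnNge; case/negP.
  apply: leq_trans (ltnW le); rewrite /shifted_sum weightS subn0.
  by apply: leq_trans (leq_addl _ _); apply: leq_bin2l.
- rewrite /shifted_sum !weightS eqm !ltn_add2r => le.
  apply: IH (strict_uptoW sm) (strict_uptoW sm') _ le => k kd; apply: pos; lia.
Qed.

(** The induction step of Green's theorem in numbers: c and b are the dimensions of
    A/l and A in one degree, c' that of A/(l, l'), and e' that of lA/l'lA.  If c
    exceeded the bound, then comparing with the expansion w of c - 1 would force
    c' + e' <= c - 1. *)
Lemma green_numeric d b c c' e' : c <= b ->
  green_bound d.+2 c c' -> green_bound d.+1 (b - c) e' -> c <= c' + e' ->
  green_bound d.+2 b c.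
Proof.
move=> cb gc ge cle m sm bm; rewrite leqNgt; apply/negP => lt.
pose g := c.-1.
have gE : c = g.+1 by rewrite /g prednK //; case: (c) lt.
have [w sw vw] := expansion_exists d.+1 g.
pose W k := (w k).+1.
have sW : strict_upto d.+2 W by move=> k kd; rewrite /W ltnS sw.
have wge k : 1 <= k <= d.+2 -> k.-1 <= w k.
  elim: k => // k IHk /andP[_ kd]; case: k IHk kd => // k IHk kd.
  have := sw k.+1; have := IHk; rewrite /=; lia.
have gW : shifted_sum 1 d.+2 W = g.
  rewrite -vw /shifted_sum /weight; apply: eq_bigr => k _.
  by rewrite /W subn1 subn0.
(* otherwise the shifted sum of m would exceed that of W, which is c - 1 *)
have bW : shifted_sum 0 d.+2 m <= shifted_sum 0 d.+2 W.
  rewrite leqNgt; apply/negP => ltW.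
  have := shifted_sum1_strict sW sm _ ltW; rewrite gW.
  have pos : (forall k : nat, 1 <= k <= d.+2 -> k <= W k).
    by move=> k kd; have := wge k kd; rewrite /W; lia.
  by move=> /(_ pos); lia.
have VW : shifted_sum 0 d.+2 W = g.+1 + shifted_sum 0 d.+1 (fun k => w k.+1).
  rewrite -vw /shifted_sum /weight.
  under eq_bigr => k _ do rewrite subn0.
  under [X in _ = X.+1 + _]eq_bigr => k _ do rewrite subn0.
  under [X in _ = _.+1 + X]eq_bigr => k _ do rewrite subn0.
  have -> : \sum_(1 <= k < d.+3) 'C(W k, k) =
            \sum_(1 <= k < d.+3) 'C(w k, k) + \sum_(1 <= k < d.+3) 'C(w k, k.-1).
    rewrite -big_split !big_nat; apply: eq_bigr => k /andP[k1 _] /=.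
    by case: k k1 => // k _; rewrite /W binS.
  rewrite addSnnS; congr (_ + _).
  by rewrite big_nat_recl // bin0 add1n.
have be : b - c <= shifted_sum 0 d.+1 (fun k => w k.+1) by lia.
have e'le : e' <= shifted_sum 1 d.+1 (fun k => w k.+1).
  by apply: ge be => k kd; apply: sw; lia.
(* the loss of w is the bound on e', up to the contribution of index 1 *)
have dE : green_gap d.+2 w = (0 < w 1) + \sum_(1 <= k < d.+2) 'C(w k.+1 - 1, k).
  rewrite /green_gap /weight big_nat_recl //; congr (_ + _).
    by rewrite !bin1; case: (w 1) => // a; rewrite subn1 /= subSnn.
  rewrite !big_nat; apply: eq_bigr => k /andP[k1 kd].
  have : 0 < w k.+1 by have := wge k.+1; lia.
  by case: (w k.+1) => // a _; rewrite subn1 /= binS addKn.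
have e1 : shifted_sum 1 d.+1 (fun k => w k.+1) = \sum_(1 <= k < d.+2) 'C(w k.+1 - 1, k) by [].
have sumw := shifted_sum_green_gap d.+2 w; rewrite vw in sumw.
suff : c' <= shifted_sum 1 d.+2 w + (0 < w 1) by lia.
have [v sv vv] := expansion_exists d.+1 g.+1.
have c'v : c' <= shifted_sum 1 d.+2 v by apply: gc sv _; rewrite vv gE.
apply: leq_trans c'v _; case: (posnP (w 1)) => [w10 | w1].
  rewrite addn0.
  (* raising the terms of w to the least nonzero ones makes the value at least c
     without changing the shifted sum *)
  pose u k := maxn (w k) k.
  have su : strict_upto d.+2 u by move=> k kd; have := sw k kd; rewrite /u; lia.
  have gu : shifted_sum 1 d.+2 u = shifted_sum 1 d.+2 w.
    rewrite /shifted_sum /weight !big_nat; apply: eq_bigr => k /andP[k1 kd].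
    have := wge k; rewrite /u; have [le | le] := leqP k (w k).
      by [].
    by move=> ?; rewrite !bin_small //; lia.
  rewrite -gu; apply: shifted_sum_mono => //; rewrite vv -vw /shifted_sum /weight.
  rewrite big_nat_recl // [X in _ <= X]big_nat_recl // !subn0 /u w10 /= bin0n add0n.
  rewrite max0n binn add1n ltnS; apply: leq_sum => k _.
  by apply: leq_bin2l; lia.
have : green_gap d.+2 w <= green_gap d.+2 v by apply: weight_mono growing_green_gap _ _ _ =>
  //; rewrite vv vw.
by have := shifted_sum_green_gap d.+2 v; rewrite vv; lia.
Qed.

End BinomialExpansions.

(** * The Koszul complex of a graded module *)

(** Successor by cases on the constructors.  Matrix dimensions depend on degrees, and
    [succz d] reduces where [d + 1] does not, so no casts are required. *)
Definition succz (d : int) : int :=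
  match d with Posz e => Posz e.+1 | Negz 0 => Posz 0 | Negz e.+1 => Negz e end.

Lemma succz_surj d : exists c, d = succz c.
Proof. by case: d => [[|e] | e]; [exists (Negz 0) | exists (Posz e) | exists (Negz e.+1)]. Qed.

Lemma succzE d : succz d = d + 1.
Proof. case: d => [e | [|e]] //; first by rewrite -PoszD addn1.
by rewrite /= !NegzE -[e.+2]addn1 PoszD opprD addrNK. Qed.

(** Dimensions in the Koszul complex on n elements with coefficients of dimension a,
    along the recursion of the mapping cone.  The index i is shifted by one: i = 0
    is the zero space in homological degree -1 and i.+1 is homological degree i. *)
Fixpoint kdim (a n i : nat) {struct n} : nat :=
  match n, i with
  | _, 0 => 0
  | 0, 1 => a
  | 0, _ => 0
  | n'.+1, i'.+1 => kdim a n' i'.+1 + kdim a n' i'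
  end.

Lemma kdim0 a n : kdim a n 0 = 0.
Proof. by case: n. Qed.

Lemma kdimS a n i : kdim a n i.+1 = ('C(n, i) * a)%N.
Proof.
elim: n i => [|n IH] [|i] /=; rewrite ?bin0 ?mul1n ?mul0n //.
  by rewrite kdim0 IH addn0 bin0 mul1n.
by rewrite !IH binS mulnDl.
Qed.

Section Koszul.
Variable K : fieldType.

(** The map of Koszul complexes induced by a map of coefficients, in one degree. *)
Fixpoint kmap (a b : nat) (f : 'M[K]_(a, b)) (n i : nat) {struct n} :
    'M[K]_(kdim a n i, kdim b n i) :=
  match n, i return 'M[K]_(kdim a n i, kdim b n i) with
  | 0, 0 => 0
  | 0, 1 => f
  | 0, _.+2 => 0
  | _.+1, 0 => 0
  | n'.+1, i'.+1 => block_mx (kmap f n' i'.+1) 0 0 (kmap f n' i')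
  end.

Lemma kdim0_row a n m (A : 'M[K]_(kdim a n 0, m)) : A = 0.
Proof. by move: A; rewrite kdim0 => A; rewrite flatmx0. Qed.

Lemma kdim0_col a n m (A : 'M[K]_(m, kdim a n 0)) : A = 0.
Proof. by move: A; rewrite kdim0 => A; rewrite thinmx0. Qed.

Lemma kmapM a b c (f : 'M_(a, b)) (g : 'M_(b, c)) n i :
  kmap (f *m g) n i = kmap f n i *m kmap g n i.
Proof.
elim: n i => [|n IH] [|i] /=; rewrite ?mul0mx //; first by case: i => [|i] //=; rewrite mul0mx.
by rewrite mulmx_block !mulmx0 !mul0mx !addr0 !add0r !IH.
Qed.

Lemma kmap_linear a b (c : K) (f g : 'M_(a, b)) n i :
  kmap (c *: f + g) n i = c *: kmap f n i + kmap g n i.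
Proof.
elim: n i => [|n IH] [|i] /=; rewrite ?scaler0 ?addr0 //.
  by case: i => [|i] //=; rewrite scaler0 addr0.
by rewrite scale_block_mx add_block_mx !IH !scaler0 !addr0.
Qed.

Lemma kmap0 a b n i : kmap (0 : 'M_(a, b)) n i = 0.
Proof.
by have := kmap_linear (-1) (0 : 'M_(a, b)) 0 n i; rewrite scaler0 addr0 scaleN1r addNr.
Qed.

Lemma kmapD a b (f g : 'M_(a, b)) n i : kmap (f + g) n i = kmap f n i + kmap g n i.
Proof. by have := kmap_linear 1 f g n i; rewrite !scale1r. Qed.

Lemma kmapZ a b c (f : 'M_(a, b)) n i : kmap (c *: f) n i = c *: kmap f n i.
Proof. by have := kmap_linear c f 0 n i; rewrite kmap0 !addr0. Qed.

Lemma kmap1 a n i : kmap (1%:M : 'M_a) n i = 1%:M.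
Proof.
elim: n i => [|n IH] [|i] /=.
- by rewrite [RHS]flatmx0.
- by case: i => [|i] //=; rewrite [RHS]flatmx0.
- by rewrite [RHS]flatmx0.
- by rewrite !IH -scalar_mx_block.
Qed.

Lemma rank_kmap a b (f : 'M_(a, b)) n i : \rank (kmap f n i.+1) = ('C(n, i) * \rank f)%N.
Proof.
elim: n i => [|n IH] [|i] /=; rewrite ?bin0 ?mul1n //.
- by rewrite mxrank0.
- by rewrite rank_diag_block_mx IH (kdim0_row (kmap f n 0)) mxrank0 addn0 bin0 mul1n.
- by rewrite rank_diag_block_mx !IH binS mulnDl.
Qed.

Lemma kmap_ker a b c (f : 'M_(a, b)) (g : 'M_(c, a)) n i :
  (kermx f :=: g)%MS -> (kermx (kmap f n i) :=: kmap g n i)%MS.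
Proof.
case: i => [|i] e.
  by rewrite (kdim0_col (kmap g n 0)) (kdim0_col (kermx _)); apply/eqmxP; rewrite !sub0mx.
apply/eqmxP; rewrite andbC -(geq_leqif (mxrank_leqif_eq _)).
  by rewrite mxrank_ker !rank_kmap kdimS -e mxrank_ker mulnBr.
apply/sub_kermxP; rewrite -kmapM (_ : g *m f = 0) ?kmap0 //.
by apply/sub_kermxP; rewrite e.
Qed.

(** Graded modules over the polynomial ring in all the x_k, k : nat, given by the
    matrices of the variables on row vectors.  Only the first n variables enter a
    Koszul complex on n elements, so quotients by the last variable need no
    reindexing. *)
Record gmod := GMod {
  gdim : int -> nat;
  gmul : nat -> forall d, 'M[K]_(gdim d, gdim (succz d));
  gmulC : forall k l d, gmul k d *m gmul l (succz d) = gmul l d *m gmul k (succz d)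
}.
Implicit Types M N Q : gmod.

Notation kc M n i d := (kdim (gdim M d) n i).

(** Mapping cone of the last variable acting on the complex on the other ones, with
    the sign on the shifted copy. *)
Fixpoint kdiff M (n i : nat) (d : int) {struct n} :
    'M[K]_(kc M n i.+1 d, kc M n i (succz d)) :=
  match n, i return 'M[K]_(kc M n i.+1 d, kc M n i (succz d)) with
  | 0, 0 => 0
  | 0, _.+1 => 0
  | _.+1, 0 => 0
  | n'.+1, i'.+1 =>
      block_mx (kdiff M n' i'.+1 d) 0 (kmap (gmul M n' d) n' i'.+1) (- kdiff M n' i' d)
  end.

Definition gmorph M N n (f : forall d, 'M[K]_(gdim M d, gdim N d)) : Prop :=
  forall k d, (k < n)%N -> gmul M k d *m f (succz d) = f d *m gmul N k d.

Lemma gmorphW M N n f : gmorph n.+1 f -> @gmorph M N n f.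
Proof. by move=> h k d kn; apply: h; rewrite ltnW. Qed.

Lemma kdiff_nat M N n f i d : @gmorph M N n f ->
  kdiff M n i d *m kmap (f (succz d)) n i = kmap (f d) n i.+1 *m kdiff N n i d.
Proof.
elim: n i => [|n IH] [|i] h /=; rewrite ?mul0mx ?mulmx0 //.
rewrite !mulmx_block !mulmx0 !mul0mx !addr0 !add0r (IH i.+1 (gmorphW h)).
by rewrite -!kmapM h // mulmxN mulNmx (IH i (gmorphW h)).
Qed.

(** Multiplication by any variable is an endomorphism of the complex; [kdiff_nat] does
    not cover it because it shifts the degree. *)
Lemma kdiff_gmul M k d (n i : nat) :
  kdiff M n i d *m kmap (gmul M k (succz d)) n i
    = kmap (gmul M k d) n i.+1 *m kdiff M n i (succz d).
Proof.
elim: n i => [|n IH] [|i] /=; rewrite ?mul0mx ?mulmx0 //.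
rewrite !mulmx_block !mulmx0 !mul0mx !addr0 !add0r (IH i.+1).
by rewrite -!kmapM gmulC mulmxN mulNmx (IH i).
Qed.

Lemma kdiff_kdiff M n i d : kdiff M n i.+1 d *m kdiff M n i (succz d) = 0.
Proof.
elim: n i => [|n IH] [|i] /=; rewrite ?mulmx0 ?mul0mx //.
rewrite mulmx_block !mulmx0 !mul0mx !addr0 !add0r IH !mulNmx !mulmxN opprK IH.
by rewrite kdiff_gmul subrr -block_mx0.
Qed.

(** The homology in homological degree i and module degree [succz d]; every degree is
    of this form by [succz_surj]. *)
Definition koszul_betti M n i d : nat :=
  (\rank (kermx (kdiff M n i (succz d))) - \rank (kdiff M n i.+1 d))%N.

Lemma kdiff_sub_ker M n i d : (kdiff M n i.+1 d <= kermx (kdiff M n i (succz d)))%MS.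
Proof. by apply/sub_kermxP; apply: kdiff_kdiff. Qed.

(** Vanishing homology is used in this form: cycles are boundaries. *)
Lemma koszul_betti0_exact M n i d (u : 'rV_(kc M n i.+1 (succz d))) :
  koszul_betti M n i d = 0%N -> u *m kdiff M n i (succz d) = 0 -> (u <= kdiff M n i.+1 d)%MS.
Proof.
move=> h0 /sub_kermxP u0; apply: submx_trans u0 _.
by rewrite -(geq_leqif (mxrank_leqif_sup (kdiff_sub_ker _ _ _ _))) -subn_eq0
  -/(koszul_betti _ _ _ _) h0.
Qed.

Lemma rank_mod m1 m2 p (A : 'M[K]_(m1, p)) (B : 'M_(m2, p)) :
  (\rank (A *m cokermx B) + \rank B)%N = \rank (A + B)%MS.
Proof.
rewrite addsmxC -(mxrank_mul_ker (B + A)%MS (cokermx B)); congr (_ + _)%N.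
  by rewrite (eqmxMr _ (addsmxE B A)) mul_col_mx mulmx_coker -(addsmxE 0 _) adds0mx.
apply: eqmx_rank; rewrite sub_capmx addsmxSl sub_kermx mulmx_coker eqxx /=.
by rewrite submxE -sub_kermx capmxSr.
Qed.

(** Homology is compared through ranks.  Z and B stand for cycles and for boundaries
    enlarged by a further space, ZQ and BQ for those of another complex. *)
Lemma rank_le_quotient m1 m2 m3 m4 p q (Z : 'M[K]_(m1, p)) (psi : 'M_(p, q))
    (ZQ : 'M_(m2, q)) (BQ : 'M_(m3, q)) (B : 'M_(m4, p)) :
  (Z *m psi <= ZQ)%MS -> (BQ <= ZQ)%MS ->
  (forall u : 'rV_p, (u <= Z)%MS -> (u *m psi <= BQ)%MS -> (u <= B)%MS) ->
  (\rank Z <= (\rank ZQ - \rank BQ) + \rank B)%N.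
Proof.
move=> sZ sB h; rewrite -(mxrank_mul_ker Z (psi *m cokermx BQ)); apply: leq_add.
  rewrite mulmxA; apply: leq_trans (mxrankS (submxMr _ sZ)) _.
  by rewrite -(leq_add2r (\rank BQ)) rank_mod subnK ?mxrankS // addsmx_sub submx_refl.
apply: mxrankS; apply/rV_subP => u; rewrite sub_capmx => /andP[uZ uk].
by apply: h => //; rewrite submxE -mulmxA -sub_kermx.
Qed.

Lemma rank_eq_quotient m1 m2 m3 m4 p q (Z : 'M[K]_(m1, p)) (psi : 'M_(p, q))
    (ZQ : 'M_(m2, q)) (BQ : 'M_(m3, q)) (B : 'M_(m4, p)) :
  (Z *m psi <= ZQ)%MS -> (BQ <= ZQ)%MS ->
  (forall u : 'rV_p, (u <= Z)%MS -> (u *m psi <= BQ)%MS -> (u <= B)%MS) ->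
  (ZQ <= Z *m psi + BQ)%MS -> (B <= Z)%MS -> (B *m psi <= BQ)%MS ->
  \rank Z = ((\rank ZQ - \rank BQ) + \rank B)%N.
Proof.
move=> sZ sB h zq bz bq; apply/eqP; rewrite eqn_leq (rank_le_quotient sZ sB h) /=.
rewrite -(mxrank_mul_ker Z (psi *m cokermx BQ)); apply: leq_add.
  by rewrite mulmxA leq_subLR addnC rank_mod mxrankS.
by apply: mxrankS; rewrite sub_capmx bz sub_kermx mulmxA -submxE.
Qed.

(** Q is M modulo the image of the n-th variable, as a module over the first n
    variables. *)
Record is_quotient M n Q (pi : forall d, 'M[K]_(gdim M d, gdim Q d)) : Prop := IsQuotient {
  quo_morph : gmorph n pi;
  quo_full : forall d, row_full (pi d);
  quo_ker : forall d, (kermx (pi (succz d)) :=: gmul M n d)%MS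
}.

Lemma kmap_full a b (f : 'M[K]_(a, b)) n i : row_full f -> row_full (kmap f n i).
Proof.
case: i => [|i]; first by rewrite /row_full => _; rewrite (kdim0_row (kmap f n 0)) mxrank0 kdim0.
by rewrite /row_full rank_kmap kdimS => /eqP ->.
Qed.

(** A chain over M whose image over Q = M/xM is a boundary is itself a boundary up to
    a multiple of x: lift the bounding chain, and the difference maps to zero. *)
Lemma kdiff_sub_imageP M n Q pi i d (u : 'rV_(kc M n i.+1 (succz d))) : @is_quotient M n Q pi ->
  (u *m kmap (pi (succz d)) n i.+1 <= kdiff Q n i.+1 d)%MS ->
  exists w v, u = w *m kdiff M n i.+1 d + v *m kmap (gmul M n d) n i.+1.
Proof.
move=> [pim pif pik] /submxP[w0 e].
have /submxP[w ew] : (w0 <= kmap (pi d) n i.+2)%MS by apply/submx_full/kmap_full.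
have : (u - w *m kdiff M n i.+1 d <= kmap (gmul M n d) n i.+1)%MS.
  rewrite -(kmap_ker _ _ (pik d)) sub_kermx mulmxBl -mulmxA (kdiff_nat _ _ pim).
  by rewrite mulmxA -ew e subrr.
by case/submxP => v ev; exists w, v; rewrite -ev addrC subrK.
Qed.

(** In the cone, a chain is a pair (u, v); u is reduced modulo the last variable and v
    is forgotten. *)
Definition kproj M n Q (pi : forall d, 'M[K]_(gdim M d, gdim Q d)) i d :
    'M_(kc M n.+1 i.+1 d, kc Q n i.+1 d) := col_mx (kmap (pi d) n i.+1) 0.

(** The pairs (0, v) with coefficients of v killed by the last variable. *)
Definition kker M n i d : 'M_(kc M n i d, kc M n.+1 i.+1 d) :=
  row_mx 0 (kmap (kermx (gmul M n d)) n i).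

Lemma rank_kker M n i d :
  \rank (kker M n i.+1 d) = ('C(n, i) * (gdim M d - \rank (gmul M n d)))%N.
Proof.
rewrite -mxrank_tr tr_row_mx trmx0 -(addsmxE 0 _) adds0mx mxrank_tr.
by rewrite rank_kmap mxrank_ker.
Qed.

Lemma kmap_killed M n i d p (f : 'M_(p, gdim M d)) :
  (forall k, (k < n)%N -> f *m gmul M k d = 0) -> kmap f n i.+1 *m kdiff M n i d = 0.
Proof.
elim: n i => [|m IH] [|j] fk /=; rewrite ?mulmx0 ?mul0mx //.
rewrite mulmx_block !mulmx0 !mul0mx !addr0 !add0r mulmxN !IH -?kmapM ?fk ?kmap0 ?oppr0
  -?block_mx0 //.
all: by move=> k km; apply: fk; rewrite ltnW.
Qed.

(** The conditions under which no homology is lost in passing to the quotient: the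
    projection has a section linear over the first n variables, and the kernel of
    the n-th variable is killed by these. *)
Record is_split M n Q (pi : forall d, 'M[K]_(gdim M d, gdim Q d))
    (sigma : forall d, 'M[K]_(gdim Q d, gdim M d)) : Prop := IsSplit {
  split_morph : gmorph n sigma;
  splitK : forall d, sigma d *m pi d = 1%:M;
  split_killed : forall k d, (k < n)%N -> kermx (gmul M n d) *m gmul M k d = 0
}.

(** A boundary of the form (0, v) with v over ker x is zero.  Let it be the boundary
    of (u, w), so that du + xw = 0 and v = - dw.  The complement 1 - pi sigma of the
    section moves u into xM, say to xu'; then x(du' + w) = 0, so du' + w has
    coefficients in ker x and is a cycle as the first n variables kill ker x.  Hence
    dw = 0. *)
Lemma kker_inter M n Q pi sigma i d : @is_quotient M n Q pi -> is_split n pi sigma ->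
  (kdiff M n.+1 i.+2 d :&: kker M n i.+1 (succz d))%MS = 0.
Proof.
have [d0 ->] := succz_surj d; move: {d} d0 => d qpi spl.
apply/eqP; rewrite -submx0; apply/rV_subP => u.
rewrite sub_capmx => /andP[/submxP[w ->]] {u}.
rewrite -[w]hsubmxK; move: (lsubmx w) (rsubmx w) => {w} u w.
rewrite /= mul_row_block mulmx0 add0r mulmxN => /submxP[y].
rewrite mul_mx_row mulmx0 => /eq_row_mx[eu ev].
suff -> : w *m kdiff M n i.+1 (succz d) = 0 by rewrite eu oppr0 row_mx0 sub0mx.
(* the projection onto xM along the section *)
pose r c := 1%:M - pi c *m sigma c : 'M_(gdim M c).
have rm : gmorph n r.
  move=> k c kn; rewrite /r mulmxBr mulmxBl mulmx1 mul1mx; congr (_ - _).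
  by rewrite mulmxA (quo_morph qpi) // -!mulmxA (split_morph spl).
have xpi c : gmul M n c *m pi (succz c) = 0 by apply/sub_kermxP; rewrite (quo_ker qpi).
have xr c : gmul M n c *m r (succz c) = gmul M n c.
  by rewrite /r mulmxBr mulmx1 mulmxA xpi mul0mx subr0.
have rpi c : r c *m pi c = 0.
  by rewrite /r mulmxBl mul1mx -mulmxA (splitK spl) mulmx1 subrr.
have /submxP[u' eu'] : (u *m kmap (r (succz d)) n i.+3 <= kmap (gmul M n d) n i.+3)%MS.
  by rewrite -(kmap_ker _ _ (quo_ker qpi d)) sub_kermx -mulmxA -kmapM rpi kmap0 mulmx0.
have := congr1 (mulmx^~ (kmap (r (succz (succz d))) n i.+2)) eu.
rewrite mulmxDl mul0mx -!mulmxA -kmapM xr (kdiff_nat _ _ rm) mulmxA eu'.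
rewrite -mulmxA -kdiff_gmul mulmxA -mulmxDl => /eqP; rewrite -sub_kermx.
rewrite (kmap_ker _ _ (eqmx_refl _)) => /submxP[z ez].
have := congr1 (mulmx^~ (kdiff M n i.+1 (succz d))) ez.
rewrite mulmxDl -!mulmxA kdiff_kdiff mulmx0 add0r kmap_killed ?mulmx0 // => k kn.
exact: split_killed spl _ _ kn.
Qed.

Section Step.
Variables (M Q : gmod) (n : nat) (pi : forall d, 'M[K]_(gdim M d, gdim Q d)).
Hypothesis qpi : is_quotient n pi.
Variables (i : nat) (d : int).
Let e := succz d.
Let Z := kermx (kdiff M n.+1 i.+1 e).
Let B := kdiff M n.+1 i.+2 d.
Let ZQ := kermx (kdiff Q n i.+1 e).
Let BQ := kdiff Q n i.+2 d.
Let psi := kproj n pi i.+1 e.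

Let cycleE (u : 'rV_(kc M n i.+2 e)) (v : 'rV_(kc M n i.+1 e)) : (row_mx u v <= Z)%MS =
  (u *m kdiff M n i.+1 e + v *m kmap (gmul M n e) n i.+1 == 0) && (v *m kdiff M n i e == 0).
Proof.
rewrite sub_kermx /= mul_row_block mulmx0 add0r mulmxN row_mx_eq0.
by rewrite oppr_eq0.
Qed.

Let cycle_proj : (Z *m psi <= ZQ)%MS.
Proof.
apply/sub_kermxP; rewrite -mulmxA.
have -> : psi *m kdiff Q n i.+1 e =
    kdiff M n.+1 i.+1 e *m kproj n pi i (succz e).
  rewrite /psi /kproj mul_col_mx mul0mx /= mul_block_col !mulmx0 !addr0.
  rewrite (kdiff_nat _ _ (quo_morph qpi)) -kmapM -[gmul M n e *m _]/(gmul M n e *m pi (succz e)).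
  suff -> : gmul M n e *m pi (succz e) = 0 by rewrite kmap0.
  by apply/sub_kermxP; rewrite (quo_ker qpi).
by rewrite mulmxA mulmx_ker mul0mx.
Qed.

(** If u bounds over the quotient, subtracting a boundary makes u = 0, and then the
    cycle condition says that v has coefficients in ker x. *)
Let kernel_proj (u : 'rV_(kc M n.+1 i.+2 e)) :
  (u <= Z)%MS -> (u *m psi <= BQ)%MS -> (u <= B + kker M n i.+1 e)%MS.
Proof.
rewrite -[u]hsubmxK; move: (lsubmx u) (rsubmx u) => {}u v uvZ.
rewrite /psi /kproj mul_row_col mulmx0 addr0 => /(kdiff_sub_imageP qpi)[w [v' eu]].
have cB : (row_mx w v' *m B <= Z)%MS by apply: submx_trans (submxMl _ _) (kdiff_sub_ker _ _ _ _).
have eB : row_mx w v' *m B = row_mx u (- (v' *m kdiff M n i.+1 d)).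
  by rewrite /B /= mul_row_block mulmx0 add0r mulmxN eu.
have : (row_mx u v - row_mx w v' *m B <= Z)%MS by apply: addmx_sub uvZ _; rewrite eqmx_opp.
rewrite eB opp_row_mx add_row_mx subrr cycleE mul0mx add0r => /andP[v0 _].
rewrite -[row_mx u v](subrK (row_mx w v' *m B)) addrC.
apply: addmx_sub_adds; first exact: submxMl.
rewrite eB opp_row_mx add_row_mx subrr.
have : (v - - (v' *m kdiff M n i.+1 d) <= kmap (kermx (gmul M n e)) n i.+1)%MS.
  by rewrite -(kmap_ker n i.+1 (eqmx_refl (kermx (gmul M n e)))) sub_kermx.
by case/submxP => y ->; rewrite /kker -{1}(mulmx0 _ y) -mul_mx_row submxMl.
Qed.

Let bq_zq : (BQ <= ZQ)%MS. Proof. exact: kdiff_sub_ker. Qed.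

(** Cycles project to cycles over Q, and by [kernel_proj] those that project to
    boundaries are boundaries up to the pairs counted by the second summand. *)
Lemma koszul_betti_step : (koszul_betti M n.+1 i.+1 d <= koszul_betti Q n i.+1 d +
  'C(n, i) * (gdim M e - \rank (gmul M n e)))%N.
Proof.
have := rank_le_quotient cycle_proj bq_zq kernel_proj.
rewrite /koszul_betti -/Z -/B -/ZQ -/BQ -rank_kker => h.
rewrite leq_subLR; apply: leq_trans h _; rewrite addnCA leq_add2l.
by apply: leq_trans (mxrank_adds_leqif _ _) _.
Qed.

Variable sigma : forall d, 'M[K]_(gdim Q d, gdim M d).
Hypothesis spl : is_split n pi sigma.

(** The section lifts every cycle over Q, and the pairs of [kker] are cycles that meet
    the boundaries in 0 by [kker_inter]. *)
Lemma koszul_betti_step_split : koszul_betti M n.+1 i.+1 d = (koszul_betti Q n i.+1 d +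
  'C(n, i) * (gdim M e - \rank (gmul M n e)))%N.
Proof.
have kkerZ : (kker M n i.+1 e <= Z)%MS.
  apply/sub_kermxP; rewrite /kker /= mul_row_block !mul0mx !add0r mulmxN.
  rewrite kmap_killed ?oppr0 -?kmapM ?mulmx_ker ?kmap0 ?row_mx0 // => k kn.
  exact: split_killed spl _ _ kn.
have BZ : (B <= Z)%MS by exact: kdiff_sub_ker.
have kpsi : kker M n i.+1 e *m psi = 0.
  by rewrite /kker /psi /kproj mul_row_col mul0mx mulmx0 addr0.
have Bpsi : (B *m psi <= BQ)%MS.
  rewrite /psi /kproj /B /= mul_block_col !mulmx0 !addr0.
  rewrite (kdiff_nat _ _ (quo_morph qpi)) -kmapM.
  have -> : gmul M n d *m pi e = 0 by apply/sub_kermxP; rewrite (quo_ker qpi).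
  by rewrite kmap0 col_mx_sub sub0mx submxMl.
have ZQs : (ZQ <= Z *m psi + BQ)%MS.
  apply: submx_trans (addsmxSl _ _).
  have -> : ZQ = row_mx (ZQ *m kmap (sigma e) n i.+2) 0 *m psi.
    by rewrite /psi /kproj mul_row_col mul0mx addr0 -mulmxA -kmapM (splitK spl) kmap1 mulmx1.
  apply: submxMr; apply/sub_kermxP; rewrite /= mul_row_block mulmx0 !mul0mx !addr0.
  by rewrite -mulmxA -(kdiff_nat _ _ (split_morph spl)) mulmxA mulmx_ker mul0mx row_mx0.
have := rank_eq_quotient cycle_proj bq_zq kernel_proj ZQs _ _.
rewrite addsmx_sub BZ kkerZ => /(_ isT).
rewrite (eqmxMr _ (addsmxE _ _)) mul_col_mx col_mx_sub Bpsi kpsi sub0mx => /(_ isT).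
rewrite (mxrank_disjoint_sum (kker_inter i d qpi spl)) rank_kker /koszul_betti -/Z -/B -/ZQ
  -/BQ => ->.
by rewrite addnCA addKn.
Qed.
End Step.
End Koszul.

(** * Linear changes of coordinates and extension of scalars *)

Section Coordinates.
Variable K : fieldType.
Implicit Types M : gmod K.
Notation kc M n i d := (kdim (gdim M d) n i).

(** The contraction of multiplication by x_k: wedging with the k-th basis vector of the
    exterior algebra, in the basis given by the iterated cone. *)
Fixpoint khomotopy (a n k i : nat) {struct n} : 'M[K]_(kdim a n i, kdim a n i.+1) :=
  match n, i return 'M[K]_(kdim a n i, kdim a n i.+1) with
  | 0, _ => 0
  | _.+1, 0 => 0
  | n'.+1, i'.+1 =>
      if k == n' then block_mx 0 1%:M 0 0
      else block_mx (khomotopy a n' k i'.+1) 0 0 (- khomotopy a n' k i')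
  end.

Lemma khomotopy_nat a b (f : 'M[K]_(a, b)) n k i :
  kmap f n i *m khomotopy b n k i = khomotopy a n k i *m kmap f n i.+1.
Proof.
elim: n i => [|n IH] [|i] /=; rewrite ?mul0mx ?mulmx0 //.
case: eqP => _; rewrite !mulmx_block !mulmx0 !mul0mx !addr0 !add0r.
  by rewrite mulmx1 mul1mx.
by rewrite mulmxN mulNmx !IH.
Qed.

Lemma khomotopyP M n k i d : (k < n)%N ->
  kdiff M n i d *m khomotopy (gdim M (succz d)) n k i + khomotopy (gdim M d) n k i.+1 *m kdiff
    M n i.+1 d
    = kmap (gmul M k d) n i.+1.
Proof.
elim: n i => // n IH i; rewrite ltnS leq_eqVlt.
have H0 m p (A : 'M[K]_(kc M n 0 m, p)) : A = 0 by apply: kdim0_row.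
case: i => [|i]; have [-> _ | /negPf kn /= lt] := eqVneq k n; rewrite /= ?eqxx ?kn ?mul0mx ?add0r.
- rewrite mulmx_block !mulmx0 !mul0mx mul1mx !mul1mx !addr0 !add0r.
  by congr block_mx; [exact: kdim0_col | rewrite [RHS]H0].
- rewrite mulmx_block !mulmx0 !mul0mx !addr0 !add0r -IH // (kdim0_col (kdiff M n 0 d)) mul0mx
  add0r.
  by congr block_mx; rewrite [LHS]H0 ?[RHS]H0 // kdim0_col.
- rewrite !mulmx_block !mulmx0 !mul0mx !mulmx1 !mul1mx !addr0 !add0r add_block_mx.
  by rewrite !add0r !addr0 subrr.
- rewrite !mulmx_block !mulmx0 !mul0mx !addr0 !add0r add_block_mx !addr0.
  by rewrite mulmxN !mulNmx mulmxN !opprK !IH // khomotopy_nat addrN.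
Qed.

Definition linear_form_mx M n (c : nat -> K) d : 'M_(gdim M d, gdim M (succz d)) :=
  \sum_(k < n) c k *: gmul M k d.

Lemma linear_form_mx_comm M n c k d :
  linear_form_mx M n c d *m gmul M k (succz d) = gmul M k d *m linear_form_mx M n c (succz d).
Proof.
rewrite /linear_form_mx mulmx_suml mulmx_sumr; apply: eq_bigr => l _.
by rewrite -scalemxAl -scalemxAr gmulC.
Qed.

(** Only the last variable is replaced.  This suffices, because the Koszul complex is
    peeled from the last variable down. *)
Definition recoord_x M n c k d : 'M_(gdim M d, gdim M (succz d)) :=
  if k == n then linear_form_mx M n.+1 c d else gmul M k d.

Lemma recoordC M n c k l d :
  recoord_x M n c k d *m recoord_x M n c l (succz d) =
  recoord_x M n c l d *m recoord_x M n c k (succz d).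
Proof.
rewrite /recoord_x; case: eqP => _; case: eqP => _ //; rewrite ?linear_form_mx_comm //.
exact: gmulC.
Qed.

Definition recoord M n c : gmod K := GMod (@recoordC M n c).

Lemma kdiff_recoord M n c m i d : (m <= n)%N -> kdiff (recoord M n c) m i d = kdiff M m i d.
Proof.
elim: m i => [|m IH] [|i] //= mn; rewrite !IH 1?ltnW //.
by rewrite /recoord_x (ltn_eqF mn).
Qed.

Let hsum (c : nat -> K) a n i : 'M_(kdim a n i, kdim a n i.+1) :=
  \sum_(k < n) c k *: khomotopy a n k i.

Let hsumP M n c i d :
  kdiff M n i d *m hsum c (gdim M (succz d)) n i + hsum c (gdim M d) n i.+1 *m kdiff M n i.+1 d
    = kmap (linear_form_mx M n c d) n i.+1.
Proof.
rewrite /hsum /linear_form_mx mulmx_sumr mulmx_suml -big_split /=.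
rewrite (big_morph (fun f => kmap f n i.+1) (fun f g => kmapD f g n i.+1) (kmap0 _ _ _ n i.+1)).
by apply: eq_bigr => k _; rewrite kmapZ -khomotopyP // scalerDr -scalemxAl -scalemxAr.
Qed.

(** The form sum_k c_k x_k over k < n is null-homotopic on the complex on the first n
    variables, and a homotopy between two maps gives an isomorphism of their cones. *)
Let theta (c : nat -> K) a n i : 'M_(kdim a n.+1 i.+1) :=
  block_mx 1%:M 0 (hsum c a n i) (c n)%:M.

Let theta_unit c a n i : c n != 0 -> theta c a n i \in unitmx.
Proof. by move=> cn; rewrite unitmxE det_lblock det1 mul1r det_scalar unitfE expf_neq0. Qed.

Let thetaP M n c i d :
  kdiff (recoord M n c) n.+1 i.+1 d *m theta c (gdim M (succz d)) n i =
  theta c (gdim M d) n i.+1 *m kdiff M n.+1 i.+1 d.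
Proof.
rewrite /= !kdiff_recoord // /recoord_x eqxx /theta !mulmx_block !mulmx0 !mul0mx !mulmx1 !mul1mx.
rewrite !addr0 !add0r mulmxN mul_mx_scalar !mulNmx mul_scalar_mx.
congr (block_mx _ _ _ _); last by rewrite scalerN mul_scalar_mx.
rewrite {1}/linear_form_mx big_ord_recr /= -/(linear_form_mx M n c d) kmapD kmapZ -hsumP.
by rewrite addrC -!addrA addKr.
Qed.

Lemma rank_kdiff_recoord M n c i d : c n != 0 ->
  \rank (kdiff (recoord M n c) n.+1 i.+1 d) = \rank (kdiff M n.+1 i.+1 d).
Proof.
move=> cn.
have u1 := theta_unit (gdim M (succz d)) i cn; have u2 := theta_unit (gdim M d) i.+1 cn.
have := congr1 (fun A => \rank A) (thetaP M n c i d).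
rewrite mxrankMfree ?row_free_unit // => ->.
by rewrite (eqmxMfull _ (_ : row_full _)) ?row_full_unit.
Qed.

Lemma koszul_betti_recoord M n c i d : c n != 0 ->
  koszul_betti (recoord M n c) n.+1 i.+1 d = koszul_betti M n.+1 i.+1 d.
Proof. by move=> cn; rewrite /koszul_betti !mxrank_ker !rank_kdiff_recoord. Qed.

End Coordinates.

Section ScalarExtension.
Variables (K L : fieldType) (phi : {rmorphism K -> L}).
Implicit Types M : gmod K.

Lemma gmod_mapC M k l d :
  map_mx phi (gmul M k d) *m map_mx phi (gmul M l (succz d)) =
  map_mx phi (gmul M l d) *m map_mx phi (gmul M k (succz d)).
Proof. by rewrite -!map_mxM gmulC. Qed.

Definition gmod_map M : gmod L := GMod (@gmod_mapC M).

Lemma kmap_map a b (f : 'M[K]_(a, b)) n i :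
  kmap (map_mx phi f) n i = map_mx phi (kmap f n i).
Proof.
elim: n i => [|n IH] [|i] /=; rewrite ?map_mx0 //; first by case: i => [|i] //; rewrite map_mx0.
by rewrite map_block_mx !map_mx0 !IH.
Qed.

Lemma kdiff_map M n i d : kdiff (gmod_map M) n i d = map_mx phi (kdiff M n i d).
Proof.
elim: n i => [|n IH] [|i] /=; rewrite ?map_mx0 //.
by rewrite map_block_mx map_mxN map_mx0 !IH kmap_map.
Qed.

Lemma koszul_betti_map M n i d : koszul_betti (gmod_map M) n i d = koszul_betti M n i d.
Proof. by rewrite /koszul_betti !mxrank_ker !kdiff_map !mxrank_map. Qed.

End ScalarExtension.

(** * Generic linear forms *)
Section Generic.
Variable K : fieldType.

(** The form in which infinity of the field is used; for the fraction field of K[t]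
    it holds by counting roots. *)
Definition infinite_field : Prop := forall p : {poly K}, p != 0 -> exists t, p.[t] != 0.

(** Genericity through lines only: around each of its points, on each line, the set
    contains the complement of the zeros of a polynomial.  This is enough to
    intersect two nonempty such sets, along the line that joins a point of each. *)
Definition line_open (U : (nat -> K) -> Prop) : Prop :=
  forall c0 v, U c0 -> exists2 p : {poly K}, p.[0] != 0 &
    forall t c, p.[t] != 0 -> (forall k, c k = c0 k + t * v k) -> U c.

Definition generic (U : (nat -> K) -> Prop) : Prop := line_open U /\ exists c, U c.

Lemma genericI U V : infinite_field -> generic U -> generic V ->
  generic (fun c => U c /\ V c).
Proof.
move=> inf [oU [c1 U1]] [oV [c2 V2]]; split.
  move=> c0 v [U0 V0]; have [p p0 pU] := oU c0 v U0; have [q q0 qV] := oV c0 v V0.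
  exists (p * q); first by rewrite hornerM mulf_neq0.
  move=> t c; rewrite hornerM mulf_eq0 negb_or => /andP[pt qt] ct.
  by split; [apply: pU ct | apply: qV ct].
have [p p0 pU] := oU c1 (fun k => c2 k - c1 k) U1.
have [q q0 qV] := oV c2 (fun k => c1 k - c2 k) V2.
(* t parametrizes the line from c1 to c2, and 1 - t the same line from c2 to c1 *)
have [|t] := inf (p * (q \Po (1 - 'X))).
  rewrite mulf_neq0 //; first by apply: contraNneq p0 => ->; rewrite horner0.
  apply: contraNneq q0 => e; have := congr1 (fun r => r.[1]) e.
  by rewrite horner_comp !hornerE subrr => ->.
rewrite hornerM mulf_eq0 negb_or horner_comp !hornerE => /andP[pt qt].
exists (fun k => c1 k + t * (c2 k - c1 k)); split; first exact: pU pt _.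
by apply: qV qt _ => k; ring.
Qed.

Definition lincomb p q n (A : nat -> 'M[K]_(p, q)) (c : nat -> K) := \sum_(k < n) c k *: A k.

(** A nonzero minor at the base point remains nonzero off the zeros of a polynomial in the
    parameter of the line; the minor is found by projecting on the row and column
    spaces at the base point. *)
Lemma line_open_rank p q n (A : nat -> 'M[K]_(p, q)) r :
  line_open (fun c => (r <= \rank (lincomb n A c))%N).
Proof.
move=> c0 v; set F := lincomb n A c0; set V := lincomb n A v => rF.
set s := \rank F in rF *.
pose P := (pid_mx s : 'M_(s, p)) *m invmx (col_ebase F).
pose Q := invmx (row_ebase F) *m (pid_mx s : 'M_(q, s)).
have PFQ : P *m F *m Q = 1%:M.
  rewrite -[F in P *m F]mulmx_ebase /P /Q.
  rewrite -!mulmxA (mulKVmx (row_ebase_unit F)) (mulKmx (col_ebase_unit F)) !pid_mx_id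
    ?rank_leq_col ?rank_leq_row ?pid_mx_1 //.
(* the minor along the line, normalized to 1 at the base point *)
pose D : 'M[{poly K}]_s := 1%:M + 'X *: map_mx polyC (P *m V *m Q).
have De t : (\det D).[t] = \det (1%:M + t *: (P *m V *m Q)).
  rewrite -horner_evalE -det_map_mx; congr (\det _).
  apply/matrixP => i j; rewrite !mxE /= horner_evalE hornerD hornerM hornerX hornerC.
  by rewrite hornerMn hornerE.
exists (\det D); first by rewrite De scale0r addr0 det1 oner_neq0.
move=> t c; rewrite De -unitfE -unitmxE => u ct.
have -> : lincomb n A c = F + t *: V.
  rewrite /F /V /lincomb scaler_sumr -big_split; apply: eq_bigr => k _ /=.
  by rewrite ct scalerDl scalerA.
apply: leq_trans rF _.
have : \rank (P *m (F + t *: V) *m Q) = s.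
  by rewrite mulmxDr mulmxDl PFQ -scalemxAr -scalemxAl mxrank_unit.
by move=> {1}<-; apply: leq_trans (mxrankM_maxl _ _) (mxrankM_maxr _ _).
Qed.

Definition max_rank p q n (A : nat -> 'M[K]_(p, q)) (c : nat -> K) : Prop :=
  forall c', (\rank (lincomb n A c') <= \rank (lincomb n A c))%N.

Lemma generic_max_rank p q n (A : nat -> 'M[K]_(p, q)) : generic (max_rank n A).
Proof.
have [c0 max0] : exists c, max_rank n A c.
  suff max x : (exists c, (p - x <= \rank (lincomb n A c))%N) -> exists c, max_rank n A c.
    by apply: (max p); exists (fun=> 0); rewrite subnn.
  elim: x => [|x IH] [c hc].
    by exists c => c'; apply: leq_trans (rank_leq_row _) _; rewrite -[X in (X <= _)%N]subn0.
  case: (classic (exists c', (p - x <= \rank (lincomb n A c'))%N)) => [/IH // | no].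
  exists c => c'; rewrite leqNgt; apply/negP => lt; apply: no; exists c'.
  by lia.
split; last by exists c0.
move=> c1 v max1; have [q' q0 h] := @line_open_rank p q n A (\rank (lincomb n A c1)) c1 v
  (leqnn _).
by exists q' => // t c qt ct c'; apply: leq_trans (max1 c') (h t c qt ct).
Qed.

Lemma generic_coord k : generic (fun c => c k != 0).
Proof.
split; last by exists (fun=> 1); rewrite oner_neq0.
move=> c0 v n0; exists ((c0 k)%:P + v k *: 'X); first by rewrite !hornerE ?mulr0 ?addr0.
by move=> t c; rewrite !hornerE => h ->; rewrite mulrC.
Qed.

End Generic.

(** * Quotients of graded modules *)
Section Quotient.
Variable K : fieldType.
Implicit Types M : gmod K.

(** Generation of each degree e + 1 > 0 by degree e, in dual form: a linear map that
    vanishes on the images of all variables vanishes.  In this form it passes to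
    quotients at once. *)
Definition standard n M : Prop := forall (e : nat) p (N : 'M[K]_(gdim M (Posz e.+1), p)),
  (forall k, (k < n)%N -> gmul M k (Posz e) *m N = 0) -> N = 0.

Section QuotientModule.
Variables (M : gmod K) (a : int -> nat) (pi : forall d, 'M[K]_(gdim M d, a d)).
Hypothesis full : forall d, row_full (pi d).
Hypothesis stable : forall k d, kermx (pi d) *m gmul M k d *m pi (succz d) = 0.

Let x k d := pinvmx (pi d) *m gmul M k d *m pi (succz d).

Let pix k d : pi d *m x k d = gmul M k d *m pi (succz d).
Proof.
have : (1%:M - pi d *m pinvmx (pi d) <= kermx (pi d))%MS.
  by apply/sub_kermxP; rewrite mulmxBl mul1mx -mulmxA mulVpmx // mulmx1 subrr.
case/submxP => y /(congr1 (fun z => z *m gmul M k d *m pi (succz d))).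
have st : kermx (pi d) *m (gmul M k d *m pi (succz d)) = 0 by rewrite mulmxA stable.
rewrite /= -(mulmxA (y *m kermx (pi d))) -(mulmxA y) st mulmx0 -mulmxA mulmxBl mul1mx => /eqP.
by rewrite subr_eq0 /x -!mulmxA => /eqP.
Qed.

Let xC k l d : x k d *m x l (succz d) = x l d *m x k (succz d).
Proof.
apply: (row_full_inj (full d)).
have pixx k' l' : pi d *m (x k' d *m x l' (succz d)) =
    gmul M k' d *m gmul M l' (succz d) *m pi (succz (succz d)).
  by rewrite mulmxA pix -mulmxA pix mulmxA.
by rewrite !pixx gmulC.
Qed.

(** The quotient of M by the kernels of surjections pi d that are stable under the
    variables; both M/fM and fM, for a linear form f, are obtained in this way. *)
Definition quotient_mod : gmod K := GMod xC.

Lemma quotient_modP k d : pi d *m gmul quotient_mod k d = gmul M k d *m pi (succz d).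
Proof. exact: pix. Qed.

Lemma quotient_standard n : standard n M -> standard n quotient_mod.
Proof.
move=> sM e p N h; apply: (row_full_inj (full _)); rewrite mulmx0; apply: sM => k kn.
by rewrite mulmxA -[gmul M k e *m _](quotient_modP k e) -mulmxA h // mulmx0.
Qed.

End QuotientModule.

Definition central M (f : forall d, 'M[K]_(gdim M d, gdim M (succz d))) : Prop :=
  forall k d, f d *m gmul M k (succz d) = gmul M k d *m f (succz d).

(** The image of f in degree d.  Cases on d avoid a transport along d = succz c. *)
Definition incoming M (f : forall d, 'M[K]_(gdim M d, gdim M (succz d))) (d : int) :
  'M[K]_(gdim M d) :=
  match d return 'M[K]_(gdim M d) with
  | Posz 0 => <<f (Negz 0)>>%MS
  | Posz e.+1 => <<f (Posz e)>>%MS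
  | Negz e => <<f (Negz e.+1)>>%MS
  end.

Lemma incomingE M f d : (@incoming M f (succz d) :=: f d)%MS.
Proof. by case: d => [e|[|e]] /=; apply: genmxE. Qed.

Definition pi_coker M f d := col_base (cokermx (@incoming M f d)).

Lemma pi_coker_full M f d : row_full (@pi_coker M f d).
Proof. exact: col_base_full. Qed.

Lemma pi_coker_ker M f d : (kermx (@pi_coker M f (succz d)) :=: f d)%MS.
Proof.
apply: eqmx_trans (incomingE f d); apply/eqmxP/rV_eqP => u.
rewrite sub_kermx submxE -[in RHS](mulmx_base (cokermx _)) mulmxA.
by rewrite [RHS](mulmx_free_eq0 _ (row_base_free _)).
Qed.

Lemma pi_coker_stable M f k d : central f ->
  kermx (@pi_coker M f d) *m gmul M k d *m pi_coker f (succz d) = 0.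
Proof.
have [c ->] := succz_surj d => fC.
have /submxP[y ->] : (kermx (pi_coker f (succz c)) <= f c)%MS by rewrite pi_coker_ker.
rewrite -[y *m _ *m _]mulmxA fC -!mulmxA.
suff -> : f (succz c) *m pi_coker f (succz (succz c)) = 0 by rewrite !mulmx0.
by apply/sub_kermxP; rewrite pi_coker_ker.
Qed.

Lemma image_stable M f k d : @central M f ->
  kermx (col_base (f d)) *m gmul M k d *m col_base (f (succz d)) = 0.
Proof.
move=> fC; apply: (row_free_inj (row_base_free (f (succz d)))).
have kf : kermx (col_base (f d)) *m f d = 0.
  by rewrite -[X in _ *m X]mulmx_base mulmxA mulmx_ker mul0mx.
by rewrite -mulmxA mulmx_base mul0mx -mulmxA -fC mulmxA kf mul0mx.
Qed.

Definition coker_mod M f (fC : @central M f) : gmod K :=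
  quotient_mod (pi_coker_full f) (fun k d => pi_coker_stable k d fC).

(** The module fM: in degree d it is the row space of f d, so its degree is that of the
    factor from M. *)
Definition image_mod M f (fC : @central M f) : gmod K :=
  quotient_mod (fun d => col_base_full (f d)) (fun k d => image_stable k d fC).

Lemma gdim_coker M f fC d : gdim (@coker_mod M f fC) (succz d)
  = (gdim M (succz d) - \rank (f d))%N.
Proof.
by rewrite /= mxrank_coker incomingE.
Qed.

Lemma gdim_coker_le M f fC d : (gdim (@coker_mod M f fC) d <= gdim M d)%N.
Proof. by rewrite /= mxrank_coker leq_subr. Qed.

Lemma linear_form_mx_central M n c : central (linear_form_mx M n c).
Proof. by move=> k d; apply: linear_form_mx_comm. Qed.

Lemma gmul_central M n : central (gmul M n).
Proof. by move=> k d; apply: gmulC. Qed.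

Lemma coker_is_quotient M n :
  is_quotient n (pi_coker (gmul M n) : forall d,
    'M_(gdim M d, gdim (coker_mod (@gmul_central M n)) d)).
Proof.
split=> [k d _ | d | d]; [by rewrite -quotient_modP | exact: pi_coker_full | exact: pi_coker_ker].
Qed.

Lemma standard_recoord M n c : c n != 0 -> standard n.+1 M -> standard n.+1 (recoord M n c).
Proof.
move=> cn sM e p N h; apply: sM => k.
have lt l : (l < n)%N -> gmul M l e *m N = 0.
  by move=> ln; have := h l (ltnW ln); rewrite /= /recoord_x (ltn_eqF ln).
rewrite ltnS leq_eqVlt => /predU1P[-> | /lt //].
have := h n (ltnSn n); rewrite /= /recoord_x eqxx /linear_form_mx big_ord_recr /= mulmxDl
  mulmx_suml.
rewrite big1 => [|l _]; last by rewrite -scalemxAl lt // scaler0.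
by rewrite add0r -scalemxAl => /eqP; rewrite scaler_eq0 (negPf cn) /= => /eqP.
Qed.

Lemma standard_coker M n : standard n.+1 M -> standard n (coker_mod (@gmul_central M n)).
Proof.
move=> sM e p N h; apply: (row_full_inj (pi_coker_full _ _)); rewrite mulmx0; apply: sM => k.
rewrite ltnS leq_eqVlt => /predU1P[-> | kn]; rewrite mulmxA.
  suff -> : gmul M n e *m pi_coker (gmul M n) (Posz e.+1) = 0 by rewrite mul0mx.
  by apply/sub_kermxP; rewrite (pi_coker_ker _ e).
have := quotient_modP (pi_coker_full (gmul M n))
  (fun k d => pi_coker_stable k d (@gmul_central M n)) k e.
by move=> /= <-; rewrite -mulmxA [_ *m N]h // mulmx0.
Qed.

End Quotient.

(** * Green's theorem and the bound on Koszul homology *)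

Section Green.
Variable K : fieldType.
Hypothesis inf : infinite_field K.
Implicit Types M : gmod K.

Definition max_at n M d c := max_rank n (fun k => gmul M k d) c.

Lemma linear_form_mx_coord M n k d : (k < n)%N -> linear_form_mx M n (fun l => (l == k)%:R) d
  = gmul M k d.
Proof.
move=> kn; rewrite /linear_form_mx (bigD1 (Ordinal kn)) //= eqxx scale1r big1 ?addr0 // => l.
by rewrite -val_eqE /= => /negPf ->; rewrite scale0r.
Qed.

Lemma max_rank_gt0 n M (e : nat) c : standard n M -> max_at n M e c -> (0 < gdim M e.+1)%N ->
  (0 < \rank (linear_form_mx M n c e))%N.
Proof.
move=> sM cmax; apply: contraTT; rewrite -!eqn0Ngt => /eqP r0.
have x0 k : (k < n)%N -> gmul M k e = 0.
  move=> kn; apply/eqP; rewrite -mxrank_eq0 -(@linear_form_mx_coord M n) // -leqn0 -r0.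
  exact: cmax.
have /(congr1 (fun A => \rank A)) : (1%:M : 'M[K]_(gdim M e.+1)) = 0.
  by apply: sM => k kn; rewrite x0 // mul0mx.
by rewrite mxrank1 mxrank0 => /eqP.
Qed.

(** Green's hyperplane restriction theorem, by induction on the degree and on the
    dimension in that degree.  For two generic forms l and l', the kernel of
    A/l' -> A/(l, l') is a quotient of lA/l'lA; the inductive hypotheses apply to
    A/l and to lA (one degree lower), and [green_numeric] combines them. *)
Lemma green e n M c : standard n M -> max_at n M (Posz e) c ->
  green_bound e.+1 (gdim M e.+1) (gdim M e.+1 - \rank (linear_form_mx M n c e)).
Proof.
elim: e M c => [|e IHe] M c sM cmax.
  move=> m _; rewrite /shifted_sum !weightS !weight0 !add0n !bin1 subn0.
  have [b0 | b0] := posnP (gdim M (Posz 1)); first by rewrite /= in b0 *; lia.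
  by have := max_rank_gt0 sM cmax b0; move: b0 => /=; lia.
have [N] := ubnP (gdim M e.+2); elim: N M sM c cmax => // N IHN M sM c cmax; rewrite ltnS => leN.
have [b0 | b0] := posnP (gdim M e.+2); first by move=> m _ _; lia.
(* any form of maximal rank has the rank of c, so the two forms may be chosen anew *)
have [_ [c1 max1]] := @generic_max_rank K _ _ n (fun k => gmul M k e.+1).
set X1 := linear_form_mx M n c1 e.+1.
have c1C := @linear_form_mx_central K M n c1.
pose B := coker_mod c1C; pose E := image_mod c1C.
have [_ [c2 [max2 [maxB maxE]]]] :
    generic (fun c2 => max_at n M e.+1 c2 /\ (max_at n B e.+1 c2 /\ max_at n E e c2)).
  by do 2?[apply: (genericI inf)]; apply: generic_max_rank.
set X2 := linear_form_mx M n c2 e.+1.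
have r1 : \rank (linear_form_mx M n c e.+1) = \rank X1.
  by apply/eqP; rewrite eqn_leq max1 cmax.
have r2 : \rank X2 = \rank X1 by apply/eqP; rewrite eqn_leq max1 max2.
have r0 : (0 < \rank X1)%N by exact: max_rank_gt0 sM max1 b0.
have rle : (\rank X1 <= gdim M e.+2)%N by exact: rank_leq_col.
rewrite r1.
have sB : standard n B by apply: quotient_standard.
have sE : standard n E by apply: quotient_standard.
have gB : gdim B e.+2 = (gdim M e.+2 - \rank X1)%N by exact: (gdim_coker c1C e.+1).
have hB : green_bound e.+2 (gdim M e.+2 - \rank X1)
    (gdim M e.+2 - \rank X1 - \rank (linear_form_mx B n c2 e.+1)).
  have := IHN B sB c2 maxB; move: (\rank (linear_form_mx B n c2 e.+1)) => rB.
  by rewrite gB; apply; lia.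
have hE : green_bound e.+1 (\rank X1) (\rank X1 - \rank (linear_form_mx E n c2 e)) by exact:
  IHe E c2 sE maxE.
have xq P (piP : forall d, 'M[K]_(gdim M d, gdim P d)) d :
    (forall k d, piP d *m gmul P k d = gmul M k d *m piP (succz d)) ->
  piP d *m linear_form_mx P n c2 d = linear_form_mx M n c2 d *m piP (succz d).
  move=> h; rewrite /linear_form_mx mulmx_suml mulmx_sumr; apply: eq_bigr => k _.
  by rewrite -scalemxAl -scalemxAr h.
have rankB : (\rank (linear_form_mx B n c2 e.+1) + \rank X1)%N = \rank (X2 + X1)%MS.
  have e1 := xq B (pi_coker (linear_form_mx M n c1)) e.+1
    (quotient_modP (pi_coker_full _) (fun k d => pi_coker_stable k d c1C)).
  have -> : \rank (linear_form_mx B n c2 e.+1)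
    = \rank (X2 *m pi_coker (linear_form_mx M n c1) (succz e.+1)).
    by rewrite -e1 (eqmxMfull _ (pi_coker_full _ _)).
  have sub12 := addsmxSr X2 X1.
  rewrite -(mxrank_mul_ker (X2 + X1)%MS (pi_coker (linear_form_mx M n c1) (succz e.+1)));
    congr (_ + _)%N.
    rewrite (eqmxMr _ (addsmxE _ _)) mul_col_mx -addsmxE.
    have -> : X1 *m pi_coker (linear_form_mx M n c1) (succz e.+1) = 0.
      by apply/sub_kermxP; rewrite pi_coker_ker.
    by rewrite addsmx0.
  by rewrite (cap_eqmx (eqmx_refl _) (pi_coker_ker _ _)) (capmx_idPr sub12).
(* l'lA lies in the intersection of lA and l'A *)
have rankE : (\rank (linear_form_mx E n c2 e) <= \rank (X1 :&: X2)%MS)%N.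
  have e1 := xq E (fun d => col_base (linear_form_mx M n c1 d)) e
    (quotient_modP (fun d => col_base_full _) (fun k d => image_stable k d c1C)).
  have -> : \rank (linear_form_mx E n c2 e) = \rank (linear_form_mx M n c2 e *m X1).
    rewrite -[X1]mulmx_base mulmxA mxrankMfree ?row_base_free //.
    by rewrite -[linear_form_mx M n c2 e *m _]e1 (eqmxMfull _ (col_base_full _)).
  apply: mxrankS; rewrite sub_capmx submxMl /=.
  have -> : linear_form_mx M n c2 e *m X1 = linear_form_mx M n c1 e *m X2.
    rewrite /X1 /X2 [in LHS]/linear_form_mx [linear_form_mx M n c2 e.+1]/linear_form_mx
      mulmx_suml mulmx_sumr.
    by apply: eq_bigr => k _; rewrite -scalemxAl -scalemxAr -(linear_form_mx_comm M n c1 k e).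
  exact: submxMl.
have rs := mxrank_sum_cap X2 X1.
have rc : \rank (X1 :&: X2)%MS = \rank (X2 :&: X1)%MS by rewrite capmxC.
have rs1 : (\rank (X2 + X1)%MS <= gdim M e.+2)%N by exact: rank_leq_col.
apply: (green_numeric (leq_subr _ _) hB); first by rewrite subKn //; exact: hE.
by move: r0 rle rankB rankE rs rc rs1 r2; lia.
Qed.

Lemma succz_nat d (e : nat) : succz d = Posz e.+1 -> d = e.
Proof. by case: d => [f [->] | [|f]]. Qed.

(** One step of [koszul_betti_step] for each variable, after replacing the last
    variable by a generic form.  The sequences a and b record the dimensions of the
    successive quotients in two consecutive degrees.  The dimension of ker x is
    a_j - (b_j - b_(j+1)), which is stated without subtraction. *)
Lemma koszul_betti_upper_infinite n M i d (e : nat) : standard n M -> succz d = e ->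
  exists a b : nat -> nat,
  [/\ a 0 = gdim M e /\ b 0 = gdim M e.+1,
      forall j, (a j.+1 <= a j)%N /\ ((0 < e)%N -> green_bound e (a j) (a j.+1)),
      forall j, green_bound e.+1 (b j) (b j.+1) &
      (koszul_betti M n i.+1 d + \sum_(j < n) 'C(n - 1 - j, i) * b j <=
       \sum_(j < n) 'C(n - 1 - j, i) * (a j + b j.+1))%N].
Proof.
move=> sM ed; elim: n M sM => [|n IH] M sM.
  (* no variables are left, so the Koszul homology in positive degrees is zero *)
  exists (fun j => if j == 0 then gdim M e else 0), (fun j => if j == 0 then gdim M e.+1 else 0).
  split=> //; by rewrite !big_ord0 addn0 /koszul_betti mxrank_ker sub0n.
have [_ [c [cn [maxc maxc']]]] : generic (fun c => c n != 0 /\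
    (max_at n.+1 M e c /\ max_at n.+1 M d c)).
  apply: (genericI inf); first exact: generic_coord.
  by apply: (genericI inf); apply: generic_max_rank.
pose M' := recoord M n c; pose Q := coker_mod (@gmul_central K M' n).
have xM' f : gmul M' n f = linear_form_mx M n.+1 c f by rewrite /= /recoord_x eqxx.
have sQ : standard n Q by apply/standard_coker/standard_recoord.
have [a [b [[a0 b0] ha hb le]]] := IH Q sQ.
exists (fun j => if j is j'.+1 then a j' else gdim M e).
exists (fun j => if j is j'.+1 then b j' else gdim M e.+1).
have bE : b 0 = (gdim M e.+1 - \rank (linear_form_mx M n.+1 c e))%N.
  by rewrite b0 -xM'; exact: (gdim_coker (@gmul_central K M' n) e).
split=> // [[|j] | [|j] |].
- split; first by rewrite a0; exact: gdim_coker_le.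
  case: (e) a0 ed => // e' a0 ed _.
  have de := succz_nat ed; rewrite de in maxc'.
  have -> : a 0 = (gdim M e'.+1 - \rank (linear_form_mx M n.+1 c e'))%N.
    by rewrite a0 -xM'; exact: (gdim_coker (@gmul_central K M' n) e').
  exact: green.
- exact: ha.
- by rewrite bE; apply: green.
- exact: hb.
have qM' := coker_is_quotient M' n.
have := koszul_betti_step qM' i d; rewrite (koszul_betti_recoord M i d cn) ed xM' -/Q => step.
rewrite !big_ord_recl /= subn1 subn0 /=.
have re : (\rank (linear_form_mx M n.+1 c e) <= gdim M e.+1)%N by exact: rank_leq_col.
have re' : (\rank (linear_form_mx M n.+1 c e) <= gdim M e)%N by exact: rank_leq_row.
have sh (F : nat -> nat) : (\sum_(j < n) 'C(n - bump 0 j, i) * F (bump 0 j) =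
    \sum_(j < n) 'C(n - 1 - j, i) * F j.+1)%N.
  apply: eq_bigr => j _; rewrite /bump leq0n add1n.
  by have -> : (n - j.+1 = n - 1 - j)%N by lia.
have := sh (fun j => if j is j'.+1 then b j' else gdim M e.+1); rewrite /= => ->.
have := sh (fun j => (if j is j'.+1 then a j' else gdim M e) + b j)%N; rewrite /= => ->.
have cE : ('C(n, i) * (gdim M e + b 0) =
    'C(n, i) * (gdim M' e - \rank (linear_form_mx M n.+1 c e)) + 'C(n, i) * gdim M e.+1)%N.
  rewrite -mulnDr; congr (_ * _)%N; move: re re'; rewrite bE; change (gdim M' e) with (gdim M e).
  by move: (\rank _) => r; lia.
rewrite cE; move: le step.
move: (\sum_(j < n) _)%N (\sum_(j < n) _)%N => x y.
by move: (_ * gdim M e.+1)%N (_ * (_ - _))%N (koszul_betti _ _ _ _) (koszul_betti _ _ _ _); lia.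
Qed.
End Green.

(** * Arbitrary ground fields *)

(** The dual form does not transfer by itself: it is first turned into an identity
    expressing 1 through the images of the variables, which any field extension
    preserves. *)
Lemma standard_map (K L : fieldType) (phi : {rmorphism K -> L}) n (M : gmod K) :
  standard n M -> standard n (gmod_map phi M).
Proof.
move=> sM e p N h.
have /submxP[D eD] : (1%:M <= \sum_(k < n) <<gmul M k (Posz e)>>)%MS.
  rewrite submxE mul1mx; apply/eqP; apply: sM => k kn; apply/eqP.
  by rewrite -submxE (sumsmx_sup (Ordinal kn)) // genmxE.
have : (1%:M <= \sum_(k < n) <<gmul M k (Posz e)>>)%MS by rewrite eD submxMl.
case/sub_sumsmxP => C eC.
have {}eC := congr1 (map_mx phi) eC; rewrite map_mx1 in eC.
rewrite -[N]mul1mx eC map_mx_sum mulmx_suml big1 // => k _.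
have /submxP[y ->] : (C k *m <<gmul M k (Posz e)>> <= gmul M k (Posz e))%MS.
  by apply: submx_trans (submxMl _ _) _; rewrite genmxE.
by rewrite map_mxM -mulmxA h // mulmx0.
Qed.

Lemma infinite_fraction (K : fieldType) : infinite_field {fraction {poly K}}.
Proof.
move=> p p0; pose s := [seq tofrac ('X^i : {poly K}) | i <- iota 0 (size p)].
have us : uniq s.
  rewrite map_inj_uniq ?iota_uniq // => i j /eqP;
    rewrite tofrac_eq => /eqP /(congr1 (fun q : {poly K} => size q)).
  by rewrite !size_polyXn => -[].
have : ~~ all (root p) s.
  by apply/negP => rs; have := max_poly_roots p0 rs us; rewrite size_map size_iota ltnn.
by case/allPn => t _ nt; exists t.
Qed.

(** The ground field is extended to the fraction field of K[t], which is infinite. *)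
Lemma koszul_betti_upper (K : fieldType) n (M : gmod K) i d (e : nat) :
  standard n M -> succz d = e ->
  exists a b : nat -> nat,
  [/\ a 0 = gdim M e /\ b 0 = gdim M e.+1,
      forall j, (a j.+1 <= a j)%N /\ ((0 < e)%N -> green_bound e (a j) (a j.+1)),
      forall j, green_bound e.+1 (b j) (b j.+1) &
      (koszul_betti M n i.+1 d + \sum_(j < n) 'C(n - 1 - j, i) * b j <=
       \sum_(j < n) 'C(n - 1 - j, i) * (a j + b j.+1))%N].
Proof.
move=> sM ed; pose phi : {rmorphism K -> {fraction {poly K}}} :=
  (@FracField.tofrac {poly K}) \o polyC.
have [a [b [ab ha hb le]]] := koszul_betti_upper_infinite (@infinite_fraction K) i
  (standard_map (phi := phi) sM) ed.
by exists a, b; split=> //; rewrite -(koszul_betti_map phi M).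
Qed.

(** * The numbers beta as sums of shifted expansions *)

Lemma binomial_nat (a k : nat) : Defs.binomial a%:R k = 'C(a, k)%:R.
Proof.
have k0 : k`!%:R != 0 :> rat by rewrite pnatr_eq0 -lt0n fact_gt0.
apply: (mulIf k0); rewrite /Defs.binomial mulfVK // -natrM bin_ffact ffact_prod.
have [ka | ak] := leqP k a.
  rewrite natr_prod; apply: eq_bigr => l _; rewrite natrB //.
  by apply: leq_trans (ltnW (ltn_ord l)) ka.
rewrite (bigD1 (Ordinal ak)) //= subrr mul0r.
by rewrite (bigD1 (Ordinal ak)) //= subnn mul0n.
Qed.

#[local] Arguments Defs.binomial : simpl never.

(** Below the first index s, the value k - 1 makes the terms vanish and the sequence
    strict. *)
Definition full_expansion (e : nat * (nat -> nat)) (k : nat) : nat :=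
  if (e.1 <= k)%N then e.2 k else k.-1.

Section Expansion.
Variables (d b : nat) (e : nat * (nat -> nat)).
Hypothesis he : is_binomial_expansion d b e.

Lemma expansion_ge k : (e.1 <= k <= d)%N -> (k <= e.2 k)%N.
Proof.
have [s1 inc lead _] := he; elim: k => // k IH /andP[sk kd].
have [eqs | ] := eqVneq e.1 k.+1; first by have := lead; rewrite eqs; apply.
by move=> ne; have := IH; have := inc k; lia.
Qed.

Lemma full_expansion_strict : strict_upto d (full_expansion e).
Proof.
have [s1 inc _ _] := he; move=> k /andP[k1 kd]; rewrite /full_expansion.
case: (leqP e.1 k) => sk; first by rewrite (leqW sk) inc // sk.
case: (leqP e.1 k.+1) => sk1; last by lia.
by have := @expansion_ge k.+1; lia.
Qed.

Lemma shifted_sum_full_expansion j :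
  shifted_sum j d (full_expansion e) = (\sum_(e.1 <= k < d.+1) 'C(e.2 k - j, k))%N.
Proof.
have [/andP[s1 sd] _ _ _] := he.
rewrite /shifted_sum /weight (big_cat_nat (n := e.1)) //= big_nat big1 ?add0n => [|k kk].
  by rewrite !big_nat; apply: eq_bigr => k /andP[sk _]; rewrite /full_expansion sk.
by rewrite /full_expansion leqNgt; case/andP: kk => k1 -> /=; rewrite bin_small //; lia.
Qed.

Lemma expansion_value : shifted_sum 0 d (full_expansion e) = b.
Proof.
have [_ _ _ ->] := he; rewrite shifted_sum_full_expansion.
by apply: eq_bigr => k _; rewrite subn0.
Qed.

(** Since h(d) is at most the number of monomials of degree d, the inner sums of beta,
    which run up to m_k - k, end before j = n. *)
Lemma expansion_lt n k : (0 < d)%N -> (b <= 'C(n + d.-1, d))%N -> (e.1 <= k <= d)%N ->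
  (e.2 k < n + k)%N.
Proof.
move=> d0 le kk; have [/andP[s1 sd] inc _ bE] := he.
have ld : (e.2 d < n + d)%N.
  rewrite ltnNge; apply/negP => ge; move: le; rewrite leqNgt; apply/negP.
  rewrite negbK bE big_nat_recr /=; last by lia.
  apply: leq_trans (leq_addl _ _); apply: leq_trans (leq_bin2l d ge).
  case: (d) d0 => // d' _; rewrite addnS binS /= -addn1 leq_add2l bin_gt0; lia.
have step x : (x <= d - e.1)%N -> (e.2 (d - x) < n + (d - x))%N.
  elim: x => [|x IH] xd; first by rewrite subn0.
  have := inc (d - x.+1)%N; have -> : ((d - x.+1).+1 = d - x)%N by lia.
  by move=> h; have := IH; lia.
by have := step (d - k)%N; rewrite subKn; lia.
Qed.
End Expansion.

Lemma binomial_expansion_spec d b : (0 < d)%N ->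
  is_binomial_expansion d b (binomial_expansion d b).
Proof.
case: d => // d _; rewrite /binomial_expansion; apply: epsilon_spec.
have [m sm vm] := expansion_exists d b.
pose P k := (0 < k)%N && ((k <= m k)%N || (k == d.+2)).
have exP : exists k, P k by exists d.+2; rewrite /P eqxx orbT.
case: (ex_minnP exP) => s /andP[s1 /orP Ps] smin.
have sd : (s <= d.+2)%N by apply: smin; rewrite /P eqxx orbT.
exists (s, m); split=> /=; first by rewrite s1.
- by move=> k /andP[sk kd]; apply: sm; rewrite kd (leq_trans s1 sk).
- by move=> sd'; case: Ps => // /eqP e; move: sd'; rewrite e ltnn.
rewrite -vm /shifted_sum /weight (big_cat_nat (n := s)) //= big_nat big1 ?add0n =>
  [|k /andP[k1 ks]].
  by apply: eq_bigr => k _; rewrite subn0.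
rewrite subn0 bin_small // ltnNge; apply/negP => km.
by have := smin k; rewrite /P k1 km /= => /(_ isT); rewrite leqNgt ks.
Qed.

Lemma shifted_sum_unique j d m m' : strict_upto d m -> strict_upto d m' ->
  shifted_sum 0 d m = shifted_sum 0 d m' -> shifted_sum j d m = shifted_sum j d m'.
Proof. move=> s s' e; apply/eqP; rewrite eqn_leq.
by rewrite (shifted_sum_mono j s s' (eq_leq e)) (shifted_sum_mono j s' s (eq_leq (esym e))). Qed.

Lemma sum_expansion_pos d b e n (i : nat) : is_binomial_expansion d b e -> (0 < d)%N ->
  (b <= 'C(n + d.-1, d))%N ->
  \sum_(e.1 <= k < d.+1) \sum_(0 <= j < (e.2 k - k).+1)
     Defs.binomial ((e.2 k)%:R - j%:R) k * Defs.binomial (n%:R - 1 - j%:R) i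
  = (\sum_(j < n) 'C(n - 1 - j, i) * shifted_sum j d (full_expansion e))%:R.
Proof.
move=> he d0 le; rewrite natr_sum.
under [RHS]eq_bigr => j _ do rewrite (shifted_sum_full_expansion he) big_distrr natr_sum /=.
rewrite exchange_big /= !big_nat; apply: eq_bigr => k /andP[sk kd].
have kk : (e.1 <= k <= d)%N by rewrite sk.
have k1 : (0 < k)%N by have [/andP[s1 _] _ _ _] := he; apply: leq_trans sk.
have km := expansion_ge he kk; have mn := expansion_lt he d0 le kk.
have lej : ((e.2 k - k).+1 <= n)%N by lia.
rewrite big_mkord (big_ord_widen n (fun j => Defs.binomial ((e.2 k)%:R - j%:R) k *
   Defs.binomial (n%:R - 1 - j%:R) i) lej) big_mkcond /=.
apply: eq_bigr => j _; have jn := ltn_ord j; case: ifP => ltj.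
  have -> : (e.2 k)%:R - j%:R = (e.2 k - j)%:R :> rat by rewrite natrB //; lia.
  have -> : n%:R - 1 - j%:R = (n - 1 - j)%:R :> rat by rewrite !natrB //; lia.
  by rewrite !binomial_nat -natrM mulnC.
by rewrite [X in (_ * X)%:R]bin_small ?muln0 //; lia.
Qed.

(** Pascal's rule: 'C(m_k - 1 - j, k - 1) = 'C(m_k - j, k) - 'C(m_k - j - 1, k). *)
Lemma sum_expansion_neg d b e n (i : nat) : is_binomial_expansion d b e -> (0 < d)%N ->
  (b <= 'C(n + d.-1, d))%N ->
  \sum_(e.1 <= k < d.+1) \sum_(0 <= j < (e.2 k - k).+1)
     Defs.binomial ((e.2 k)%:R - 1 - j%:R) (k%:Z - 1) * Defs.binomial (n%:R - 1 - j%:R) i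
  = (\sum_(j < n) 'C(n - 1 - j, i) * shifted_sum j d (full_expansion e))%:R
    - (\sum_(j < n) 'C(n - 1 - j, i) * shifted_sum j.+1 d (full_expansion e))%:R.
Proof.
move=> he d0 le; rewrite !natr_sum -sumrB.
under [RHS]eq_bigr => j _ do
  rewrite !(shifted_sum_full_expansion he) !big_distrr !natr_sum -sumrB /=.
rewrite exchange_big /= !big_nat; apply: eq_bigr => k /andP[sk kd].
have kk : (e.1 <= k <= d)%N by rewrite sk.
have k1 : (0 < k)%N by have [/andP[s1 _] _ _ _] := he; apply: leq_trans sk.
have km := expansion_ge he kk; have mn := expansion_lt he d0 le kk.
have lej : ((e.2 k - k).+1 <= n)%N by lia.
rewrite big_mkord (big_ord_widen n (fun j => Defs.binomial ((e.2 k)%:R - 1 - j%:R) (k%:Z - 1) *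
   Defs.binomial (n%:R - 1 - j%:R) i) lej) big_mkcond /=.
apply: eq_bigr => j _; have jn := ltn_ord j; case: ifP => ltj.
  have -> : (e.2 k)%:R - 1 - j%:R = (e.2 k - 1 - j)%:R :> rat by rewrite !natrB //; lia.
  have -> : n%:R - 1 - j%:R = (n - 1 - j)%:R :> rat by rewrite !natrB //; lia.
  have -> : k%:Z - 1 = k.-1 by lia.
  rewrite !binomial_nat -!natrM -natrB; last by apply/leq_mul/leq_bin2l => //; lia.
  rewrite -mulnBr mulnC; congr (_ * _)%:R.
  case: (k) k1 km ltj => // k' _ km ltj.
  have -> : (e.2 k'.+1 - j = (e.2 k'.+1 - j.+1).+1)%N by lia.
  rewrite binS addKn; congr 'C(_, _); lia.
have -> : 'C(e.2 k - j, k) = 0 by rewrite bin_small //; lia.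
have -> : 'C(e.2 k - j.+1, k) = 0 by rewrite bin_small //; lia.
by rewrite muln0 subrr.
Qed.

(** The positive part of sum_(j < n) 'C(n-1-j, i) (a_j - b_j + b_(j+1)); the negative
    part is [bound_neg].  Apart, both stay in nat. *)
Definition bound_pos n i (a b : nat -> nat) := (\sum_(j < n) 'C(n - 1 - j, i) * (a j + b j.+1))%N.
Definition bound_neg n i (b : nat -> nat) := (\sum_(j < n) 'C(n - 1 - j, i) * b j)%N.

(** The expansions chosen in the definition of beta can be exchanged for any others of
    the same value, by [shifted_sum_unique]. *)
Lemma beta_main_sum h n (i e : nat) nn mm :
  (0 < e)%N -> (h e <= 'C(n + e.-1, e))%N -> (h e.+1 <= 'C(n + e, e.+1))%N ->
  strict_upto e nn -> shifted_sum 0 e nn = h e -> strict_upto e.+1 mm -> shifted_sum 0 e.+1 mm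
    = h e.+1 ->
  beta_main h n i e.+1 = (bound_pos n i (fun j => shifted_sum j e nn)
    (fun j => shifted_sum j e.+1 mm))%:R
    - (bound_neg n i (fun j => shifted_sum j e.+1 mm))%:R.
Proof.
move=> e0 he he1 snn vnn smm vmm; rewrite /beta_main /=.
have := binomial_expansion_spec (h e) e0; have := @binomial_expansion_spec e.+1 (h e.+1) isT.
case E1 : (binomial_expansion e (h e)) => [t nn']; case E2 : (binomial_expansion _ _) => [s mm'].
move=> h2 h1; rewrite (sum_expansion_pos i h1 e0 he) (sum_expansion_neg i h2 _ he1) //.
have g1 j : shifted_sum j e (full_expansion (t, nn')) = shifted_sum j e nn.
  by apply: shifted_sum_unique (full_expansion_strict h1) snn _; rewrite (expansion_value h1).
have g2 j : shifted_sum j e.+1 (full_expansion (s, mm')) = shifted_sum j e.+1 mm.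
  by apply: shifted_sum_unique (full_expansion_strict h2) smm _; rewrite (expansion_value h2).
under eq_bigr => j _ do rewrite g1.
under [X in _ - (X%:R - _)]eq_bigr => j _ do rewrite g2.
under [X in _ - (_ - X%:R)]eq_bigr => j _ do rewrite g2.
rewrite opprB addrA; congr (_ - _); rewrite -natrD /bound_pos -big_split /=; congr _%:R.
by apply: eq_bigr => j _; rewrite mulnDr.
Qed.

(** Abel summation: with D_j = b'_j - b_j >= 0 and D_0 = 0, the change in the terms
    b_(j+1) - b_j is the sum of the 'C(n-1-j, i) (D_(j+1) - D_j), and it is nonnegative
    as the coefficients decrease with j. *)
Lemma bound_mono n i (a a' b b' : nat -> nat) x :
  (forall j, a j <= a' j)%N -> (forall j, b j <= b' j)%N -> b 0 = b' 0 ->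
  (x + bound_neg n i b <= bound_pos n i a b)%N ->
  (x + bound_neg n i b' <= bound_pos n i a' b')%N.
Proof.
move=> ha hb b0; rewrite /bound_neg /bound_pos.
have E (u v : nat -> nat) : (\sum_(j < n) 'C(n - 1 - j, i) * (u j + v j.+1) =
    \sum_(j < n) 'C(n - 1 - j, i) * u j + \sum_(j < n) 'C(n - 1 - j, i) * v j.+1)%N.
  by rewrite -big_split; apply: eq_bigr => j _; rewrite mulnDr.
rewrite !E => le.
have le1 : (\sum_(j < n) 'C(n - 1 - j, i) * a j <= \sum_(j < n) 'C(n - 1 - j, i) * a' j)%N.
  by apply: leq_sum => j _; rewrite leq_mul2l ha orbT.
suff : (\sum_(j < n) 'C(n - 1 - j, i) * b' j + \sum_(j < n) 'C(n - 1 - j, i) * b j.+1 <=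
        \sum_(j < n) 'C(n - 1 - j, i) * b j + \sum_(j < n) 'C(n - 1 - j, i) * b' j.+1)%N by lia.
pose D j := (b' j - b j)%N.
have bD j : b' j = (b j + D j)%N by rewrite /D subnKC.
suff : (\sum_(j < n) 'C(n - 1 - j, i) * D j <= \sum_(j < n) 'C(n - 1 - j, i) * D j.+1)%N.
  have -> : (\sum_(j < n) 'C(n - 1 - j, i) * b' j =
     \sum_(j < n) 'C(n - 1 - j, i) * b j + \sum_(j < n) 'C(n - 1 - j, i) * D j)%N.
    by rewrite -big_split; apply: eq_bigr => j _; rewrite bD mulnDr.
  have -> : (\sum_(j < n) 'C(n - 1 - j, i) * b' j.+1 =
     \sum_(j < n) 'C(n - 1 - j, i) * b j.+1 + \sum_(j < n) 'C(n - 1 - j, i) * D j.+1)%N.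
    by rewrite -big_split; apply: eq_bigr => j _; rewrite bD mulnDr.
  lia.
have D0 : D 0 = 0%N by rewrite /D b0 subnn.
case: (n) => [|m]; first by rewrite !big_ord0.
(* pair the (j+1)-st term on the left with the j-th on the right *)
rewrite big_ord_recl D0 muln0 add0n [X in (_ <= X)%N]big_ord_recr /=.
apply: leq_trans (leq_addr _ _); apply: leq_sum => j _.
by rewrite leq_mul2r; apply/orP; right; apply: leq_bin2l; rewrite /bump leq0n; lia.
Qed.

(** With a_j = 1 and b_j = h - j, the factor a_j - b_j + b_(j+1) is 0 for j < h and 1
    from there on, and the remaining coefficients add up to 'C(n - h, i + 1). *)
Lemma linear_bound n i h : (h <= n)%N ->
  (bound_neg n i (fun j => h - j) + 'C(n - h, i.+1) =
   bound_pos n i (fun=> 1) (fun j => h - j))%N.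
Proof.
rewrite /bound_neg /bound_pos; elim: n h => [|n IH] h hn.
  by rewrite !big_ord0 bin0n.
rewrite !big_ord_recl !subn0 !subn1 /=.
have sh (F : nat -> nat) : (\sum_(j < n) 'C(n - bump 0 j, i) * F (bump 0 j) =
    \sum_(j < n) 'C(n - 1 - j, i) * F j.+1)%N.
  apply: eq_bigr => j _; rewrite /bump leq0n add1n.
  by have -> : (n - j.+1 = n - 1 - j)%N by lia.
rewrite (sh (fun j => h - j)%N) (sh (fun j => 1 + (h - j.+1))%N).
case: h hn => [|h] hn.
  rewrite subn0 binS; have := IH 0 (leq0n n); rewrite subn0.
  have e1 : (\sum_(j < n) 'C(n - 1 - j, i) * (0 - j) = 0)%N.
    by rewrite big1 // => j _; rewrite muln0.
  by rewrite e1 !add0n muln0 !add0n => ->; rewrite -[(1 + 0.-1)%N]/1%N muln1 addnC.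
have := IH h hn; rewrite subSS.
have e1 : (\sum_(j < n) 'C(n - 1 - j, i) * (h.+1 - j.+1)
  = \sum_(j < n) 'C(n - 1 - j, i) * (h - j))%N.
  by apply: eq_bigr => j _; rewrite subSS.
have e2 : (\sum_(j < n) 'C(n - 1 - j, i) * (1 + (h.+1 - j.+2)) =
  \sum_(j < n) 'C(n - 1 - j, i) * (1 + (h - j.+1)))%N.
  by apply: eq_bigr => j _; rewrite subSS.
rewrite e1 e2 => <-; rewrite add1n addnA; congr (_ + _ + _)%N.
Qed.

(** * Dimension shifting along an exact sequence *)

Section Shift.
Variable K : fieldType.
Implicit Types M E G : gmod K.
Notation kc M n i d := (kdim (gdim M d) n i).

Lemma rank_eq_ker m p q (X : 'M[K]_(m, p)) (Y : 'M_(m, q)) :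
  (forall u : 'rV_m, (u *m X == 0) = (u *m Y == 0)) -> \rank X = \rank Y.
Proof.
move=> h; have e : (kermx X :=: kermx Y)%MS.
  by apply/eqmxP/rV_eqP => u; rewrite !sub_kermx h.
have := mxrank_ker X; rewrite e mxrank_ker => ee.
by apply/eqP; rewrite -(eqn_add2l (m - \rank X)) subnK ?rank_leq_row // -ee subnK ?rank_leq_row.
Qed.

(** Both sides are the dimension of W modulo the same subspace. *)
Lemma rank_subquotient m w p q m1 m2 (W : 'M[K]_(m, w)) (P : 'M_(w, p)) (Q : 'M_(w, q))
    (B1 : 'M_(m1, p)) (B2 : 'M_(m2, q)) :
  (forall u : 'rV_w, (u <= W)%MS -> (u *m P <= B1)%MS = (u *m Q <= B2)%MS) ->
  (\rank (W *m P + B1)%MS - \rank B1 = \rank (W *m Q + B2)%MS - \rank B2)%N.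
Proof.
move=> h; rewrite -!rank_mod !addnK; apply: rank_eq_ker => u.
rewrite (mulmxA u (W *m P)) (mulmxA u W) -submxE h ?submxMl //.
by rewrite (mulmxA u (W *m Q)) (mulmxA u W) -submxE.
Qed.

(** The Koszul homology of ker f in homological degree i and degree [succz d], as
    cycles with coefficients in ker f modulo boundaries of chains with coefficients
    in ker f.  It is expressed inside the complex of E, without building the module
    ker f. *)
Definition kerhom E G (f : forall d, 'M[K]_(gdim E d, gdim G d)) n i d : nat :=
  (\rank (kermx (kdiff E n i (succz d)) :&: kermx (kmap (f (succz d)) n i.+1))%MS -
   \rank (kermx (kmap (f d) n i.+2) *m kdiff E n i.+1 d))%N.

Lemma kerhom0 M n i d : kerhom (fun d => 0 : 'M_(gdim M d)) n i d = koszul_betti M n i d.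
Proof.
rewrite /kerhom /koszul_betti !kmap0.
have k0 a b : (kermx (0 : 'M[K]_(a, b)) :=: 1%:M)%MS.
  by apply/eqmxP; rewrite submx1 sub_kermx mulmx0 eqxx.
rewrite (cap_eqmx (eqmx_refl _) (k0 _ _)) capmx1 (eqmxMr _ (k0 _ _)) mul1mx.
by [].
Qed.

Section Step.
Variables (E' E G : gmod K) (n : nat).
Variables (g : forall d, 'M[K]_(gdim E' d, gdim E d)) (f : forall d, 'M[K]_(gdim E d, gdim G d)).
Hypotheses (gm : gmorph n g) (fm : gmorph n f).
Hypothesis exact : forall d, (kermx (f d) :=: g d)%MS.

Let gf0 d i : kmap (g d) n i *m kmap (f d) n i = 0.
Proof. by apply/sub_kermxP; rewrite (kmap_ker _ _ (exact d)). Qed.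

Let B_sub_Z i d : (kermx (kmap (f d) n i.+2) *m kdiff E n i.+1 d <=
  kermx (kdiff E n i (succz d)) :&: kermx (kmap (f (succz d)) n i.+1))%MS.
Proof.
rewrite sub_capmx; apply/andP; split; apply/sub_kermxP.
  by rewrite -mulmxA kdiff_kdiff mulmx0.
by rewrite -mulmxA (kdiff_nat _ _ fm) mulmxA mulmx_ker mul0mx.
Qed.

(** The connecting map of 0 -> ker g -> E' -> ker f -> 0: as the homology of E' vanishes,
    that of ker f is the kernel of H_i(ker g) -> H_i(E'). *)
Lemma kerhom_step i d : koszul_betti E' n i.+1 d = 0%N ->
  kerhom f n i.+1 d =
  (\rank (kermx (kmap (g (succz (succz d))) n i.+1) :&: kdiff E' n i.+1 (succz d))%MS -
   \rank (kermx (kmap (g (succz d)) n i.+2) *m kdiff E' n i.+1 (succz d)))%N.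
Proof.
move=> acyc; rewrite /kerhom.
pose W := kermx (kdiff E' n i.+1 (succz d) *m kmap (g (succz (succz d))) n i.+1).
pose P := kmap (g (succz d)) n i.+2; pose Q := kdiff E' n i.+1 (succz d).
set Z1 := (_ :&: _)%MS; set B1 := (_ *m kdiff E n i.+2 d); set Z2 := (_ :&: _)%MS;
  set B2 := (_ *m _).
have WP : W *m P *m kdiff E n i.+1 (succz d) = 0.
  by rewrite -(mulmxA W) -(kdiff_nat _ _ gm) mulmx_ker.
have z1 : (W *m P + B1 :=: Z1)%MS.
  apply/eqmxP; rewrite addsmx_sub B_sub_Z andbT sub_capmx; apply/andP; split.
    apply/andP; split; first exact/sub_kermxP.
    by apply/sub_kermxP; rewrite -mulmxA gf0 mulmx0.
  apply: submx_trans (addsmxSl _ _); apply/rV_subP => z; rewrite sub_capmx !sub_kermx.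
  case/andP=> z0; rewrite -sub_kermx (kmap_ker _ _ (exact _)) => /submxP[c ec].
  rewrite ec; apply: submxMr; rewrite sub_kermx (kdiff_nat _ _ gm) mulmxA.
  by rewrite -ec.
have z2 : (W *m Q + B2 :=: Z2)%MS.
  apply/eqmxP; rewrite addsmx_sub !sub_capmx submxMl submxMl !andbT; apply/andP; split.
    apply/andP; split; rewrite sub_kermx; first by rewrite -(mulmxA W) mulmx_ker.
    by rewrite -(mulmxA (kermx _)) (kdiff_nat _ _ gm) (mulmxA (kermx _)) mulmx_ker mul0mx.
  apply: submx_trans (addsmxSl _ _); apply/rV_subP => z; rewrite sub_capmx sub_kermx.
  case/andP=> z0 /submxP[c ec]; rewrite ec; apply: submxMr.
  by rewrite sub_kermx mulmxA -ec.
rewrite -z1 -z2; apply: rank_subquotient => u; rewrite sub_kermx mulmxA => /eqP uW.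
apply/idP/idP => /submxP[y ey].
  have /submxP[b eb] : (y *m kermx (kmap (f d) n i.+3) <= kmap (g d) n i.+3)%MS.
    by rewrite -(kmap_ker _ _ (exact d)) submxMl.
  have ub : (u - b *m kdiff E' n i.+2 d <= kermx P)%MS.
    rewrite sub_kermx mulmxBl -(mulmxA b) (kdiff_nat _ _ gm) mulmxA -eb -mulmxA -ey subrr.
    by rewrite eqxx.
  have -> : u *m Q = (u - b *m kdiff E' n i.+2 d) *m Q.
    by rewrite mulmxBl -mulmxA kdiff_kdiff mulmx0 subr0.
  exact: submxMr.
pose m := y *m kermx P.
have um : (u - m) *m Q = 0 by rewrite mulmxBl ey /m /B2 mulmxA subrr.
have /submxP[b eb] := koszul_betti0_exact acyc um.
have -> : u *m P = b *m kmap (g d) n i.+3 *m kdiff E n i.+2 d.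
  rewrite -mulmxA -(kdiff_nat _ _ gm) mulmxA -eb mulmxBl /m -[y *m _ *m _]mulmxA mulmx_ker.
  by rewrite mulmx0 subr0.
by apply: submxMr; rewrite sub_kermx -mulmxA gf0 mulmx0.
Qed.

(** If the homology of E' vanishes in degree i + 1 too, the kernel in [kerhom_step] is
    the whole homology of ker g. *)
Lemma kerhom_shift i d : koszul_betti E' n i.+2 d = 0%N -> koszul_betti E' n i.+1 (succz d)
  = 0%N ->
  kerhom f n i.+2 d = kerhom g n i.+1 (succz d).
Proof.
move=> h2 h1; rewrite (kerhom_step h2) /kerhom; congr (_ - _)%N.
apply: eqmx_rank; rewrite !sub_capmx capmxSl capmxSr /= andbT.
apply/andP; split.
  by apply: submx_trans (capmxSr _ _) (kdiff_sub_ker _ _ _ _).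
apply/rV_subP => u; rewrite sub_capmx sub_kermx => /andP[/eqP u0 _].
exact: koszul_betti0_exact h1 u0.
Qed.

End Step.

(** The identification of the coefficients with the chains of homological degree 0. *)
Fixpoint inj0 (a n : nat) : 'M[K]_(a, kdim a n 1) :=
  match n return 'M[K]_(a, kdim a n 1) with
  | 0 => 1%:M
  | n'.+1 => row_mx (inj0 a n') 0
  end.

Lemma inj0_nat a b (f : 'M[K]_(a, b)) n : f *m inj0 b n = inj0 a n *m kmap f n 1.
Proof.
elim: n => [|n IH] /=; first by rewrite mulmx1 mul1mx.
by rewrite mul_mx_row mulmx0 mul_row_block !mulmx0 mul0mx !addr0 IH.
Qed.

Lemma rank_inj0 a n : \rank (inj0 a n) = a.
Proof.
elim: n => [|n IH] /=; first by rewrite mxrank1.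
by rewrite rank_row_mx0.
Qed.

Lemma inj0_full a n : row_full (inj0 a n).
Proof. by rewrite /row_full rank_inj0 kdimS bin0 mul1n. Qed.

Lemma inj0_free a n : row_free (inj0 a n).
Proof. by rewrite /row_free rank_inj0. Qed.

(** A map kills the boundaries of homological degree 0 if and only if it kills the
    images of all variables. *)
Lemma kdiff1_dual M n d p (N : 'M[K]_(gdim M (succz d), p)) :
  (kdiff M n 1 d *m kmap N n 1 = 0) <-> (forall k, (k < n)%N -> gmul M k d *m N = 0).
Proof.
elim: n => [|n IH] /=; first by split=> // _; rewrite mul0mx.
rewrite mulmx_block !mulmx0 !mul0mx !addr0 !add0r (kdim0_col (_ *m kmap N n 0)).
rewrite -kmapM; split.
  move/eqP; rewrite block_mx_eq0 => /and4P[/eqP/IH h _ + _] k.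
  rewrite -mxrank_eq0 rank_kmap bin0 mul1n mxrank_eq0 => /eqP x0.
  by rewrite ltnS leq_eqVlt => /predU1P[-> // | /h].
move=> h; rewrite h // kmap0 (_ : kdiff M n 1 d *m _ = 0) -?block_mx0 //.
by apply/IH => k kn; apply: h; rewrite ltnW.
Qed.

Lemma kdiff1_image M n d p (kappa : 'M[K]_(gdim M (succz d), p)) :
  (forall k, (k < n)%N -> gmul M k d *m kappa = 0) ->
  (forall q (N : 'M_(_, q)), (forall k, (k < n)%N -> gmul M k d *m N = 0) -> kermx kappa *m N
    = 0) ->
  (kermx (kmap kappa n 1) :=: kdiff M n 1 d)%MS.
Proof.
move=> xk kx; apply/eqmxP; apply/andP; split; last by apply/sub_kermxP; apply/kdiff1_dual.
set C := cokermx (kdiff M n 1 d); set a := gdim M (succz d) in kappa xk kx *.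
(* the cokernel of the differential, transported to the coefficients *)
have kC : kmap (inj0 a n *m C) n 1 = C *m inj0 _ n.
  apply: (row_full_inj (inj0_full a n)).
  by rewrite -inj0_nat -(mulmxA _ C).
have : kermx kappa *m (inj0 a n *m C) = 0.
  by apply: kx; apply/kdiff1_dual; rewrite kC mulmxA mulmx_coker mul0mx.
move=> k0; apply/rV_subP => u; rewrite sub_kermx submxE => uk.
have /submxP[u' eu] : (u <= inj0 a n)%MS by apply/submx_full/inj0_full.
have : (u' <= kermx kappa)%MS.
  by rewrite sub_kermx -(mulmx_free_eq0 _ (inj0_free _ n)) -mulmxA inj0_nat mulmxA -eu.
by case/submxP => y ey; rewrite eu ey -(mulmxA (y *m _)) -(mulmxA y) k0 mulmx0.
Qed.

Section Last.
Variables (F3 F2 F1 E G : gmod K) (n r1 r2 : nat).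
Variables (h' : forall d, 'M[K]_(gdim F3 d, gdim F2 d))
  (h : forall d, 'M[K]_(gdim F2 d, gdim F1 d)).
Variables (g : forall d, 'M[K]_(gdim F1 d, gdim E d)) (f : forall d, 'M[K]_(gdim E d, gdim G d)).
Hypotheses (hm : gmorph n h) (gm : gmorph n g) (fm : gmorph n f).
Hypotheses (exf : forall d, (kermx (f d) :=: g d)%MS) (exg : forall d, (kermx (g d) :=: h d)%MS).
Hypothesis exh : forall d, (kermx (h d) :=: h' d)%MS.
Variable d : int.
Let j := succz (succz d).
Variables (k1 : 'M[K]_(gdim F1 j, r1)) (k2 : 'M[K]_(gdim F2 j, r2)).
Hypothesis k1_ker : (kermx (kmap k1 n 1) :=: kdiff F1 n 1 (succz d))%MS.
Hypothesis k2_ker : (kermx (kmap k2 n 1) :=: kdiff F2 n 1 (succz d))%MS.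
Hypothesis acyc : koszul_betti F1 n 1 d = 0%N.

(** In homological degree 1 the shift ends: H_1(ker f) is the kernel of
    ker g / m ker g -> F1 / m F1, m being generated by the variables.  As ker g is the
    image of F2 and k1, k2 are reductions modulo m, this is the homology of
    F3/m -> F2/m -> F1/m. *)
Lemma kerhom_last : kerhom f n 1 d =
  (\rank (kermx (h j *m k1) *m k2) - \rank (h' j *m k2))%N.
Proof.
rewrite (kerhom_step gm fm exf acyc).
pose W := kermx (kmap (h j) n 1 *m kmap k1 n 1).
pose P := kmap (h j) n 1; pose Q := kmap k2 n 1.
set Z1 := (_ :&: _)%MS; set B1 := (_ *m kdiff F1 n 1 (succz d)).
pose B2 := kmap (h' j *m k2) n 1.
have hg0 c i : kmap (h c) n i *m kmap (g c) n i = 0.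
  by apply/sub_kermxP; rewrite (kmap_ker _ _ (exg c)).
have h'h0 c i : kmap (h' c) n i *m kmap (h c) n i = 0.
  by apply/sub_kermxP; rewrite (kmap_ker _ _ (exh c)).
have z1 : (W *m P + B1 :=: Z1)%MS.
  apply/eqmxP; rewrite addsmx_sub !sub_capmx submxMl !andbT; apply/andP; split.
    apply/andP; split; first by rewrite !sub_kermx -mulmxA hg0 mulmx0 -k1_ker sub_kermx -mulmxA
      mulmx_ker !eqxx.
    by rewrite sub_kermx -mulmxA (kdiff_nat _ _ gm) mulmxA mulmx_ker mul0mx eqxx.
  apply: submx_trans (addsmxSl _ _); apply/rV_subP => z; rewrite sub_capmx.
  rewrite (kmap_ker _ _ (exg _)) -k1_ker sub_kermx => /andP[/submxP[c ->]].
  by rewrite -mulmxA -sub_kermx => cW; apply: submxMr.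
have z2 : (W *m Q + B2 :=: W *m Q)%MS.
  apply/addsmx_idPl; rewrite /B2 kmapM; apply: submxMr.
  by rewrite sub_kermx mulmxA h'h0 mul0mx.
have rW : \rank (W *m Q) = \rank (kermx (h j *m k1) *m k2).
  rewrite /W -kmapM (eqmxMr _ (kmap_ker _ _ (eqmx_refl _))) /Q -kmapM.
  by rewrite rank_kmap bin0 mul1n.
have rB : \rank B2 = \rank (h' j *m k2) by rewrite /B2 rank_kmap bin0 mul1n.
rewrite -z1 -rW -rB -z2; apply: rank_subquotient => u; rewrite sub_kermx mulmxA => /eqP uW.
apply/idP/idP => /submxP[y ey].
  have /submxP[b eb] : (y *m kermx (kmap (g (succz d)) n 2) <= kmap (h (succz d)) n 2)%MS.
    by rewrite -(kmap_ker _ _ (exg _)) submxMl.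
  have : (u - b *m kdiff F2 n 1 (succz d) <= kmap (h' j) n 1)%MS.
    rewrite -(kmap_ker _ _ (exh j)) sub_kermx mulmxBl -(mulmxA b) (kdiff_nat _ _ hm) mulmxA -eb.
    by rewrite ey /B1 mulmxA subrr.
  have kd0 : kdiff F2 n 1 (succz d) *m Q = 0 by apply/sub_kermxP; rewrite k2_ker.
  have -> : u *m Q = (u - b *m kdiff F2 n 1 (succz d)) *m Q.
    by rewrite mulmxBl -mulmxA kd0 mulmx0 subr0.
  by rewrite /B2 kmapM; apply: submxMr.
have : (u - y *m kmap (h' j) n 1 <= kdiff F2 n 1 (succz d))%MS.
  by rewrite -k2_ker sub_kermx mulmxBl ey /B2 kmapM mulmxA subrr.
case/submxP => b eb.
have -> : u *m P = b *m kmap (h (succz d)) n 2 *m kdiff F1 n 1 (succz d).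
  by rewrite -mulmxA -(kdiff_nat _ _ hm) mulmxA -eb mulmxBl -[y *m _ *m _]mulmxA h'h0 mulmx0
    subr0.
by apply: submxMr; rewrite sub_kermx -mulmxA hg0 mulmx0.
Qed.
End Last.

End Shift.

(** * Modules with a basis of monomials *)

Section SeqMatrix.
Variable K : fieldType.

Definition seqmx (T U : Type) (s : seq T) (t : seq U) (f : T -> U -> K) :
    'M[K]_(size s, size t) :=
  \matrix_(i, j) f (tnth (in_tuple s) i) (tnth (in_tuple t) j).

Lemma seqmxM T U V (s : seq T) (t : seq U) (r : seq V) f g :
  seqmx s t f *m seqmx t r g = seqmx s r (fun x z => \sum_(y <- t) f x y * g y z).
Proof. by apply/matrixP => i j; rewrite !mxE [RHS]big_tnth; apply: eq_bigr => k _;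
  rewrite !mxE. Qed.

Lemma eq_seqmx (T U : eqType) (s : seq T) (t : seq U) f g :
  (forall x y, x \in s -> y \in t -> f x y = g x y) -> seqmx s t f = seqmx s t g.
Proof. by move=> h; apply/matrixP => i j; rewrite !mxE h //;
  [exact: (mem_tnth i (in_tuple s)) | exact: (mem_tnth j (in_tuple t))]. Qed.

Lemma seqmx1 (T : eqType) (s : seq T) : uniq s -> seqmx s s (fun x y => (x == y)%:R) = 1%:M.
Proof.
move=> us; have inj : injective (tnth (in_tuple s)) by apply/tuple_uniqP.
by apply/matrixP => i j; rewrite !mxE (inj_eq inj).
Qed.

Lemma seqmx0 T U (s : seq T) (t : seq U) : seqmx s t (fun _ _ => 0) = 0.
Proof. by apply/matrixP => i j; rewrite !mxE. Qed.

Lemma seqmxD T U (s : seq T) (t : seq U) f g :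
  seqmx s t f + seqmx s t g = seqmx s t (fun x y => f x y + g x y).
Proof. by apply/matrixP => i j; rewrite !mxE. Qed.

Lemma sum_delta (T : eqType) (s : seq T) a (F : T -> K) : uniq s ->
  \sum_(y <- s) (y == a)%:R * F y = (a \in s)%:R * F a.
Proof.
move=> us; have [ain | aout] := boolP (a \in s).
  rewrite (bigD1_seq a) //= eqxx mul1r big1 ?addr0 // => y /negPf ->; exact: mul0r.
rewrite mul0r big_seq big1 // => y ys.
have [e|] := eqVneq y a; last by rewrite mul0r.
by case/negP: aout; rewrite -e.
Qed.

End SeqMatrix.

(** The proof of commutation does not enter the homology; this lets modules with
    equal bases be identified by rewriting. *)
Lemma koszul_betti_irrelevant (K : fieldType) a (x : nat -> forall d, 'M[K]_(a d, a (succz d)))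
  C1 C2 n i d :
  koszul_betti (@GMod K a x C1) n i d = koszul_betti (@GMod K a x C2) n i d.
Proof.
have kdE m j c : kdiff (@GMod K a x C1) m j c = kdiff (@GMod K a x C2) m j c.
  by elim: m j => [|m IH] [|j] //=; rewrite !IH.
by rewrite /koszul_betti !kdE.
Qed.

Lemma rank_gmul_quotient (K : fieldType) (M Q : gmod K) n pi d : @is_quotient K M n Q pi ->
  (\rank (gmul M n d) + gdim Q (succz d))%N = gdim M (succz d).
Proof.
move=> qpi; have := mxrank_ker (pi (succz d)); rewrite (quo_ker qpi) => ->.
by rewrite -{2}(eqP (quo_full qpi (succz d))) subnK // rank_leq_row.
Qed.

Section MonomialModules.
Variables (K : fieldType) (T : eqType) (N : nat) (act : nat -> T -> T) (dv : nat -> pred T).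
Hypothesis actC : forall k l u, act k (act l u) = act l (act k u).
Hypothesis act_inj : forall k, injective (act k).
Hypothesis dv_act : forall k u, (k < N)%N -> dv k (act k u).
Hypothesis dvP : forall k u, (k < N)%N -> dv k u -> exists w, u = act k w.
Hypothesis dv_neq : forall k l u, (k < N)%N -> (l < N)%N -> k != l -> dv l (act k u) = dv l u.

(** The elements outside s then span a submodule, whose quotient has s as a basis. *)
Definition div_closed (s : int -> seq T) : Prop :=
  forall k d u, (k < N)%N -> act k u \in s (succz d) -> u \in s d.

Section Module.
Variable s : int -> seq T.
Hypotheses (us : forall d, uniq (s d)) (cs : div_closed s).

Definition monomial_mul k d : 'M[K]_(size (s d), size (s (succz d))) :=
  if (k < N)%N then seqmx (s d) (s (succz d)) (fun u v => (v == act k u)%:R) else 0.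

Lemma monomial_mulC k l d : monomial_mul k d *m monomial_mul l (succz d)
  = monomial_mul l d *m monomial_mul k (succz d).
Proof.
rewrite /monomial_mul; case: ifP => kN; case: ifP => lN; rewrite ?mulmx0 ?mul0mx //.
rewrite !seqmxM; apply: eq_seqmx => u w _ ws; rewrite !sum_delta // (actC l k).
have [e | _] := eqVneq w; last by rewrite !mulr0.
rewrite (_ : act k u \in _); last by apply: (cs (k := l)); rewrite // actC -e.
by rewrite (_ : act l u \in _) //; apply: (cs (k := k)); rewrite // -e.
Qed.

Definition monomial_mod : gmod K := GMod monomial_mulC.

Lemma monomial_modE k d : (k < N)%N ->
  gmul monomial_mod k d = seqmx (s d) (s (succz d)) (fun u v => (v == act k u)%:R).
Proof. by move=> kN; rewrite /= /monomial_mul kN. Qed.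
End Module.

Section Chain.
Variable s : int -> seq T.
Hypotheses (us : forall d, uniq (s d)) (cs : div_closed s).

(** The basis of the quotient by the variables of index at least m. *)
Definition below (m : nat) (d : int) : seq T :=
  [seq u <- s d | all (fun l => ~~ dv l u) (iota m (N - m))].

Lemma mem_below m d u : (m <= N)%N ->
  reflect (u \in s d /\ forall l, (m <= l < N)%N -> ~~ dv l u) (u \in below m d).
Proof.
move=> mN; rewrite mem_filter andbC; apply: (iffP andP) => [[uin /allP h] | [uin h]].
  by split=> // l lN; apply: h; rewrite mem_iota subnKC.
by split=> //; apply/allP => l; rewrite mem_iota subnKC //; apply: h.
Qed.

Lemma below_uniq m d : uniq (below m d).
Proof. by rewrite filter_uniq. Qed.

Lemma dv_mul k l u : (k < N)%N -> (l < N)%N -> dv l u -> dv l (act k u).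
Proof.
move=> kN lN; have [-> _ | kl] := eqVneq k l; first exact: dv_act.
by rewrite dv_neq.
Qed.

Lemma below_closed m : (m <= N)%N -> div_closed (below m).
Proof.
move=> mN k d u kN /(mem_below _ _ mN)[uin h]; apply/(mem_below _ _ mN).
split=> [|l ml]; first exact: cs kN uin.
by apply: contra (h l ml); apply: dv_mul kN _; case/andP: ml.
Qed.

Lemma belowN d : below N d = s d.
Proof. by rewrite /below subnn /= filter_predT. Qed.

Lemma belowS m d u : (m < N)%N -> (u \in below m d) = (u \in below m.+1 d) && ~~ dv m u.
Proof.
move=> mN; apply/idP/andP => [/(mem_below _ _ (ltnW mN))[uin h] |
  [/(mem_below _ _ mN)[uin h] hm]].
  split; last by apply: h; rewrite leqnn.
  by apply/(mem_below _ _ mN); split=> // l /andP[ml lN]; apply: h; rewrite ltnW.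
apply/(mem_below _ _ (ltnW mN)); split=> // l; rewrite leq_eqVlt => /andP[/predU1P[<- //|ml] lN].
by apply: h; rewrite ml.
Qed.

Definition below_mod m (mN : (m <= N)%N) : gmod K :=
  monomial_mod (below_uniq m) (below_closed mN).

Section Link.
Variables (m : nat) (mN : (m < N)%N).
Let M := below_mod mN.
Let Q := below_mod (ltnW mN).

Definition link_pi d : 'M[K]_(gdim M d, gdim Q d) :=
  seqmx (below m.+1 d) (below m d) (fun u v => (u == v)%:R).
Definition link_sigma d : 'M[K]_(gdim Q d, gdim M d) :=
  seqmx (below m d) (below m.+1 d) (fun u v => (u == v)%:R).
(** Division by the m-th variable, a partial inverse of multiplication by it. *)
Definition link_div d : 'M[K]_(gdim M (succz d), gdim M d) :=
  seqmx (below m.+1 (succz d)) (below m.+1 d) (fun u v => (u == act m v)%:R).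

Let eqC (a b : T) : (a == b)%:R = (b == a)%:R :> K. Proof. by rewrite eq_sym. Qed.

Lemma link_sigmaK d : link_sigma d *m link_pi d = 1%:M.
Proof.
rewrite seqmxM -(seqmx1 _ (below_uniq m d)); apply: eq_seqmx => u v uin vin.
rewrite (eq_bigr (fun y => (y == u)%:R * (y == v)%:R)) => [|y _]; last by rewrite eqC.
rewrite sum_delta ?below_uniq // (_ : u \in _) ?mul1r //.
by move: uin; rewrite belowS // => /andP[].
Qed.

(** A basis element either survives in the quotient or is divisible by the m-th
    variable. *)
Lemma link_decomp d :
  link_pi (succz d) *m link_sigma (succz d) + link_div d *m gmul M m d = 1%:M.
Proof.
rewrite monomial_modE // !seqmxM seqmxD -(seqmx1 _ (below_uniq m.+1 (succz d))).
apply: eq_seqmx => u v uin vin.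
rewrite (eq_bigr (fun y => (y == u)%:R * (y == v)%:R)) => [|y _]; last by rewrite eqC.
rewrite sum_delta ?below_uniq // belowS // uin /=.
have [dvu | ndv] := boolP (dv m u).
  rewrite mul0r add0r; have [w eu] := dvP mN dvu.
  rewrite (eq_bigr (fun y => (y == w)%:R * (v == act m y)%:R)) => [|y _]; last first.
    by rewrite eu (inj_eq (@act_inj m)) eqC.
  rewrite sum_delta ?below_uniq // (_ : w \in _); last first.
    by apply: (below_closed mN (k := m)); rewrite // -eu.
  by rewrite mul1r -eu eqC.
rewrite mul1r big_seq big1 ?addr0 // => y _.
by rewrite (_ : (u == act m y) = false) ?mul0r //; apply: contraNF ndv => /eqP ->; apply: dv_act.
Qed.

Lemma link_x0 d : gmul M m d *m link_pi (succz d) = 0.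
Proof.
rewrite monomial_modE // seqmxM -(seqmx0 _ (below m.+1 d) (below m (succz d))).
apply: eq_seqmx => u v uin vin; rewrite sum_delta ?below_uniq //.
rewrite (_ : (act m u == v) = false) ?mulr0 //; apply: contraTF vin => /eqP <-.
by rewrite belowS // dv_act // andbF.
Qed.

Lemma link_quotient : is_quotient m link_pi.
Proof.
split=> [k d km | d | d].
- have kN := ltn_trans km mN.
  rewrite !monomial_modE // !seqmxM; apply: eq_seqmx => u v uin vin.
  rewrite sum_delta ?below_uniq //.
  rewrite [RHS](eq_bigr (fun y => (y == u)%:R * (v == act k y)%:R)) => [|y _];
    last by rewrite eqC.
  rewrite sum_delta ?below_uniq // [act k u == v]eq_sym.
  have [e | _] := eqVneq v; last by rewrite !mulr0.
  rewrite (_ : u \in _); last by apply: (below_closed (ltnW mN) (k := k)); rewrite // -e.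
  by rewrite -e; move: vin; rewrite belowS // => /andP[->].
- by apply/row_fullP; exists (link_sigma d); exact: link_sigmaK.
apply/eqmxP; apply/andP; split; last by apply/sub_kermxP; exact: link_x0.
rewrite -[kermx _]mulmx1 -link_decomp mulmxDr (mulmxA (kermx _)) mulmx_ker mul0mx add0r.
by rewrite (mulmxA (kermx _)) submxMl.
Qed.

Lemma link_sigma_morph : gmorph m link_sigma.
Proof.
move=> k d km; have kN := ltn_trans km mN.
rewrite !monomial_modE // !seqmxM; apply: eq_seqmx => u v uin vin.
rewrite sum_delta ?below_uniq //.
rewrite [RHS](eq_bigr (fun y => (y == u)%:R * (v == act k y)%:R)) => [|y _]; last by rewrite eqC.
rewrite sum_delta ?below_uniq // [act k u == v]eq_sym.
have [e | _] := eqVneq v; last by rewrite !mulr0.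
rewrite -e; have -> : v \in below m (succz d).
  rewrite belowS // vin e dv_neq ?(gtn_eqF km) ?(ltn_eqF km) //.
  by move: uin; rewrite belowS // => /andP[].
by move: uin; rewrite belowS // => /andP[->].
Qed.

(** The stability hypothesis is the exchange property of a stable ideal, read on the
    monomials outside of it: if x_k u is nonzero for some k < m, then so is x_m u. *)
Lemma link_is_split :
  (forall k d u, (k < m)%N -> u \in s d -> act k u \in s (succz d) -> act m u \in s (succz d)) ->
  is_split m link_pi link_sigma.
Proof.
move=> stab; split=> [|d|k d km]; [exact: link_sigma_morph | exact: link_sigmaK |].
have kN := ltn_trans km mN.
have -> : gmul M k d = gmul M m d *m (link_div d *m gmul M k d).
  rewrite !monomial_modE // !seqmxM; apply: eq_seqmx => u v uin vin.
  rewrite sum_delta ?below_uniq //.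
  rewrite (eq_bigr (fun y => (y == u)%:R * (v == act k y)%:R)) => [|y _]; last first.
    by rewrite (inj_eq (@act_inj m)) eqC.
  rewrite sum_delta ?below_uniq // uin mul1r.
  have [e | _] := eqVneq v; last by rewrite mulr0.
  suff -> : act m u \in below m.+1 (succz d) by rewrite mul1r.
  have [us' hu] := mem_below _ _ mN uin; have [vs _] := mem_below _ _ mN vin.
  apply/(mem_below _ _ mN); split; first by apply: (stab k) => //; rewrite -e.
  by move=> l /andP[ml lN]; rewrite dv_neq ?(ltn_eqF ml) //; apply: hu; rewrite ml lN.
by rewrite mulmxA mulmx_ker mul0mx.
Qed.

Lemma link_inj d : (forall u, u \in s d -> act m u \in s (succz d)) -> row_free (gmul M m d).
Proof.
move=> free; apply/row_freeP; exists (link_div d).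
rewrite monomial_modE // seqmxM -(seqmx1 _ (below_uniq m.+1 d)); apply: eq_seqmx => u v uin vin.
rewrite sum_delta ?below_uniq // (inj_eq (@act_inj m)).
suff -> : act m u \in below m.+1 (succz d) by rewrite mul1r.
have [us' hu] := mem_below _ _ mN uin.
apply/(mem_below _ _ mN); split; first exact: free.
by move=> l /andP[ml lN]; rewrite dv_neq ?(ltn_eqF ml) //; apply: hu; rewrite ml lN.
Qed.

End Link.

(** A free module has injective variables at each stage, so the bound of
    [koszul_betti_step] is zero. *)
Lemma koszul_betti_below_free m (mN : (m <= N)%N) i d :
  (forall k c u, (k < N)%N -> u \in s c -> act k u \in s (succz c)) ->
  koszul_betti (below_mod mN) m i.+1 d = 0%N.
Proof.
move=> free; elim: m mN i d => [|m IH] mN i d; first by rewrite /koszul_betti mxrank_ker sub0n.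
have := koszul_betti_step (link_quotient mN) i d; rewrite IH add0n.
have := link_inj (d := succz d) mN (fun u => free m _ u mN); rewrite /row_free => /eqP ->.
by rewrite subnn muln0 leqn0 => /eqP.
Qed.

Lemma koszul_betti_below_stable m (mN : (m <= N)%N) i d :
  (forall l k c u, (k < l)%N -> (l < N)%N -> u \in s c -> act k u \in s (succz c) ->
     act l u \in s (succz c)) ->
  (koszul_betti (below_mod mN) m i.+1 d +
     \sum_(j < m) 'C(m - 1 - j, i) * size (below (m - j) (succz (succz d))) =
   \sum_(j < m) 'C(m - 1 - j, i) * (size (below (m - j) (succz d)) +
     size (below (m - j.+1) (succz (succz d)))))%N.
Proof.
move=> stab; elim: m mN => [|m IH] mN; first by rewrite !big_ord0 addn0 /koszul_betti
  mxrank_ker sub0n.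
rewrite (koszul_betti_step_split (link_quotient mN) i d (link_is_split mN _)); last first.
  by move=> k c u km; apply: stab.
rewrite !big_ord_recl !subn0 !subn1 /=.
have sh (F : nat -> nat) : (\sum_(j < m) 'C(m - bump 0 j, i) * F (m.+1 - bump 0 j) =
    \sum_(j < m) 'C(m - 1 - j, i) * F (m - j))%N.
  apply: eq_bigr => j _; rewrite /bump leq0n add1n subSS.
  by have -> : (m - j.+1 = m - 1 - j)%N by lia.
rewrite (sh (fun j => size (below j _))).
have sh2 (F G : nat -> nat) : (\sum_(j < m) 'C(m - bump 0 j, i) *
     (F (m.+1 - bump 0 j) + G (m.+1 - (bump 0 j).+1)) =
    \sum_(j < m) 'C(m - 1 - j, i) * (F (m - j) + G (m - j.+1)))%N.
  apply: eq_bigr => j _; rewrite /bump leq0n add1n !subSS.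
  by have -> : (m - j.+1 = m - 1 - j)%N by lia.
rewrite (sh2 (fun j => size (below j _)) (fun j => size (below j _))) -(IH (ltnW mN)).
have := rank_gmul_quotient (succz d) (link_quotient mN) => /=.
have := rank_leq_row (gmul (below_mod mN) m (succz d)) => /=.
move: (\rank _) => r; move: (size _) => x le; move: (size _) => y rE.
rewrite -rE (_ : 'C(m, i) * (x + y) = 'C(m, i) * (x - r) + 'C(m, i) * (r + y))%N; last first.
  by rewrite -mulnDr; congr (_ * _)%N; lia.
move: ('C(m, i) * (x - r))%N ('C(m, i) * (r + y))%N => p q.
move: (koszul_betti _ _ _ _) (\sum_(j < m) _)%N; lia.
Qed.

Lemma koszul_betti_belowN i d :
  koszul_betti (monomial_mod us cs) N i d = koszul_betti (below_mod (leqnn N)) N i d.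
Proof.
rewrite /below_mod; move: (below_uniq N) (below_closed (leqnn N)).
have -> : below N = s by apply: functional_extensionality => c; exact: belowN.
move=> us' cs'; exact: koszul_betti_irrelevant.
Qed.

End Chain.
End MonomialModules.

(** * Free modules over the polynomial ring *)

Section Monomials.
Variable n : nat.
Implicit Types m : 'X_{1..n}.

Lemma mem_monomials d m : (m \in monomials n d) = (mdeg m == d).
Proof.
rewrite mem_sort; apply/mapP/idP => [[m'] | /eqP md].
  by rewrite mem_filter => /andP[md _] ->.
have lt : (mdeg m < d.+1)%N by rewrite md.
by exists (BMultinom lt); rewrite // mem_filter /= md eqxx mem_enum.
Qed.

Lemma monomials_uniq d : uniq (monomials n d).
Proof.
rewrite sort_uniq map_inj_uniq => [|x y]; last exact: val_inj.
by rewrite filter_uniq // enum_uniq.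
Qed.

Lemma monomials0 : monomials n 0 = [:: 0%MM].
Proof.
apply: perm_small_eq; rewrite // uniq_perm ?monomials_uniq // => m.
by rewrite mem_monomials mdeg_eq0 inE.
Qed.

(** Resolutions have integer shifts, so negative degrees occur. *)
Definition monomialsz (e : int) : seq 'X_{1..n} := if e is Posz d then monomials n d else [::].

Lemma mem_monomialsz e m : (m \in monomialsz e) = ((mdeg m)%:Z == e).
Proof. by case: e => d //=; rewrite mem_monomials. Qed.

Lemma monomialsz_uniq e : uniq (monomialsz e).
Proof. by case: e => d //=; apply: monomials_uniq. Qed.

Definition var_mono (k : nat) : 'X_{1..n} := [multinom (i == k :> nat) : nat | i < n].

Lemma var_monoE k (i : 'I_n) : var_mono k i = (i == k :> nat).
Proof. by rewrite mnmE. Qed.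

Lemma var_mono_ord (k : 'I_n) : var_mono k = U_(k)%MM.
Proof. by apply/mnmP => i; rewrite var_monoE mnm1E eq_sym. Qed.

Lemma var_monoU k (kn : (k < n)%N) : var_mono k = U_(Ordinal kn)%MM.
Proof. exact: (var_mono_ord (Ordinal kn)). Qed.

Lemma mdeg_var_mono k : (k < n)%N -> mdeg (var_mono k) = 1%N.
Proof. by move=> kn; rewrite (var_monoU kn) mdeg1. Qed.

Variable r : nat.
Notation T := ('I_r * 'X_{1..n})%type.

Definition mono_act (k : nat) (u : T) : T := (u.1, u.2 + var_mono k)%MM.
Definition mono_dvd (k : nat) (u : T) : bool :=
  [exists i : 'I_n, (i == k :> nat) && (0 < u.2 i)%N].

Lemma mono_actC k l u : mono_act k (mono_act l u) = mono_act l (mono_act k u).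
Proof. by rewrite /mono_act /= -!addmA (addmC (var_mono l)). Qed.

Lemma mono_act_inj k : injective (mono_act k).
Proof. by case=> i m [j m'] e; have /= -> := congr1 fst e; have /= /addIm -> := congr1 snd e. Qed.

Lemma mono_dvdE (k : 'I_n) u : mono_dvd k u = (0 < u.2 k)%N.
Proof.
apply/existsP/idP => [[i /andP[/eqP ik]] | h]; last by exists k; rewrite eqxx.
by have -> : i = k by apply: val_inj.
Qed.

Lemma mono_dvd_act k u : (k < n)%N -> mono_dvd k (mono_act k u).
Proof.
by move=> kn; rewrite -[k]/(val (Ordinal kn)) mono_dvdE /= mnmDE var_monoE eqxx addn1.
Qed.

Lemma mono_dvdP k u : (k < n)%N -> mono_dvd k u -> exists w, u = mono_act k w.
Proof.
move=> kn; rewrite -[k]/(val (Ordinal kn)) mono_dvdE => h.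
exists (u.1, (u.2 - U_(Ordinal kn))%MM); rewrite /mono_act /= (var_monoU kn) submK;
  first by case: u h.
by rewrite lep1mP -lt0n.
Qed.

Lemma mono_dvd_neq k l u : (k < n)%N -> (l < n)%N -> k != l -> mono_dvd l (mono_act k u)
  = mono_dvd l u.
Proof.
move=> kn ln kl; rewrite -[l]/(val (Ordinal ln)) !mono_dvdE /= mnmDE var_monoE /=.
by rewrite eq_sym (negPf kl) addn0.
Qed.

Variable sh : 'I_r -> int.

Definition free_basis (e : int) : seq T :=
  [seq (k, m) | k <- enum 'I_r, m <- monomialsz (e - sh k)].

Lemma mem_free_basis e u : (u \in free_basis e) = ((mdeg u.2)%:Z + sh u.1 == e).
Proof.
apply/allpairsPdep/idP => [[k [m [_ + ->]]] | h] /=.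
  by rewrite mem_monomialsz => /eqP ->; rewrite subrK.
by exists u.1, u.2; rewrite mem_enum mem_monomialsz -(eqP h) addrK; case: u h.
Qed.

Lemma free_basis_uniq e : uniq (free_basis e).
Proof.
apply: allpairs_uniq_dep => [|k _|]; rewrite ?enum_uniq ?monomialsz_uniq //.
by case=> k m [k' m'] _ _ [-> ->].
Qed.

Lemma free_basis_act k e u : (k < n)%N -> (mono_act k u \in free_basis (succz e))
  = (u \in free_basis e).
Proof. by move=> kn; rewrite !mem_free_basis /= mdegD mdeg_var_mono // succzE; lia. Qed.

Lemma free_basis_closed : div_closed n mono_act free_basis.
Proof. by move=> k d u kn; rewrite free_basis_act. Qed.

End Monomials.

Section Coordinates.
Variables (K : fieldType) (n : nat).
Notation R := {mpoly K[n]}.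

Lemma big_seq_support (T : eqType) (V : nmodType) (s t : seq T) (G : T -> V) :
  uniq s -> uniq t -> (forall x, x \in s -> x \notin t -> G x = 0) ->
  (forall x, x \in t -> x \notin s -> G x = 0) ->
  \sum_(x <- s) G x = \sum_(x <- t) G x.
Proof.
move=> us ut hs ht.
have split_ (a b : seq T) : uniq a -> (forall x, x \in a -> x \notin b -> G x = 0) ->
    \sum_(x <- a) G x = \sum_(x <- [seq y <- a | y \in b]) G x.
  move=> ua h; rewrite big_filter [LHS](bigID (mem b)) /= [X in _ + X]big_seq_cond.
  by rewrite [X in _ + X]big1 ?addr0 // => x /andP[xa xb]; apply: h.
rewrite (split_ s t) // (split_ t s) //; apply: perm_big; apply: uniq_perm;
  rewrite ?filter_uniq //.
by move=> x; rewrite !mem_filter andbC.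
Qed.

Definition free_mod r (sh : 'I_r -> int) : gmod K :=
  monomial_mod K (fun k l u => mono_actC k l u) (@free_basis_uniq n r sh)
    (@free_basis_closed n r sh).

Section One.
Variables (r : nat) (sh : 'I_r -> int).

Definition coord_row e (w : 'rV[R]_r) : 'rV[K]_(size (free_basis n sh e)) :=
  \row_i (w 0 (tnth (in_tuple (free_basis n sh e)) i).1)@_(tnth (in_tuple (free_basis n sh e))
    i).2.

Lemma coord_row_inj w w' : (forall e, coord_row e w = coord_row e w') -> w = w'.
Proof.
move=> h; apply/rowP => k; apply/mpolyP => m.
have : (k, m) \in free_basis n sh ((mdeg m)%:Z + sh k) by rewrite mem_free_basis.
case/(nthP (k, m)) => i lt e.
have := congr1 (fun v : 'rV_ _ => v 0 (Ordinal lt)) (h ((mdeg m)%:Z + sh k)).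
by rewrite !mxE !(tnth_nth (k, m)) /= e.
Qed.

Lemma coord_rowB e w w' : coord_row e (w - w') = coord_row e w - coord_row e w'.
Proof. by apply/rowP => i; rewrite !mxE mcoeffB. Qed.

Lemma coord_row0 e : coord_row e 0 = 0.
Proof. by apply/rowP => i; rewrite !mxE mcoeff0. Qed.

(** Every coordinate row in degree e is that of a homogeneous element, so statements on
    homogeneous elements of a free module become statements on matrices. *)
Lemma coord_row_lift e (v : 'rV[K]_(size (free_basis n sh e))) :
  exists w, coord_row e w = v /\ forall e', e' != e -> coord_row e' w = 0.
Proof.
set s := in_tuple (free_basis n sh e).
pose w : 'rV[R]_r := \row_k \sum_i (if (tnth s i).1 == k then v 0 i *: 'X_[(tnth s i).2] else 0).
have wE k m : (w 0 k)@_m = \sum_i v 0 i * (tnth s i == (k, m))%:R.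
  rewrite mxE raddf_sum /=; apply: eq_bigr => i _; case: (tnth s i) => k' m' /=.
  rewrite -pair_eqE /=; case: eqP => _; last by rewrite mcoeff0 mulr0.
  by rewrite mcoeffZ mcoeffX.
exists w; split=> [|e' ne]; apply/rowP => j; rewrite mxE wE.
  rewrite -surjective_pairing (bigD1 j) //= eqxx mulr1 big1 ?addr0 // => i /negPf ij.
  have inj : injective (tnth s) by apply/tuple_uniqP/free_basis_uniq.
  by rewrite (inj_eq inj) ij mulr0.
rewrite mxE big1 // => i _; rewrite -surjective_pairing.
case: eqP => [eq | _]; last by rewrite mulr0.
have := mem_tnth i s; rewrite eq /= mem_free_basis.
have := mem_tnth j (in_tuple (free_basis n sh e')); rewrite mem_free_basis => /eqP -> /eqP e1.
by rewrite e1 eqxx in ne.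
Qed.

Lemma coord_row_gmul e k (kn : (k < n)%N) w :
  coord_row (succz e) ('X_(Ordinal kn) *: w) = coord_row e w *m gmul (free_mod sh) k e.
Proof.
rewrite monomial_modE //; apply/rowP => j; rewrite !mxE.
rewrite (eq_bigr (fun i => (fun x : 'I_r * 'X_{1..n} =>
   (tnth (in_tuple (free_basis n sh (succz e))) j == mono_act k x)%:R * (w 0 x.1)@_x.2)
     (tnth (in_tuple (free_basis n sh e)) i))) => [|i _]; last by rewrite !mxE mulrC.
rewrite -(big_tnth _ _ (free_basis n sh e) xpredT (fun x : 'I_r * 'X_{1..n} =>
   (tnth (in_tuple (free_basis n sh (succz e))) j == mono_act k x)%:R * (w 0 x.1)@_x.2)).
have := mem_tnth j (in_tuple (free_basis n sh (succz e))).
move: (tnth _ j) => y yin; rewrite mulrC.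
have [dk | ndk] := boolP (mono_dvd k y).
  have [x yE] := mono_dvdP kn dk; rewrite yE.
  rewrite (eq_bigr (fun z => (z == x)%:R * (w 0 z.1)@_z.2)) => [|z _]; last first.
    by rewrite (inj_eq (@mono_act_inj n r k)) eq_sym.
  rewrite sum_delta ?free_basis_uniq // (_ : x \in _);
    last by rewrite -(free_basis_act sh e x kn) -yE.
  by rewrite mul1r /= (var_monoU kn) addmC mcoeffMX.
rewrite big1 => [|z _].
  apply/eqP; rewrite mcoeff_eq0; apply: contra ndk.
  rewrite (perm_mem (msuppMX _ _)) => /mapP[m' _ e2].
  by rewrite -[k]/(val (Ordinal kn)) mono_dvdE e2 mnmDE mnm1E eqxx.
by rewrite (_ : (y == mono_act k z) = false) ?mul0r //; apply: contraNF ndk => /eqP ->;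
  apply: mono_dvd_act.
Qed.

End One.

Section Map.
Variables (r1 r0 : nat) (sh1 : 'I_r1 -> int) (sh0 : 'I_r0 -> int) (D : 'M[R]_(r1, r0)).
Hypothesis homD : forall k l, homog_of_degree (sh1 k - sh0 l) (D k l).

Definition free_map e : 'M[K]_(gdim (free_mod sh1) e, gdim (free_mod sh0) e) :=
  seqmx (free_basis n sh1 e) (free_basis n sh0 e) (fun x y => ('X_[x.2] * D x.1 y.1)@_y.2).

Lemma coord_row_map e w : coord_row sh0 e (w *m D) = coord_row sh1 e w *m free_map e.
Proof.
apply/rowP => j; rewrite !mxE.
rewrite (eq_bigr (fun i => (fun x : 'I_r1 * 'X_{1..n} => (w 0 x.1)@_x.2 *
   ('X_[x.2] * D x.1 (tnth (in_tuple (free_basis n sh0 e)) j).1)@_(tnth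
     (in_tuple (free_basis n sh0 e)) j).2)
     (tnth (in_tuple (free_basis n sh1 e)) i))) => [|i _]; last by rewrite !mxE.
rewrite -(big_tnth _ _ (free_basis n sh1 e) xpredT (fun x : 'I_r1 * 'X_{1..n} => (w 0 x.1)@_x.2 *
   ('X_[x.2] * D x.1 (tnth (in_tuple (free_basis n sh0 e)) j).1)@_(tnth
     (in_tuple (free_basis n sh0 e)) j).2)).
have := mem_tnth j (in_tuple (free_basis n sh0 e)); move: (tnth _ j) => [l m'] /=.
rewrite mem_free_basis /= => /eqP ej.
rewrite big_allpairs_dep /= big_enum raddf_sum /=; apply: eq_bigr => k _.
rewrite [w 0 k in LHS]mpolyE mulr_suml raddf_sum /=.
rewrite (eq_bigr (fun m => (w 0 k)@_m * ('X_[m] * D k l)@_m')) => [|m _]; last first.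
  by rewrite -scalerAl mcoeffZ.
apply: big_seq_support; rewrite ?msupp_uniq ?monomialsz_uniq // => m.
  move=> _; rewrite mem_monomialsz => ne.
  suff -> : ('X_[m] * D k l)@_m' = 0 by rewrite mulr0.
  apply/eqP; rewrite mcoeff_eq0; apply: contra ne; rewrite mulrC (perm_mem (msuppMX _ _)).
  case/mapP => m2 /homD md e2; rewrite -ej e2 mdegD PoszD md.
  by apply/eqP; move: (sh1 k) (sh0 l) => a b; lia.
by move=> _; rewrite mcoeff_msupp negbK => /eqP ->; rewrite mul0r.
Qed.

(** Both composites agree on rows that are coordinates of elements, where the claim is
    that D commutes with scalars. *)
Lemma free_map_gmorph : gmorph n free_map.
Proof.
move=> k e kn; apply/row_matrixP => i; rewrite !row_mul.
have [w [ew _]] := coord_row_lift (row i (1%:M : 'M[K]_(gdim (free_mod sh1) e))).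
have E : row i (gmul (free_mod sh1) k e) = coord_row sh1 e w *m gmul (free_mod sh1) k e.
  by rewrite ew -row_mul mul1mx.
have E' : row i (free_map e) = coord_row sh1 e w *m free_map e by rewrite ew -row_mul mul1mx.
by rewrite E E' -!(coord_row_gmul _ _ kn) -!coord_row_map -(coord_row_gmul _ _ kn) scalemxAl.
Qed.

End Map.
End Coordinates.

(** * Reduction modulo the variables *)

Section Constants.
Variables (K : fieldType) (n : nat).
Notation R := {mpoly K[n]}.
Notation fb sh e := (in_tuple (free_basis n sh e)).

Lemma sum_free_basis r (sh : 'I_r -> int) e (V : nmodType) (G : 'I_r * 'X_{1..n} -> V) :
  \sum_i G (tnth (fb sh e) i) = \sum_(x <- free_basis n sh e) G x.
Proof. by rewrite [RHS]big_tnth. Qed.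

Lemma eq_pairE r (x : 'I_r * 'X_{1..n}) k m : (x == (k, m)) = (x.1 == k) && (x.2 == m).
Proof. by case: x => a b; rewrite xpair_eqE. Qed.

Section One.
Variables (r : nat) (sh : 'I_r -> int).

(** Reduction modulo (x_1,...,x_n): a generator goes to itself and every other basis
    element to 0. *)
Definition generator_mx e : 'M[K]_(gdim (free_mod K n sh) e, r) :=
  \matrix_(i, k) (tnth (fb sh e) i == (k, 0%MM))%:R.

Definition generator_mxT e : 'M[K]_(r, gdim (free_mod K n sh) e) :=
  \matrix_(k, i) (tnth (fb sh e) i == (k, 0%MM))%:R.

Definition deg_part e : 'M[K]_r := diag_mx (\row_k (sh k == e)%:R).

Lemma gmul_row k e q (N : 'M[K]_(gdim (free_mod K n sh) (succz e), q)) i y : (k < n)%N ->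
  tnth (fb sh (succz e)) i = mono_act k y ->
  exists j, row i N = row j (gmul (free_mod K n sh) k e *m N).
Proof.
move=> kn iy; have : y \in free_basis n sh e.
  by rewrite -(free_basis_act sh e y kn) -iy mem_tnth.
move=> yin; have /tnthP[j ej] : y \in fb sh e by [].
exists j; rewrite row_mul [row j _](_ : _ = delta_mx 0 i) -?rowE //.
rewrite monomial_modE //; apply/rowP => l; rewrite !mxE eqxx /= -ej -iy.
have inj : injective (tnth (fb sh (succz e))) by apply/tuple_uniqP/free_basis_uniq.
by rewrite (inj_eq inj).
Qed.

Lemma gmul_kill e q (N : 'M[K]_(gdim (free_mod K n sh) (succz e), q)) i :
  (forall k, (k < n)%N -> gmul (free_mod K n sh) k e *m N = 0) ->
  (tnth (fb sh (succz e)) i).2 != 0%MM -> row i N = 0.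
Proof.
move=> h ne; have : exists k : 'I_n, (tnth (fb sh (succz e)) i).2 k != 0%N.
  apply/existsP; apply: contraR ne => /existsPn z; apply/eqP/mnmP => k; rewrite mnm0E.
  by apply/eqP; have := z k; rewrite negbK.
case=> k kne; have [y ey] : exists y, tnth (fb sh (succz e)) i = mono_act k y.
  by apply: mono_dvdP => //; rewrite mono_dvdE lt0n.
by have [j ->] := gmul_row N (ltn_ord k) ey; rewrite h // row0.
Qed.

Lemma generator_mxK e : generator_mx e *m generator_mxT e
  = diag_mx (\row_i ((tnth (fb sh e) i).2 == 0%MM)%:R).
Proof.
apply/matrixP => i j; rewrite !mxE.
have inj : injective (tnth (fb sh e)) by apply/tuple_uniqP/free_basis_uniq.
rewrite (eq_bigr (fun k => ((k == (tnth (fb sh e) i).1) && ((tnth (fb sh e) i).2 == 0%MM))%:R *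
    (tnth (fb sh e) j == (k, 0%MM))%:R)) => [|k _]; last first.
  by rewrite !mxE [_ == (k, _)]eq_pairE [_ == k]eq_sym.
rewrite (bigD1 (tnth (fb sh e) i).1) //= eqxx big1 ?addr0 => [|k /negPf ->]; last exact: mul0r.
have [e0 | _] := eqVneq (tnth (fb sh e) i).2; last by rewrite mul0r mul0rn.
by rewrite mul1r -e0 -surjective_pairing (inj_eq inj) eq_sym; case: eqP.
Qed.

(** A map that kills all multiples of the variables is determined by its values on the
    generators. *)
Lemma generator_mx_factor e q (N : 'M[K]_(gdim (free_mod K n sh) (succz e), q)) :
  (forall k, (k < n)%N -> gmul (free_mod K n sh) k e *m N = 0) ->
  N = generator_mx (succz e) *m (generator_mxT (succz e) *m N).
Proof.
move=> h; rewrite mulmxA generator_mxK; apply/matrixP => i j; rewrite mul_diag_mx !mxE.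
have [_ | /(gmul_kill h) /rowP/(_ j)] := eqVneq (tnth (fb sh (succz e)) i).2 0%MM.
  by rewrite mul1r.
by rewrite !mxE mul0r.
Qed.

Lemma gmul_generator_mx k e : (k < n)%N -> gmul (free_mod K n sh) k e *m generator_mx (succz e)
  = 0.
Proof.
move=> kn; rewrite monomial_modE //; apply/matrixP => i l; rewrite !mxE big1 // => j _;
  rewrite !mxE.
case: eqP => [-> | _]; last by rewrite mul0r.
rewrite (_ : (mono_act _ _ == _) = false) ?mulr0 //; apply/negbTE/negP => /eqP/(congr1 snd) /=.
move/(congr1 (@mdeg n)); rewrite mdegD mdeg_var_mono // mdeg0; lia.
Qed.

Lemma generator_mx_ker e : (kermx (generator_mx (succz e)) :=:
  \sum_(k < n) <<gmul (free_mod K n sh) k e>>)%MS.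
Proof.
apply/eqmxP/andP; split; last first.
  by apply/sumsmx_subP => k _; rewrite genmxE; apply/sub_kermxP/gmul_generator_mx.
set S := (\sum_(k < n) _)%MS; rewrite submxE (generator_mx_factor (N := cokermx S)).
  by rewrite mulmxA mulmx_ker mul0mx.
move=> k kn; apply/eqP; rewrite -submxE (sumsmx_sup (Ordinal kn)) // genmxE.
by [].
Qed.

Lemma generator_mx_image e :
  (kermx (kmap (generator_mx (succz e)) n 1) :=: kdiff (free_mod K n sh) n 1 e)%MS.
Proof.
apply: kdiff1_image => [k kn | q N h]; first exact: gmul_generator_mx.
by rewrite (generator_mx_factor h) mulmxA mulmx_ker mul0mx.
Qed.

Lemma generator_mxTK e : generator_mxT e *m generator_mx e = deg_part e.
Proof.
apply/matrixP => k l; rewrite !mxE.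
rewrite (eq_bigr (fun i => (fun x => (x == (k, 0%MM))%:R * (x == (l, 0%MM))%:R)
  (tnth (fb sh e) i))) => [|i _]; last by rewrite !mxE.
rewrite (sum_free_basis sh e (fun x => (x == (k, 0%MM))%:R * (x == (l, 0%MM))%:R)).
rewrite sum_delta ?free_basis_uniq // mem_free_basis /= mdeg0 add0r [(k, _) == _]eq_pairE /=
  eqxx andbT.
by case: (k =P l) => [-> | _]; rewrite ?mulr1 ?mulr0.
Qed.

Lemma generator_mx_deg e : generator_mx e *m deg_part e = generator_mx e.
Proof.
rewrite /deg_part; apply/matrixP => i k; rewrite mul_mx_diag !mxE.
case: eqP => [ei | _]; last by rewrite mul0r.
have := mem_tnth i (fb sh e); rewrite ei mem_free_basis /= mdeg0 add0r => ->.
by rewrite mulr1.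
Qed.

Lemma generator_mx_eqmx e : (generator_mx e :=: deg_part e)%MS.
Proof.
by apply/eqmxP/andP; split; [rewrite -generator_mx_deg | rewrite -generator_mxTK]; apply: submxMl.
Qed.
End One.

Definition constant_mx r1 r0 (D : 'M[R]_(r1, r0)) : 'M[K]_(r1, r0) :=
  map_mx (fun f : R => f@_0%MM) D.

Section Map.
Variables (r1 r0 : nat) (sh1 : 'I_r1 -> int) (sh0 : 'I_r0 -> int) (D : 'M[R]_(r1, r0)).
Hypothesis homD : forall k l, homog_of_degree (sh1 k - sh0 l) (D k l).

Lemma constant_coef_degree k l : (D k l)@_0%MM != 0 -> sh1 k = sh0 l.
Proof.
rewrite -mcoeff_msupp => /homD; rewrite mdeg0 => e.
by apply/eqP; rewrite -subr_eq0 -e.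
Qed.

(** Reduction turns the matrix D into its constant terms: by homogeneity, a nonconstant
    entry maps generators to multiples of the variables. *)
Lemma free_map_generator_mx e : free_map sh1 sh0 D e *m generator_mx sh0 e
  = generator_mx sh1 e *m constant_mx D.
Proof.
apply/matrixP => i l; rewrite !mxE; set x := tnth (fb sh1 e) i.
rewrite (eq_bigr (fun j => (fun y => (y == (l, 0%MM))%:R * ('X_[x.2] * D x.1 y.1)@_y.2)
  (tnth (fb sh0 e) j))) => [|j _]; last by rewrite !mxE mulrC.
rewrite (sum_free_basis sh0 e (fun y => (y == (l, 0%MM))%:R * ('X_[x.2] * D x.1 y.1)@_y.2)).
rewrite sum_delta ?free_basis_uniq //= mem_free_basis /= mdeg0 add0r.
have xin : x \in free_basis n sh1 e by apply: mem_tnth.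
have [x0 | x0] := eqVneq x.2 0%MM.
  rewrite (bigD1 x.1) //= !mxE big1 ?addr0 => [|k kx]; last first.
    rewrite !mxE -/x eq_pairE /= eq_sym (negPf kx) /=.
    exact: mul0r.
  rewrite -/x (_ : (x == (x.1, 0%MM)) = true); last by rewrite -x0 -surjective_pairing eqxx.
  rewrite mul1r x0 mpolyX0 mul1r; have [-> | nz] := eqVneq (D x.1 l)@_0%MM 0; first exact: mulr0.
  move: xin; rewrite mem_free_basis x0 mdeg0 add0r (constant_coef_degree nz) => ->; exact: mul1r.
rewrite big1 => [|k _]; last first.
  rewrite !mxE -/x eq_pairE /= (negPf x0) andbF; exact: mul0r.
rewrite [_@__](_ : _ = 0) ?mulr0 //; apply/eqP; rewrite mcoeff_eq0 mulrC (perm_mem (msuppMX _ _)).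
apply: contra x0 => /mapP[m' _ /(congr1 (@mdeg n))]; rewrite mdeg0 mdegD -mdeg_eq0; lia.
Qed.

Lemma deg_part_constant_mx e : constant_mx D *m deg_part sh0 e = deg_part sh1 e *m constant_mx D.
Proof.
rewrite /deg_part; apply/matrixP => k l; rewrite mul_mx_diag mul_diag_mx !mxE.
have [-> | nz] := eqVneq (D k l)@_0%MM 0; first by rewrite mul0r mulr0.
by rewrite (constant_coef_degree nz) mulrC.
Qed.

(** Constant terms are nonzero only between generators of the same degree, so the
    image of the constant matrix in degree e comes from degree e. *)
Lemma constant_mx_cap_deg e :
  (constant_mx D :&: deg_part sh0 e :=: generator_mx sh1 e *m constant_mx D)%MS.
Proof.
apply/eqmxP/andP; split; last first.
  by rewrite sub_capmx submxMl -free_map_generator_mx /= -(generator_mx_eqmx sh0 e) submxMl.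
apply/rV_subP => z; rewrite sub_capmx => /andP[/submxP[y ey] /submxP[y' ey']].
have dd : deg_part sh0 e *m deg_part sh0 e = deg_part sh0 e.
  by rewrite -{1}generator_mxTK -mulmxA generator_mx_deg generator_mxTK.
have -> : z = y *m deg_part sh1 e *m constant_mx D.
  by rewrite -mulmxA -deg_part_constant_mx mulmxA -ey ey' -mulmxA dd.
by rewrite (eqmxMr _ (generator_mx_eqmx sh1 e)) -mulmxA submxMl.
Qed.
End Map.

Lemma ker_mul_cap a b c (A : 'M[K]_(a, b)) (B : 'M_(b, c)) :
  (kermx (A *m B) *m A :=: kermx B :&: A)%MS.
Proof.
apply/eqmxP/andP; split.
  by rewrite sub_capmx submxMl andbT sub_kermx -mulmxA mulmx_ker.
apply/rV_subP => z; rewrite sub_capmx sub_kermx => /andP[z0 /submxP[y ey]].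
by rewrite ey; apply: submxMr; rewrite sub_kermx mulmxA -ey.
Qed.

(** The variables form a regular sequence on a free module, whose successive quotients
    have the bases [below]. *)
Lemma free_mod_acyclic r (sh : 'I_r -> int) i e : koszul_betti (free_mod K n sh) n i.+1 e = 0%N.
Proof.
rewrite /free_mod (koszul_betti_belowN K (fun k l u => mono_actC k l u) (@mono_dvd_act n r)
  (@mono_dvd_neq n r)).
apply: koszul_betti_below_free; [exact: mono_act_inj | exact: mono_dvdP |].
by move=> k c u kn; rewrite free_basis_act.
Qed.
End Constants.

(** * Betti numbers of a resolution as Koszul homology *)

Section Tor.
Variables (K : fieldType) (n : nat).
Notation R := {mpoly K[n]}.

Definition no_shift (k : 'I_1) : int := 0.
Notation P := (free_mod K n no_shift).
Definition poly_coord e (f : R) := coord_row no_shift e (f%:M : 'M_1).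

(** A is R/I in coordinates: rho is onto with kernel I in each degree.  A polynomial is
    homogeneous of degree e when its coordinates in all other degrees vanish. *)
Record presents (I : {pred R}) (A : gmod K) (rho : forall e, 'M[K]_(gdim P e, gdim A e)) : Prop :=
  Presents {
    pres_morph : gmorph n rho;
    pres_full : forall e, row_full (rho e);
    pres_ker : forall e f, (forall e', e' != e -> poly_coord e' f = 0) ->
      (poly_coord e f *m rho e == 0) = (f \in I)
  }.

(** The witness is the homogeneous component, which lies in I together with f. *)
Lemma poly_coord_component (I : {pred R}) : proper_homogeneous_ideal I -> forall e f, exists g,
  [/\ poly_coord e g = poly_coord e f, (forall e', e' != e -> poly_coord e' g = 0) & f \in I ->
    g \in I].
Proof.
move=> [idI homI] e f.
have pE e' g i : poly_coord e' g 0 i = g@_(tnth (in_tuple (free_basis n no_shift e')) i).2.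
  by rewrite !mxE; case: (tnth _ i) => a m /=; rewrite !ord1 eqxx mulr1n.
have deg e' i : (mdeg (tnth (in_tuple (free_basis n no_shift e')) i).2)%:Z = e'.
  by have := mem_tnth i (in_tuple (free_basis n no_shift e'));
    rewrite mem_free_basis addr0 => /eqP.
case: e => d.
  exists (pihomog mdeg d f); have hc m : (pihomog mdeg d f)@_m = f@_m *+ (mdeg m == d).
    rewrite pihomogE raddf_sum /= -big_filter /=.
    rewrite (eq_bigr (fun m' => (m' == m)%:R * f@_m')) => [|m' _]; last first.
      by rewrite mcoeffZ mcoeffX mulrC.
    rewrite sum_delta ?filter_uniq ?msupp_uniq // mem_filter.
    have [-> | nz] := eqVneq f@_m 0; first by rewrite mulr0 mul0rn.
    by rewrite mcoeff_msupp nz andbT mulr_natl.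
  split=> [|e' ne|]; last exact: homI.
    apply/rowP => i; rewrite !pE hc; move: (tnth _ i).2 (deg d i) => m [->].
    by rewrite eqxx.
  apply/rowP => i; rewrite pE hc mxE; move: (tnth _ i).2 (deg e' i) => m me.
  by rewrite (_ : (mdeg m == d) = false) //; apply: contraNF ne => /eqP <-; rewrite me.
exists 0; split=> [|e' _|_].
- apply/rowP => i; have := deg (Negz d) i; by [].
- by apply/rowP => i; rewrite pE mcoeff0 mxE.
- by case: idI.
Qed.

Section Resolution.
Variables (I : {pred R}) (hI : proper_homogeneous_ideal I) (F : graded_free_resolution I).
Variables (A : gmod K) (rho : forall e, 'M[K]_(gdim P e, gdim A e)).
Hypothesis pA : presents I rho.

Let Fm p := free_mod K n (res_shift (g := F) (p := p)).
Let diff_map p e : 'M[K]_(gdim (Fm p.+1) e, gdim (Fm p) e) := free_map _ _ (res_diff F p) e.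
Let aug_map e : 'M[K]_(gdim (Fm 0) e, gdim P e) := free_map _ no_shift (res_aug F) e.
Let eps e : 'M[K]_(gdim (Fm 0) e, gdim A e) := aug_map e *m rho e.

Let hom_aug k l : homog_of_degree (res_shift (g := F) (p := 0) k - no_shift l) (res_aug F k l).
Proof. by rewrite subr0 (ord1 l); apply: aug_homog. Qed.

Let diff_map_morph p : gmorph n (diff_map p).
Proof. exact/free_map_gmorph/diff_homog. Qed.

Let eps_morph : gmorph n eps.
Proof.
move=> k e kn; rewrite /eps mulmxA (free_map_gmorph hom_aug) // -!mulmxA.
by rewrite (pres_morph pA).
Qed.

Let aug_row (w : 'rV[R]_(res_rank F 0)) : w *m res_aug F = ((w *m res_aug F) 0 0)%:M.
Proof. by rewrite [LHS]mx11_scalar. Qed.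

Let poly_coord_aug e (w : 'rV[R]_(res_rank F 0)) :
  poly_coord e ((w *m res_aug F) 0 0) = coord_row _ e w *m aug_map e.
Proof. by rewrite /poly_coord -aug_row (coord_row_map hom_aug). Qed.

Let eps_ker e (w : 'rV[R]_(res_rank F 0)) :
  (forall e', e' != e -> coord_row (res_shift (g := F) (p := 0)) e' w = 0) ->
  (coord_row _ e w *m eps e == 0) = ((w *m res_aug F) 0 0 \in I).
Proof.
move=> h; rewrite /eps mulmxA -poly_coord_aug (pres_ker pA) // => e' ne.
by rewrite poly_coord_aug h // mul0mx.
Qed.

Let exact0 e : (kermx (eps e) :=: diff_map 0 e)%MS.
Proof.
apply/eqmxP/rV_eqP => u; rewrite sub_kermx; apply/idP/idP.
  have [w [<- h]] := coord_row_lift u; rewrite eps_ker // => /(exact_aug w)[v ->].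
  by rewrite (coord_row_map (diff_homog (p := 0))) submxMl.
case/submxP => y ->; have [v [<- h]] := coord_row_lift y.
rewrite -(coord_row_map (diff_homog (p := 0))) eps_ker; first by apply/(exact_aug (g := F));
  exists v.
by move=> e' ne; rewrite (coord_row_map (diff_homog (p := 0))) h // mul0mx.
Qed.

Let exactS p e : (kermx (diff_map p e) :=: diff_map p.+1 e)%MS.
Proof.
apply/eqmxP/rV_eqP => u; rewrite sub_kermx; apply/idP/idP.
  have [w [<- h]] := coord_row_lift u; rewrite -(coord_row_map (diff_homog (p := p))) => /eqP c0.
  have : w *m res_diff F p = 0.
    apply: (coord_row_inj (sh := res_shift (g := F) (p := p))) => e'; rewrite coord_row0.
    have [-> // | ne] := eqVneq e' e.
    by rewrite (coord_row_map (diff_homog (p := p))) h // mul0mx.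
  by case/(exact_diff (g := F)) => v ->; rewrite (coord_row_map (diff_homog (p := p.+1))) submxMl.
case/submxP => y ->; have [v [<- h]] := coord_row_lift y.
rewrite -(coord_row_map (diff_homog (p := p.+1))) -(coord_row_map (diff_homog (p := p))).
by rewrite (_ : _ *m res_diff F p = 0) ?coord_row0 //; apply/(exact_diff (g := F)); exists v.
Qed.

Let eps_full e : row_full (eps e).
Proof.
rewrite -sub1mx; apply/rV_subP => a _.
have /submxP[b ->] : (a <= rho e)%MS by apply/submx_full/(pres_full pA).
have [w [eb hw]] := coord_row_lift b.
pose f := w 0 0; have wf : w = f%:M by rewrite [w]mx11_scalar.
have [u hu] := aug_surj F f.
have [g [ge g0 gI]] := poly_coord_component hI e (f - (u *m res_aug F) 0 0).
have := pres_ker pA g0; rewrite gI // => /eqP; rewrite ge.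
have -> : poly_coord e (f - (u *m res_aug F) 0 0) = b - coord_row _ e u *m aug_map e.
  by rewrite /poly_coord raddfB /= coord_rowB -/(poly_coord _ _) -/(poly_coord _ _)
    poly_coord_aug /poly_coord -wf eb.
rewrite mulmxBl => /eqP; rewrite subr_eq0 => /eqP ->.
by rewrite -mulmxA submxMl.
Qed.

Let E q : gmod K := if q is p.+1 then Fm p else A.
Let fE q : forall e, 'M[K]_(gdim (E q.+1) e, gdim (E q) e) :=
  match q return forall e, 'M[K]_(gdim (E q.+1) e, gdim (E q) e) with
  | 0 => eps
  | p.+1 => diff_map p
  end.

Let fE_morph q : gmorph n (fE q).
Proof. by case: q. Qed.

Let fE_exact q e : (kermx (fE q e) :=: fE q.+1 e)%MS.
Proof. by case: q => [|q]; [exact: exact0 | exact: exactS]. Qed.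

Let kerhom_iter p q d : kerhom (fE q) n p.+1 d = kerhom (fE (q + p)) n 1 (iter p succz d).
Proof.
elim: p q d => [|p IH] q d; first by rewrite addn0.
rewrite (kerhom_shift (fE_morph q.+1) (fE_morph q) (fE_exact q)); try exact: free_mod_acyclic.
by rewrite IH addSnnS iterSr.
Qed.

Let koszul_kerhom p d : koszul_betti A n p.+2 d = kerhom eps n p.+1 (succz d).
Proof.
rewrite -kerhom0; apply: (kerhom_shift (g := eps)); try exact: free_mod_acyclic.
- exact: eps_morph.
- by move=> k e _; rewrite mulmx0 mul0mx.
move=> e; apply/eqmxP; rewrite submx_full ?eps_full //=.
by rewrite sub_kermx mulmx0.
Qed.

(** Common end of the two cases of [betti_koszul]: f is the p-th map of the augmented
    resolution, or the zero map on A when there is none before. *)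
Let last_rank p d : let j := succz (succz d) in forall q
  (f : forall e, 'M[K]_(gdim (E p) e, gdim (E q) e)),
   gmorph n f -> (forall e, (kermx (f e) :=: fE p e)%MS) ->
   kerhom f n 1 d = betti F p.+1 j.
Proof.
move=> j q f fm fx.
rewrite (@kerhom_last K (E p.+3) (E p.+2) (E p.+1) (E p) (E q) n _ _ (fE p.+2) (fE p.+1) (fE p) f
  (fE_morph p.+1) (fE_morph p) fm fx (fE_exact p) (fE_exact p.+1) d
  (generator_mx K n (res_shift (g := F) (p := p)) j)
    (generator_mx K n (res_shift (g := F) (p := p.+1)) j)
  (generator_mx_image _ _ _ _) (generator_mx_image _ _ _ _) (free_mod_acyclic _ _ _ _ _)).
rewrite /betti /=; congr (_ - _)%N; last first.
  by rewrite (free_map_generator_mx (diff_homog (p := p.+1)))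
    -(constant_mx_cap_deg (diff_homog (p := p.+1))).
rewrite (free_map_generator_mx (diff_homog (p := p))) ker_mul_cap.
by rewrite (cap_eqmx (eqmx_refl _) (generator_mx_eqmx _ _ _ _)).
Qed.

Let zero_morph : gmorph n (fun d => 0 : 'M[K]_(gdim A d)).
Proof. by move=> k e _; rewrite mulmx0 mul0mx. Qed.

Let zero_exact e : (kermx (0 : 'M[K]_(gdim A e)) :=: eps e)%MS.
Proof.
apply/eqmxP; rewrite submx_full ?eps_full //=.
by rewrite sub_kermx mulmx0.
Qed.

(** Tor is symmetric: the resolution of A against the Koszul resolution of K.  The
    internal degree is that of the module plus the homological degree. *)
Lemma betti_koszul p d : betti F p.+1 (iter p.+2 succz d) = koszul_betti A n p.+1 d.
Proof.
case: p => [|p].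
  by rewrite -kerhom0; apply/esym/(@last_rank 0 d 0); [exact: zero_morph | exact: zero_exact].
rewrite koszul_kerhom (kerhom_iter p 0 (succz d)) add0n.
by rewrite (@last_rank p.+1 _ p (fE p) (fE_morph p) (fE_exact p)) -iterSr.
Qed.

(** Right exactness of the tensor product: the cokernel of F_1/m -> F_0/m is A/mA. *)
Lemma betti0_generators d : betti F 0 (succz d) =
  (gdim A (succz d) - \rank (\sum_(k < n) <<gmul A k d>>)%MS)%N.
Proof.
set B2 := (\sum_(k < n) _)%MS; set j := succz d.
have z2 : (1%:M *m eps j + B2 :=: 1%:M)%MS.
  by apply/eqmxP; rewrite submx1 mul1mx (submx_trans _ (addsmxSl _ _)) // sub1mx eps_full.
pose k0 := generator_mx K n (res_shift (g := F) (p := 0)) j.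
have e0 : (generator_mx K n (res_shift (g := F) (p := 1)) j *m constant_mx (res_diff F 0)
  = diff_map 0 j *m k0).
  by rewrite (free_map_generator_mx (diff_homog (p := 0))).
have z1 : (1%:M *m k0 + diff_map 0 j *m k0 :=: k0)%MS.
  by rewrite mul1mx; apply/addsmx_idPl; apply: submxMl.
rewrite /betti /= (cap_eqmx (eqmx_refl _)
  (eqmx_sym (generator_mx_eqmx K n (res_shift (g := F) (p := 0)) j))).
rewrite (capmx_idPr (submx1 _)) (constant_mx_cap_deg (diff_homog (p := 0))) e0 -/k0 -z1.
rewrite -[X in _ = (X - _)%N](mxrank1 K) -z2.
pose SF := (\sum_(k < n) <<gmul (Fm 0) k d>>)%MS.
have kF : (kermx k0 :=: SF)%MS by exact: generator_mx_ker.
have de0 : diff_map 0 j *m eps j = 0 by apply/sub_kermxP; rewrite exact0.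
have SFA : (SF *m eps j :=: B2)%MS.
  apply: eqmx_trans (sumsmxMr_gen _ _ _) (eqmx_sums _) => k _.
  apply: eqmx_trans (genmxE _) (eqmx_trans (eqmxMr _ (genmxE _)) _).
  by rewrite (eps_morph d (ltn_ord k)); apply:
    eqmx_trans (eqmxMfull _ (eps_full _)) (eqmx_sym (genmxE _)).
apply: rank_subquotient => u _.
apply/idP/idP.
  case/submxP => y ey.
  have u0 : (u - y *m diff_map 0 j <= SF)%MS by rewrite -kF sub_kermx mulmxBl ey mulmxA subrr.
  have : ((u - y *m diff_map 0 j) *m eps j <= B2)%MS by rewrite -SFA; apply: submxMr.
  by rewrite mulmxBl -mulmxA de0 mulmx0 subr0.
rewrite -SFA => /submxP[y ey].
have : (u - y *m SF <= diff_map 0 j)%MS by rewrite -exact0 sub_kermx mulmxBl ey mulmxA subrr.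
case/submxP => z ez; have -> : u *m k0 = (u - y *m SF) *m k0.
  have : (y *m SF <= kermx k0)%MS by rewrite kF submxMl.
  by rewrite sub_kermx => /eqP y0; rewrite mulmxBl y0 subr0.
by rewrite ez -mulmxA submxMl.
Qed.

End Resolution.
End Tor.

(** * The quotient by a homogeneous ideal *)

(** A subspace of largest dimension among those contained in p. *)
Lemma linear_predicate_vspace (K : fieldType) (vT : vectType K) (p : vT -> Prop) :
  p 0 -> (forall a u v, p u -> p v -> p (a *: u + v)) ->
  exists U : {vspace vT}, forall v, v \in U <-> p v.
Proof.
move=> p0 pl.
have step x (U : {vspace vT}) : (\dim {: vT} - \dim U <= x)%N -> (forall v, v \in U -> p v) ->
    exists U' : {vspace vT}, forall v, v \in U' <-> p v.
  elim: x U => [|x IH] U dU pU.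
    have eU : U = fullv.
      by apply/eqP; rewrite eqEdim subvf /= -subn_eq0 -leqn0.
    by exists U => v; split=> [|_]; [exact: pU | rewrite eU memvf].
  case: (classic (exists2 v, p v & v \notin U)) => [[v pv nv] | no].
    apply: (IH (U + <[v]>)%VS) => [|w /memv_addP[u uU [w' /vlineP[a ->] ->]]]; last first.
      by rewrite addrC; apply: pl => //; apply: pU.
    have lt : (\dim U < \dim (U + <[v]>))%N.
      rewrite ltnNge; apply: contra nv => le.
      have /eqP -> : U == (U + <[v]>)%VS by rewrite eqEdim addvSl.
      by rewrite (subvP (addvSr _ _)) ?memv_line.
    by move: dU lt; lia.
  exists U => v; split=> [|pv]; first exact: pU.
  by apply: contraT => nv; case: no; exists v.
apply: (step _ 0%VS (leqnn _)) => v; rewrite memv0 => /eqP -> //.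
Qed.

Section Ideal.
Variables (K : fieldType) (n : nat) (I : {pred {mpoly K[n]}}).
Hypothesis hI : proper_homogeneous_ideal I.
Notation R := {mpoly K[n]}.
Implicit Types (f g : R) (d : nat).

Lemma ideal0 : 0 \in I.
Proof. by case: hI => -[]. Qed.

Lemma idealN1 : 1 \notin I.
Proof. by case: hI => -[]. Qed.

Lemma idealMD a f g : f \in I -> g \in I -> a * f + g \in I.
Proof. by move=> fI gI; case: hI => -[_ _ h] _; apply: h. Qed.

Lemma idealM a f : f \in I -> a * f \in I.
Proof. by move=> fI; rewrite -[a * f]addr0 idealMD ?ideal0. Qed.

Lemma idealZ (a : K) f : f \in I -> a *: f \in I.
Proof. by move=> fI; rewrite -mul_mpolyC idealM. Qed.

Lemma idealD f g : f \in I -> g \in I -> f + g \in I.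
Proof. by move=> fI gI; rewrite -[f]mul1r idealMD. Qed.

Lemma ideal_sum (T : Type) (s : seq T) (P : pred T) (G : T -> R) :
  (forall x, P x -> G x \in I) -> \sum_(x <- s | P x) G x \in I.
Proof. by move=> h; elim/big_ind: _ => //; [exact: ideal0 | exact: idealD]. Qed.

Lemma form_of_row_linear d (a : K) (u v : 'rV[K]_(size (monomials n d))) :
  form_of_row (a *: u + v) = a *: form_of_row u + form_of_row v.
Proof.
rewrite /form_of_row scaler_sumr -big_split; apply: eq_bigr => k _ /=.
by rewrite !mxE scalerDl scalerA.
Qed.

Lemma ideal_partP d v : (v \in ideal_part I d) = (form_of_row v \in I).
Proof.
have ex : exists U : {vspace 'rV[K]_(size (monomials n d))},
    forall v, (v \in U) = (form_of_row v \in I).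
  have [||U UP] := @linear_predicate_vspace K _
    (fun v : 'rV[K]_(size (monomials n d)) => form_of_row v \in I).
  - by rewrite /form_of_row big1 ?ideal0 // => k _; rewrite mxE scale0r.
  - by move=> a u w uI wI; rewrite form_of_row_linear idealD ?idealZ.
  by exists U => w; apply/idP/idP => /UP.
exact: (epsilon_spec (inhabits 0%VS) _ ex v).
Qed.

Lemma form_of_row_coef d (v : 'rV[K]_(size (monomials n d))) m :
  (form_of_row v)@_m = \sum_(k < size (monomials n d)) v 0 k *
    (nth 0%MM (monomials n d) k == m)%:R.
Proof. by rewrite raddf_sum /=; apply: eq_bigr => k _; rewrite mcoeffZ mcoeffX. Qed.

Lemma form_of_row_nth d (v : 'rV[K]_(size (monomials n d))) (k : 'I_(size (monomials n d))) :
  (form_of_row v)@_(nth 0%MM (monomials n d) k) = v 0 k.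
Proof.
rewrite form_of_row_coef (bigD1 k) //= eqxx mulr1 big1 ?addr0 // => l.
by rewrite -val_eqE /= => /negPf lk; rewrite nth_uniq ?monomials_uniq // lk mulr0.
Qed.

Lemma form_of_row_deg d (v : 'rV[K]_(size (monomials n d))) m :
  (form_of_row v)@_m != 0 -> mdeg m = d.
Proof.
apply: contraNeq => md; rewrite form_of_row_coef big1 // => k _.
case: eqP => [e | _]; last by rewrite mulr0.
have := mem_nth 0%MM (ltn_ord k); rewrite e mem_monomials => /eqP md'.
by rewrite md' eqxx in md.
Qed.

Notation P := (free_mod K n no_shift).
Notation fb e := (in_tuple (free_basis n no_shift e)).

Lemma poly_coordE e f i : poly_coord e f 0 i = f@_(tnth (fb e) i).2.
Proof. by rewrite !mxE; case: (tnth _ i) => a m /=; rewrite !ord1 eqxx mulr1n. Qed.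

Lemma mem_free_basis0 e (i : 'I_1) m : ((i, m) \in free_basis n no_shift e) = ((mdeg m)%:Z == e).
Proof. by rewrite mem_free_basis addr0. Qed.

Lemma poly_coord_homog e f : (forall m, m \in msupp f -> (mdeg m)%:Z = e) ->
  forall e', e' != e -> poly_coord e' f = 0.
Proof.
move=> hf e' ne; apply/rowP => i; rewrite poly_coordE mxE; apply/eqP; rewrite mcoeff_eq0.
apply: contra ne => /hf <-; have := mem_tnth i (fb e').
by rewrite [tnth _ _]surjective_pairing mem_free_basis0 eq_sym.
Qed.

Lemma poly_coord_homog_inv e f : (forall e', e' != e -> poly_coord e' f = 0) ->
  forall m, m \in msupp f -> (mdeg m)%:Z = e.
Proof.
move=> h m; rewrite mcoeff_msupp; apply: contraNeq => ne.
have : (ord0, m) \in fb (mdeg m)%:Z by rewrite mem_free_basis0.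
case/tnthP => i ei; have := congr1 (fun u : 'rV__ => u 0 i) (h _ ne).
by rewrite poly_coordE -ei mxE => ->.
Qed.

Definition mono_mx d : 'M[K]_(size (monomials n d), gdim P d) :=
  seqmx (monomials n d) (free_basis n no_shift d) (fun m x => (m == x.2)%:R).

Lemma mono_mx_row d (v : 'rV[K]_(size (monomials n d))) :
  v *m mono_mx d = poly_coord d (form_of_row v).
Proof.
apply/rowP => i; rewrite poly_coordE form_of_row_coef mxE; apply: eq_bigr => k _.
by rewrite !mxE (tnth_nth 0%MM).
Qed.

Lemma mono_mx_free d : row_free (mono_mx d).
Proof.
rewrite -kermx_eq0 -submx0; apply/rV_subP => v; rewrite sub_kermx mono_mx_row => /eqP v0.
suff -> : v = 0 by rewrite sub0mx.
apply/rowP => k; rewrite -form_of_row_nth mxE; set m := nth _ _ _.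
have : (ord0, m) \in fb d by rewrite mem_free_basis0 -mem_monomialsz /= mem_nth.
case/tnthP => i ei; have := congr1 (fun u : 'rV__ => u 0 i) v0.
by rewrite poly_coordE -ei mxE.
Qed.

Lemma size_free_basis0 d : size (free_basis n no_shift d) = size (monomials n d).
Proof.
rewrite -(size_map (pair (ord0 : 'I_1)) (monomials n d)); apply: perm_size; apply: uniq_perm.
- exact: free_basis_uniq.
- by rewrite map_inj_uniq ?monomials_uniq // => x y [].
move=> [i m]; rewrite mem_free_basis0 ord1; apply/idP/mapP => [md | [m' + [->]]].
  by exists m; rewrite // mem_monomials; move: md; rewrite eqz_nat.
by rewrite mem_monomials eqz_nat.
Qed.

(** The degree part of I, carried from the coordinates of [ideal_part] to those of the
    free module of rank 1. *)
Definition ideal_mx (e : int) : 'M[K]_(gdim P e) :=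
  match e return 'M[K]_(gdim P e) with
  | Posz d => <<(\matrix_(i < \dim (ideal_part I d)) (vbasis (ideal_part I d))`_i) *m mono_mx
    d>>%MS
  | Negz _ => 0
  end.

Lemma sub_basis_mx d (v : 'rV[K]_(size (monomials n d))) :
  (v <= \matrix_(i < \dim (ideal_part I d)) (vbasis (ideal_part I d))`_i)%MS
    = (v \in ideal_part I d).
Proof.
set U := ideal_part I d; apply/idP/idP => [/submxP[y ->] | vU].
  rewrite mulmx_sum_row; apply: memv_suml => i _; apply: memvZ.
  by rewrite rowK vbasis_mem // mem_nth // size_tuple.
rewrite (coord_vbasis vU); apply: summx_sub => i _; apply: scalemx_sub.
have := row_sub i (\matrix_(i < \dim U) (vbasis U)`_i); rewrite rowK.
by [].
Qed.

Lemma rank_basis_mx d :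
  \rank (\matrix_(i < \dim (ideal_part I d)) (vbasis (ideal_part I d))`_i)
    = \dim (ideal_part I d).
Proof.
set U := ideal_part I d; set B := \matrix_(i < _) _.
apply/eqP; rewrite -/(row_free B) -kermx_eq0 -submx0; apply/rV_subP => y.
rewrite sub_kermx mulmx_sum_row => /eqP s0.
suff -> : y = 0 by rewrite sub0mx.
have fr := basis_free (vbasisP U); apply/rowP => i; rewrite mxE.
have /freeP h := fr; apply: (h (fun i => y 0 i)); rewrite -[RHS]s0.
by apply: eq_bigr => k _; rewrite rowK.
Qed.

Lemma rank_ideal_mx d : \rank (ideal_mx d) = \dim (ideal_part I d).
Proof. by rewrite /= mxrank_gen mxrankMfree ?mono_mx_free // rank_basis_mx. Qed.

Lemma homog_form d f : (forall m, m \in msupp f -> mdeg m = d) ->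
  exists v : 'rV[K]_(size (monomials n d)), f = form_of_row v.
Proof.
move=> hf; exists (\row_k f@_(nth 0%MM (monomials n d) k)); apply/mpolyP => m.
have [md | md] := eqVneq (mdeg m) d; last first.
  apply: etrans (_ : _ = 0) _; first by apply/eqP; rewrite mcoeff_eq0; apply: contra md => /hf ->.
  by apply/esym/eqP; apply: contraNT md => /form_of_row_deg ->.
have : m \in monomials n d by rewrite mem_monomials md.
case/(nthP 0%MM) => k lt <-; have := form_of_row_nth (\row_k f@_(nth 0%MM (monomials n d) k))
  (Ordinal lt).
by rewrite mxE => ->.
Qed.

Lemma ideal_mxP e f : (forall e', e' != e -> poly_coord e' f = 0) ->
  (poly_coord e f <= ideal_mx e)%MS = (f \in I).
Proof.
move=> /poly_coord_homog_inv hf; case: e hf => d hf.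
  have [|v ->] := @homog_form d f; first by move=> m /hf [].
  rewrite -mono_mx_row /= genmxE -ideal_partP -sub_basis_mx.
  apply/idP/idP; last exact: submxMr.
  case/submxP => y; rewrite mulmxA => /(row_free_inj (mono_mx_free d)) ->.
  exact: submxMl.
have -> : f = 0.
  apply/mpolyP => m; rewrite mcoeff0; apply/eqP; rewrite mcoeff_eq0; apply/negP => /hf; by [].
by rewrite ideal0 /poly_coord /=; apply/eqP; rewrite (_ : _%:M = 0) ?raddf0 // coord_row0 sub0mx.
Qed.

Lemma ideal_mx_rows e (u : 'rV[K]_(gdim P e)) : (u <= ideal_mx e)%MS ->
  exists2 f, (forall e', e' != e -> poly_coord e' f = 0) /\ u = poly_coord e f & f \in I.
Proof.
move=> uI; have [w [ew hw]] := coord_row_lift u.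
have wf : w = (w 0 0)%:M by rewrite {1}[w]mx11_scalar.
have h0 e' : e' != e -> poly_coord e' (w 0 0) = 0 by rewrite /poly_coord -wf; apply: hw.
have eu : u = poly_coord e (w 0 0) by rewrite /poly_coord -wf.
by exists (w 0 0) => //; rewrite -(ideal_mxP h0) -eu.
Qed.

Lemma ideal_mx_gmul k e : (ideal_mx e *m gmul P k e <= ideal_mx (succz e))%MS.
Proof.
apply/row_subP => i; rewrite row_mul.
have [f [h ->] fI] := ideal_mx_rows (row_sub i (ideal_mx e)).
have [kn | nk] := ltnP k n; last by rewrite /= /monomial_mul ltnNge nk /= mulmx0 sub0mx.
rewrite /poly_coord -(coord_row_gmul no_shift e kn) scale_scalar_mx -/(poly_coord (succz e) _)
  ideal_mxP ?idealM //.
apply: poly_coord_homog => m; rewrite mulrC (perm_mem (msuppMX _ _)) =>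
  /mapP[m' /(poly_coord_homog_inv h) me ->].
by rewrite mdegD mdeg1 PoszD me succzE addrC.
Qed.

Definition quo_pi e := col_base (cokermx (ideal_mx e)).

Lemma quo_pi_ker e (u : 'rV[K]_(gdim P e)) : (u *m quo_pi e == 0) = (u <= ideal_mx e)%MS.
Proof.
rewrite submxE -[in RHS](mulmx_base (cokermx _)) mulmxA.
by rewrite [RHS](mulmx_free_eq0 _ (row_base_free _)).
Qed.

Lemma quo_pi_stable k e : kermx (quo_pi e) *m gmul P k e *m quo_pi (succz e) = 0.
Proof.
apply/row_matrixP => i; rewrite row0 (row_mul i (kermx _ *m _)) (row_mul i (kermx _));
  apply/eqP; rewrite quo_pi_ker.
apply: submx_trans (ideal_mx_gmul k e); apply: submxMr.
by rewrite -quo_pi_ker -(row_mul i (kermx _)) mulmx_ker row0.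
Qed.

Definition quo_mod : gmod K :=
  quotient_mod (fun e => col_base_full (cokermx (ideal_mx e))) quo_pi_stable.

Lemma quo_presents : presents I (quo_pi : forall e, 'M_(gdim P e, gdim quo_mod e)).
Proof.
split=> [k e kn | e | e f h]; [by rewrite -quotient_modP | exact: col_base_full |].
by rewrite quo_pi_ker ideal_mxP.
Qed.

Lemma gdim_quo d : gdim quo_mod d = hilbert I d.
Proof. by rewrite /= mxrank_coker rank_ideal_mx /hilbert size_free_basis0. Qed.
End Ideal.

(** * Lex-segment ideals *)

Section Presentation.
Variables (K : fieldType) (n : nat) (I : {pred {mpoly K[n]}}).
Hypothesis hI : proper_homogeneous_ideal I.
Notation R := {mpoly K[n]}.
Notation P := (free_mod K n no_shift).
Notation fb e := (in_tuple (free_basis n no_shift e)).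

Section Any.
Variables (A : gmod K) (rho : forall e, 'M[K]_(gdim P e, gdim A e)).
Hypothesis pA : presents I rho.

Lemma pres_neg k : gdim A (Negz k) = 0%N.
Proof.
apply/eqP; rewrite -leqn0 -(eqP (pres_full pA (Negz k))); apply: leq_trans (rank_leq_row _) _.
rewrite /= leqn0 size_eq0; case E : (free_basis n no_shift (Negz k)) => [//|x s].
by have : x \in free_basis n no_shift (Negz k);
  [rewrite E mem_head | rewrite mem_free_basis addr0].
Qed.

Lemma pres_zero : gdim A 0 = 1%N.
Proof.
apply/eqP; rewrite -(eqP (pres_full pA 0)) eqn_leq; apply/andP; split.
  by apply: leq_trans (rank_leq_row _) _; rewrite /= size_free_basis0 monomials0.
rewrite lt0n mxrank_eq0; apply: contra (idealN1 hI) => /eqP r0.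
rewrite -(pres_ker pA (e := 0)) ?r0 ?mulmx0 //; apply: poly_coord_homog => m.
by rewrite -mpolyX0 msuppX inE => /eqP ->; rewrite mdeg0.
Qed.

Lemma pres_standard : standard n A.
Proof.
move=> e q N h; apply: (row_full_inj (pres_full pA e.+1)); rewrite mulmx0.
apply/row_matrixP => i; rewrite row0.
have ei := mem_tnth i (fb e.+1); apply: (gmul_kill (e := Posz e)) => [k kn|].
  by rewrite mulmxA (pres_morph pA) // -mulmxA h // mulmx0.
apply/negP => /eqP m0; move: ei; rewrite mem_free_basis m0 mdeg0 addr0.
by [].
Qed.

Lemma betti0_value (F : graded_free_resolution I) j : betti F 0 j = (j == 0) :> nat.
Proof.
have [d ->] := succz_surj j; rewrite (betti0_generators hI F pA).
case: d => [d | [|k]] /=.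
- rewrite (_ : \rank _ = gdim A d.+1) ?subnn //; apply/eqP; rewrite -/(row_full _) -sub1mx.
  rewrite submxE mul1mx; apply/eqP/pres_standard => k kn; apply/eqP.
  by rewrite -submxE (sumsmx_sup (Ordinal kn)) // genmxE.
- rewrite (_ : \rank _ = 0%N); first by rewrite subn0; exact: pres_zero.
  apply/eqP; rewrite mxrank_eq0 -submx0.
  apply/sumsmx_subP => k _; rewrite genmxE (_ : gmul A k (Negz 0) = 0) ?sub0mx //.
  by move: (gmul A k (Negz 0)); rewrite pres_neg => M; rewrite flatmx0.
by apply/eqP; rewrite -leqn0 -(pres_neg k) leq_subr.
Qed.
End Any.

Hypothesis lexI : lex_segment_ideal I.
Notation initial d := (take (\dim (ideal_part I d)) (monomials n d)).

Lemma initial_deg d m : m \in initial d -> mdeg m = d.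
Proof. by move/mem_take; rewrite mem_monomials => /eqP. Qed.

Lemma initial_ideal d m : m \in initial d -> 'X_[m] \in I.
Proof.
move=> mi; have [_ h] := lexI d 'X_[m].
case: h => [|s [sI ->]].
  exists [:: (1, 'X_[m])]; rewrite big_seq1 mul1r; split=> // c.
  by rewrite inE => /eqP ->; exists m.
rewrite big_seq; apply: (ideal_sum hI) => c cs.
by apply: (idealM hI); case: (sI c cs).
Qed.

(** In degree d, both ideals of the definition reduce to the spans of their generators,
    since the cofactors of generators of degree d are constants there. *)
Lemma lex_homog d f : (forall m, m \in msupp f -> mdeg m = d) ->
  (f \in I) <-> (forall m, m \in msupp f -> m \in initial d).
Proof.
move=> hf; split=> [fI m mf | h]; last first.
  rewrite [f]mpolyE big_seq; apply: (ideal_sum hI) => m mf.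
  by apply: (idealZ hI); apply: initial_ideal (h m mf).
have [h _] := lexI d f; case: h => [|s [sg ef]].
  exists [:: (1, f)]; rewrite big_seq1 mul1r; split=> // c; rewrite inE => /eqP -> /=.
  by split=> //; apply/dhomogP.
have md := hf m mf; move: mf; rewrite mcoeff_msupp ef raddf_sum /=.
apply: contraR => nm; rewrite big_seq big1 // => c cs; have [m' m'i ->] := sg c cs.
apply/eqP; rewrite mcoeff_eq0 (perm_mem (msuppMX _ _)); apply: contra nm => /mapP[m2 _ em].
have /eqP := congr1 (@mdeg n) em; rewrite md mdegD (initial_deg m'i) -{1}[d]addn0 eqn_add2l
  eq_sym.
by rewrite mdeg_eq0 => /eqP m20; rewrite em m20 addm0.
Qed.

Lemma lex_monomial d m : mdeg m = d -> ('X_[m] \in I) = (m \in initial d).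
Proof.
move=> md; apply/idP/idP; last exact: initial_ideal.
move/lex_homog => h; apply: (h d) => [m'|]; first by rewrite msuppX inE => /eqP ->.
by rewrite msuppX inE.
Qed.

Definition lex_basis (e : int) : seq ('I_1 * 'X_{1..n}) :=
  if e is Posz d then [seq (ord0, m) | m <- drop (\dim (ideal_part I d)) (monomials n d)]
  else [::].

(** In each degree the monomials outside of I are the last ones, and they form the basis
    of R/I. *)
Lemma mem_lex_basis e i m : ((i, m) \in lex_basis e) = ((mdeg m)%:Z == e) && ('X_[m] \notin I).
Proof.
case: e => [d|//] /=.
have -> : ((i, m) \in [seq (ord0, m0) | m0 <- drop (\dim (ideal_part I d)) (monomials n d)])
   = (m \in drop (\dim (ideal_part I d)) (monomials n d)).
  by rewrite ord1 mem_map // => x y [].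
rewrite eqz_nat; have [md | md] := eqVneq (mdeg m) d; last first.
  by apply: contraNF md => /mem_drop; rewrite mem_monomials.
rewrite (lex_monomial md); have := monomials_uniq n d.
have : m \in monomials n d by rewrite mem_monomials md.
rewrite -{1 2}(cat_take_drop (\dim (ideal_part I d)) (monomials n d)) mem_cat cat_uniq.
case: (m \in take _ _) / idP => [mt _ /and3P[_ /hasPn h _] | _ /= -> //].
by apply: contraTF mt => /h.
Qed.

Lemma lex_basis_uniq e : uniq (lex_basis e).
Proof.
case: e => [d|//]; rewrite /= map_inj_uniq ?drop_uniq ?monomials_uniq //.
by move=> x y [].
Qed.

Lemma lex_basis_closed : div_closed n (@mono_act n 1) lex_basis.
Proof.
move=> k d [i m] kn; rewrite /mono_act /= !mem_lex_basis mdegD mdeg_var_mono // succzE =>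
  /andP[md mI].
apply/andP; split; first by move: md; rewrite -addn1 PoszD; lia.
by apply: contra mI => mI; rewrite mpolyXD mulrC; apply: (idealM hI).
Qed.

Definition lex_mod : gmod K :=
  monomial_mod K (fun k l u => mono_actC k l u) lex_basis_uniq lex_basis_closed.

Definition lex_rho e : 'M[K]_(gdim P e, gdim lex_mod e) :=
  seqmx (free_basis n no_shift e) (lex_basis e) (fun x y => (x == y)%:R).

Let eqC (T : eqType) (a b : T) : (a == b)%:R = (b == a)%:R :> K. Proof. by rewrite eq_sym. Qed.

Lemma lex_presents : presents I lex_rho.
Proof.
split=> [k e kn | e | e f /poly_coord_homog_inv h].
- rewrite !monomial_modE // !seqmxM; apply: eq_seqmx => u v uin vin.
  rewrite sum_delta ?free_basis_uniq // free_basis_act // uin mul1r.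
  rewrite [RHS](eq_bigr (fun y => (y == u)%:R * (v == mono_act k y)%:R)) => [|y _];
    last by rewrite eqC.
  rewrite sum_delta ?lex_basis_uniq // eqC; have [e' | _] := eqVneq v; last by rewrite mulr0.
  by rewrite (lex_basis_closed kn (d := e)) ?mul1r // -e'.
- apply/row_fullP; exists (seqmx (lex_basis e) (free_basis n no_shift e)
  (fun x y => (x == y)%:R)).
  rewrite seqmxM -(seqmx1 _ (lex_basis_uniq e)); apply: eq_seqmx => u v uin vin.
  rewrite (eq_bigr (fun y => (y == u)%:R * (y == v)%:R)) => [|y _]; last by rewrite eqC.
  rewrite sum_delta ?free_basis_uniq //; case: u uin => i m;
    rewrite mem_lex_basis mem_free_basis0 => /andP[-> _].
  by rewrite mul1r.
have coef j : (poly_coord e f *m lex_rho e) 0 j = f@_(tnth (in_tuple (lex_basis e)) j).2.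
  rewrite mxE; set y := tnth _ j.
  rewrite (eq_bigr (fun i => (fun x => (x == y)%:R * f@_x.2) (tnth (fb e) i))) => [|i _];
    last first.
    by rewrite poly_coordE !mxE mulrC.
  rewrite (sum_free_basis no_shift e (fun x => (x == y)%:R * f@_x.2)) sum_delta
    ?free_basis_uniq //.
  have := mem_tnth j (in_tuple (lex_basis e)); rewrite -/y [y]surjective_pairing.
  by rewrite mem_lex_basis mem_free_basis0 => /andP[-> _]; rewrite mul1r.
apply/eqP/idP => [z | fI].
  rewrite [f]mpolyE big_seq; apply: (ideal_sum hI) => m mf; apply: (idealZ hI).
  apply: contraT => mI; have : (ord0, m) \in in_tuple (lex_basis e).
    by rewrite mem_lex_basis mI (h m mf) eqxx.
  case/tnthP => j ej; have := coef j; rewrite z mxE -ej /= => /esym/eqP.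
  by rewrite mcoeff_eq0 mf.
apply/rowP => j; rewrite coef mxE; apply/eqP; rewrite mcoeff_eq0.
have := mem_tnth j (in_tuple (lex_basis e)); move: (tnth _ j) => [i m].
rewrite mem_lex_basis => /andP[/eqP me]; apply: contra => mf.
have hd : forall m', m' \in msupp f -> mdeg m' = mdeg m by move=> m' /h; rewrite -me => -[].
by rewrite (lex_monomial (erefl _)); apply: (proj1 (lex_homog hd)).
Qed.

Lemma gdim_lex (d : nat) : gdim lex_mod d = hilbert I d.
Proof. by rewrite /= size_map size_drop. Qed.

End Presentation.

(** * Counting monomials in a final lex segment *)

Section Count.
Local Open Scope nat_scope.
Variable n : nat.
Implicit Types (m M u : 'X_{1..n}).

Definition box i l m := [forall v : 'I_n, (m v != 0) ==> (i <= v < l)].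

Lemma boxP i l m : reflect (forall v : 'I_n, m v != 0 -> i <= v < l) (box i l m).
Proof. by apply: (iffP forallP) => h v; apply/implyP/h. Qed.

Lemma count_split (i : 'I_n) d (p : pred 'X_{1..n}) :
  count p (monomials n d.+1) = count (fun m => p m && (m i == 0)) (monomials n d.+1)
    + count (fun u => p (u + U_(i))%MM) (monomials n d).
Proof.
rewrite -[LHS]size_filter -(count_predC (fun m => m i == 0)) !count_filter; congr (_ + _).
  by apply: eq_count => m /=; rewrite andbC.
rewrite -!size_filter.
rewrite -[RHS](size_map (fun u => u + U_(i))%MM); apply: perm_size; apply: uniq_perm.
- by rewrite filter_uniq ?monomials_uniq.
- by rewrite map_inj_uniq ?filter_uniq ?monomials_uniq //; apply: addIm.
move=> m; rewrite mem_filter mem_monomials /=; apply/idP/mapP.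
  case/andP=> /andP[mi pm] /eqP md; exists (m - U_(i))%MM.
    rewrite mem_filter submK ?lep1mP // pm mem_monomials /=.
    by have := mdegD (m - U_(i))%MM U_(i); rewrite submK ?lep1mP // mdeg1 md; lia.
  by rewrite submK ?lep1mP.
case=> u; rewrite mem_filter mem_monomials => /andP[pu /eqP ud] ->.
by rewrite mnmDE mnm1E eqxx addn1 pu mdegD mdeg1 ud addn1 eqxx.
Qed.

Lemma box_add (i : 'I_n) l u : box i l (u + U_(i))%MM = (i < l) && box i l u.
Proof.
apply/boxP/andP => [h | [il /boxP h] v].
  split; first by have := h i; rewrite mnmDE mnm1E eqxx addn1 => /(_ isT)/andP[].
  by apply/boxP => v vne; apply: h; rewrite mnmDE addn_eq0 negb_and vne.
rewrite mnmDE mnm1E; case: (i =P v) => [<- _ | _]; first by rewrite leqnn.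
by rewrite addn0; apply: h.
Qed.

Lemma boxS (i : 'I_n) l m : box i.+1 l m = box i l m && (m i == 0).
Proof.
apply/boxP/andP => [h | [/boxP h m0] v vne].
  split; first by apply/boxP => v /h /andP[iv ->]; rewrite ltnW.
  by apply: contraT => /h; rewrite ltnn.
have /andP[iv ->] := h v vne; rewrite andbT ltn_neqAle iv andbT.
by apply: contraNneq vne => e; rewrite (_ : v = i) //; apply: val_inj.
Qed.

Lemma box_ge i l m : l <= i -> box i l m -> m = 0%MM.
Proof.
move=> li /boxP h; apply/mnmP => v; rewrite mnm0E; apply/eqP; apply: contraT => /h; lia.
Qed.

Lemma count_box0 i l : count (box i l) (monomials n 0) = 1.
Proof.
by rewrite monomials0 /= (_ : box i l 0%MM) //; apply/boxP => v; rewrite mnm0E.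
Qed.

Lemma count_box i l d : l <= n -> count (box i l) (monomials n d.+1) = 'C(l - i + d, d.+1).
Proof.
move=> ln; move ex : (l - i) => x; elim: x i ex d => [|x IH] i ex d.
  rewrite bin_small // (@eq_in_count _ _ pred0) ?count_pred0 // => m.
  rewrite mem_monomials => /eqP md; apply/negP => /box_ge e.
  by move: md; rewrite e ?mdeg0 //; lia.
have il : i < l by lia.
pose v := Ordinal (leq_trans il ln).
have ex' : l - i.+1 = x by lia.
elim: d => [|d IHd]; rewrite (count_split v).
  rewrite (eq_count (a2 := box i.+1 l)) => [|m]; last by rewrite (boxS v).
  rewrite (IH _ ex') (eq_count (a2 := box i l)) => [|m]; last by rewrite (box_add v) il.
  by rewrite count_box0 !addn0 !bin1 addn1.
rewrite (eq_count (a2 := box i.+1 l)) => [|m]; last by rewrite (boxS v).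
rewrite (IH _ ex') [X in _ + X](eq_count (a2 := box i l)) => [|m]; last by rewrite (box_add v) il.
by rewrite IHd !addSn !addnS binS.
Qed.

Lemma size_monomials d : size (monomials n d.+1) = 'C(n + d, d.+1).
Proof.
have := count_box 0 d (leqnn n); rewrite subn0 => <-.
rewrite -[LHS]count_predT; apply: eq_count => m /=.
by apply/esym/boxP => v _; rewrite ltn_ord.
Qed.

(** If x_i does not divide M, then a smaller monomial is free of x_i as well, and i can
    be increased.  If it does, a smaller monomial is either free of x_i, which gives the
    top term of the expansion, or x_i times a monomial smaller than M/x_i.  The top index
    n - i - 2 + d is independent of j, and the bound on the other indices makes the
    sequence strict. *)
Lemma count_lt d i M : mdeg M = d -> (forall v : 'I_n, M v != 0 -> i <= v) ->
  exists mm, [/\ strict_upto d mm, (forall k, 1 <= k <= d -> mm k + i + 2 <= n + k) &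
    forall j, j <= n ->
      count (fun m => box i (n - j) m && (m < M)%O) (monomials n d) = shifted_sum j d mm].
Proof.
have [N] := ubnP (d + (n - i)); elim: N d i M => // N IH d i M; rewrite ltnS => leN.
case: d leN => [|d] leN md Mi.
  exists (fun=> 0); split=> [k | k | j _]; [lia | lia |].
  rewrite /shifted_sum weight0 (@eq_in_count _ _ pred0) ?count_pred0 // => m.
  rewrite mem_monomials mdeg_eq0 => /eqP ->; move/eqP: md; rewrite mdeg_eq0 => /eqP ->.
  by rewrite ltxx andbF.
have [ni | iN] := leqP n i.
  have M0 : M = 0%MM.
    apply/mnmP => v; rewrite mnm0E; apply/eqP; apply: contraT => /Mi; have := ltn_ord v; lia.
  by move: md; rewrite M0 mdeg0.
pose v := Ordinal iN; have [Mv0 | Mv] := eqVneq (M v) 0.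
  have [|w wne|mm [sm bd cnt]] := IH d.+1 i.+1 M _ md; first by lia.
    rewrite ltn_neqAle Mi // andbT; apply: contraNneq wne => e.
    by rewrite (_ : w = v) ?Mv0 //; apply: val_inj.
  exists mm; split=> // [k kd | j jn]; first by have := bd k kd; lia.
  rewrite -cnt //; apply: eq_in_count => m; rewrite mem_monomials => /eqP mdm.
  rewrite (boxS v) -andbA; case bm : (box i _ m) => //=.
  case ltm : (m < M)%O; rewrite ?andbF // andbT; apply/esym/eqP.
  have /(ltmcP (etrans mdm (esym md)))[w eqw ltw] := ltm.
  have [iw | wi | ew] := ltngtP i w.
  - by rewrite eqw.
  - suff M0 : M w = 0 by rewrite M0 in ltw.
    by apply/eqP; apply: contraT => /Mi; rewrite leqNgt wi.
  - by move: ltw; rewrite (_ : w = v) ?Mv0 //; apply: val_inj.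
pose M' := (M - U_(v))%MM; have ME : M = (M' + U_(v))%MM by rewrite submK ?lep1mP.
have md' : mdeg M' = d by move: md; rewrite ME mdegD mdeg1 addn1 => -[].
have [|w|mm [sm bd cnt]] := IH d i M' _ md'; first by lia.
  rewrite /M' mnmBE => h; apply: Mi; apply: contraNneq h => ->; by rewrite sub0n.
(* 'C(n - i - 1 - j + d, d.+1) monomials of degree d.+1 are free of x_i and of the
   last j variables *)
pose m' k := if k == d.+1 then n - i.+1 + d else mm k.
have mE k : k <= d -> m' k = mm k by rewrite /m'; case: eqP => // -> ; rewrite ltnn.
have mL : m' d.+1 = n - i.+1 + d by rewrite /m' eqxx.
exists m'; split.
- move=> k /andP[k1 kd]; have [kd' | kd'] := ltnP k d; first by rewrite !mE ?sm ?k1 //; lia.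
  have -> : k = d by lia.
  by rewrite mL mE //; have := bd d; lia.
- move=> k /andP[k1 kd]; have [kd' | kd'] := leqP k d; first by rewrite mE // bd // k1.
  have -> : k = d.+1 by lia.
  by rewrite mL; lia.
move=> j jn; rewrite /shifted_sum weightS -/(shifted_sum j d m') mL.
have -> : shifted_sum j d m' = shifted_sum j d mm.
  by rewrite /shifted_sum /weight !big_nat; apply: eq_bigr => k /andP[_ kd]; rewrite mE.
rewrite (count_split v) addnC; congr (_ + _).
  have [il | li] := ltnP i (n - j).
    rewrite -cnt //; apply: eq_count => u; rewrite /= (box_add v) il /=. rewrite {1}ME ltmc_add2l.
    by [].
  rewrite (eq_count (a2 := pred0)) ?count_pred0 => [|u]; last first.
    by rewrite (box_add v) ltnNge li.
  rewrite /shifted_sum /weight big_nat big1 // => k kd; rewrite bin_small //.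
  by have := bd k; lia.
rewrite (@eq_in_count _ _ (box i.+1 (n - j))) => [|m]; last first.
  rewrite mem_monomials (boxS v) => /eqP mdm; rewrite andbAC; case bm : (box i _ m && _) => //=.
  have /andP[/boxP bx /eqP m0] := bm.
  apply/(ltmcP (etrans mdm (esym md))); exists v; last by rewrite m0 lt0n.
  move=> w wv; apply: etrans (_ : _ = 0) _.
    by apply/eqP; apply: contraT => /bx; rewrite leqNgt wv.
  by apply/esym/eqP; apply: contraT => /Mi; rewrite leqNgt wv.
rewrite count_box ?leq_subr //; have [il | li] := ltnP i (n - j).
  by congr 'C(_, _); lia.
by rewrite !bin_small //; lia.
Qed.

(** The monomials are listed in decreasing order, so those after position a are the ones
    smaller than the a-th. *)
Lemma count_drop_nth d a (p : pred 'X_{1..n}) : a < size (monomials n d) ->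
  count p (drop a.+1 (monomials n d)) =
  count (fun m => p m && (m < nth 0%MM (monomials n d) a)%O) (monomials n d).
Proof.
move=> lt; set s := monomials n d in lt *; set M := nth _ _ _.
pose ge (m1 m2 : 'X_{1..n}) := (m2 <= m1)%O.
have ge_total : total ge by move=> x y; rewrite /ge le_total.
have ge_trans : transitive ge by move=> y x z; rewrite /ge => xy yz; apply: le_trans yz xy.
have ge_refl : reflexive ge by move=> x; rewrite /ge lexx.
have ss : sorted ge s by apply: sort_sorted.
have us : uniq s by apply: monomials_uniq.
have le_nth := sorted_leq_nth ge_trans ge_refl 0%MM ss.
rewrite -[in RHS](cat_take_drop a.+1 s) count_cat.
rewrite [X in _ = X + _](@eq_in_count _ _ pred0) ?count_pred0 => [|m]; last first.
  case/(nthP 0%MM) => k; rewrite size_take => kt <-.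
  have /andP[ka ks] : (k <= a) && (k < size s).
    move: kt lt; move: (size s) => z; case: (ltnP a.+1 z) => h1 h2 h3; apply/andP; split; lia.
  rewrite nth_take ?ltnS //; apply/negbTE; rewrite negb_and -leNgt.
  by apply/orP; right; apply: le_nth.
rewrite add0n; apply: eq_in_count => m /(nthP 0%MM)[k]; rewrite size_drop nth_drop => ks <-.
have ks' : a.+1 + k < size s by rewrite -ltn_subRL.
rewrite (_ : (_ < M)%O) ?andbT // lt_neqAle nth_uniq //.
by rewrite (_ : (_ == a) = false) /=; [apply: le_nth => //; lia | lia].
Qed.

Lemma take_monomials_up d a m m' : m \in take a (monomials n d) -> m' \in monomials n d ->
  (m < m')%O -> m' \in take a (monomials n d).
Proof.
set s := monomials n d => mt m's lt.
pose ge (m1 m2 : 'X_{1..n}) := (m2 <= m1)%O.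
have ge_total : total ge by move=> x y; rewrite /ge le_total.
have ge_trans : transitive ge by move=> y x z; rewrite /ge => xy yz; apply: le_trans yz xy.
have ge_refl : reflexive ge by move=> x; rewrite /ge lexx.
have ss : sorted ge s by apply: sort_sorted.
have le_nth := sorted_leq_nth ge_trans ge_refl 0%MM ss.
have ms := mem_take mt.
have us : uniq s by apply: monomials_uniq.
have : (m' \in take a s) || (m' \in drop a s) by rewrite -mem_cat cat_take_drop.
case/orP=> [//|md].
have it := index_ltn mt.
have id' : a <= index m' s.
  rewrite leqNgt; apply/negP => lt'; move: us; rewrite -(cat_take_drop a s) cat_uniq.
  case/and3P => _ /hasPn /(_ _ md) /negP + _; apply.
  by rewrite /= -(nth_index 0%MM m's) -(nth_take _ lt') mem_nth // size_take; case: ifP;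
    rewrite ?index_mem.
have := le_nth (index m s) (index m' s); rewrite !inE !index_mem ms m's => /(_ isT isT).
rewrite !nth_index // => /(_ (leq_trans (ltnW it) id')).
by rewrite /ge leNgt lt.
Qed.

(** The two extreme segments, all monomials and none, are not of the form of
    [count_lt] and are expanded directly. *)
Lemma count_drop d a : exists mm, strict_upto d.+1 mm /\
  forall j, j <= n -> count (box 0 (n - j)) (drop a (monomials n d.+1)) = shifted_sum j d.+1 mm.
Proof.
have minimal j (mm : nat -> nat) c : (forall k, 1 <= k <= c -> mm k = k.-1) ->
  shifted_sum j c mm = 0.
  by move=> h; rewrite /shifted_sum /weight big_nat big1 // => k kd; rewrite h // bin_small; lia.
case: a => [|a].
  (* all monomials: the expansion has the top term only *)
  exists (fun k => if k == d.+1 then n + d else k.-1); split=> [k kd | j jn].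
    by case: eqP => [|_]; case: eqP => //; lia.
  rewrite drop0 count_box ?leq_subr // subn0 /shifted_sum weightS eqxx -/(shifted_sum j d _)
    minimal ?add0n.
    by have [jn' | nj] := ltnP j n; [congr 'C(_, _); lia | rewrite !bin_small //; lia].
  by move=> k kd; case: eqP => //; lia.
have [lt | ge] := ltnP a (size (monomials n d.+1)).
  set M := nth 0%MM (monomials n d.+1) a.
  have /eqP md : mdeg M == d.+1 by rewrite -mem_monomials mem_nth.
  have [//|mm [sm _ cnt]] := @count_lt d.+1 0 M md.
  by exists mm; split=> // j jn; rewrite count_drop_nth // cnt.
(* no monomial is left, and all terms vanish *)
exists predn; split=> [k kd | j jn]; first by lia.
by rewrite drop_oversize ?minimal // ltnW.
Qed.

End Count.

(** * The bound and its sharpness *)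

#[local] Arguments beta_main : simpl never.

Lemma iter_succz k d : iter k succz d = d + k%:Z.
Proof. by elim: k => [|k IH] /=; rewrite ?addr0 // succzE IH -addrA -PoszD addn1. Qed.

Lemma koszul_betti_degenerate (K : fieldType) (M : gmod K) n i d :
  gdim M (succz d) = 0%N -> koszul_betti M n i d = 0%N.
Proof.
move=> g0; apply/eqP; rewrite -leqn0; apply: leq_trans (leq_subr _ _) _.
by apply: leq_trans (rank_leq_row _) _; rewrite kdimS g0 muln0.
Qed.

Section Final.
Variables (K : fieldType) (n : nat) (I : {pred {mpoly K[n]}}).
Hypothesis hI : proper_homogeneous_ideal I.
Notation h := (hilbert I).

Lemma hilbert_le d : (h d.+1 <= 'C(n + d, d.+1))%N.
Proof. by rewrite -size_monomials leq_subr. Qed.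

Lemma hilbert1_le : (h 1 <= n)%N.
Proof. by have := hilbert_le 0; rewrite addn0 bin1. Qed.

Lemma beta_linear (i : nat) : Defs.binomial (n%:R - (h 1)%:R) i.+1 = 'C(n - h 1, i.+1)%:R.
Proof. by rewrite -natrB ?hilbert1_le // binomial_nat. Qed.

Lemma beta_pos (i : nat) (j : int) : beta h n i.+1 (i%:Z + j) =
  match j with
  | Posz 0 => 0
  | Posz 1 => 'C(n - h 1, i.+1)%:R
  | Posz d => beta_main h n i d
  | Negz _ => 0
  end.
Proof.
rewrite /beta (_ : i%:Z + j - i%:Z = j); last by rewrite addrC addKr.
by case: j => [[|[|d]] | k] //; rewrite beta_linear.
Qed.

Lemma shifted_sum_linear j m : shifted_sum j 1 m = (m 1 - j)%N.
Proof. by rewrite /shifted_sum weightS weight0 add0n bin1. Qed.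

Lemma rational_le (x p q : nat) : (x + q <= p)%N -> x%:R <= p%:R - q%:R :> rat.
Proof. by move=> le; rewrite lerBrDr -natrD ler_nat. Qed.

Lemma rational_eq (x p q : nat) : (x + q = p)%N -> x%:R = p%:R - q%:R :> rat.
Proof. by move=> <-; rewrite natrD addrK. Qed.

Section Fixed.
Variable F : graded_free_resolution I.

(** Koszul homology lives in the degrees of A, which has nothing in negative degrees. *)
Lemma betti_neg A rho (pA : @presents K n I A rho) (i : nat) (j : int) : j <= 0 ->
  betti F i.+1 (i%:Z + j) = 0%N.
Proof.
move=> j0; have [d1 e1] := succz_surj j; have [d e2] := succz_surj d1.
have -> : i%:Z + j = iter i.+2 succz d.
  by rewrite /= iter_succz e1 e2 !succzE; lia.
rewrite (betti_koszul hI F pA); apply: koszul_betti_degenerate.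
have : succz d < 0 by rewrite -e2; move: j0; rewrite e1 succzE; lia.
by case: (succz d) => // k _; apply: pres_neg pA k.
Qed.

Lemma betti_koszul_at A rho (pA : @presents K n I A rho) (i e : nat) : exists2 d,
  succz d = e & betti F i.+1 (i%:Z + e.+1) = koszul_betti A n i.+1 d.
Proof.
have [d ed] := succz_surj e; exists d => //.
have -> : i%:Z + e.+1 = iter i.+2 succz d.
  by rewrite iter_succz; move: ed; rewrite succzE; lia.
exact: (betti_koszul hI F pA).
Qed.

Lemma betti_upper (i : nat) (j : int) :
  (betti F i.+1 (i%:Z + j))%:R <= beta h n i.+1 (i%:Z + j).
Proof.
have pA := quo_presents hI; have sA := pres_standard pA.
rewrite beta_pos; case: j => [[|e] | k]; try by rewrite (betti_neg pA).
have [d ed ->] := betti_koszul_at pA i e.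
have [a [b [[a0 b0] ha hb le]]] := koszul_betti_upper i sA ed.
rewrite -/(bound_neg n i b) -/(bound_pos n i a b) in le.
case: e ed a0 b0 ha hb => [|e] ed a0 b0 ha hb.
  rewrite ler_nat -(leq_add2r (bound_neg n i (fun j => h 1 - j)%N)).
  rewrite [leqRHS]addnC linear_bound ?hilbert1_le //; apply: (bound_mono _ _ _ le).
  - elim=> [|j IHj]; first by rewrite a0 (pres_zero hI pA).
    exact: leq_trans (ha j).1 IHj.
  - move=> j; rewrite -(shifted_sum_linear j (fun=> h 1)); apply: green_bound_iter hb j.
      by move=> k kdiff; lia.
    by rewrite shifted_sum_linear subn0 b0 gdim_quo.
  - by rewrite b0 gdim_quo subn0.
have [nn snn vnn] := expansion_exists e (h e.+1).
have [mm smm vmm] := expansion_exists e.+1 (h e.+2).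
rewrite (beta_main_sum _ _ _ _ snn vnn smm vmm) ?hilbert_le //; apply: rational_le.
apply: (bound_mono _ _ _ le).
- by apply: green_bound_iter snn _ _ => [|j]; [rewrite a0 gdim_quo vnn | exact: (ha j).2].
- by apply: green_bound_iter smm _ hb; rewrite b0 gdim_quo vmm.
- by rewrite b0 gdim_quo vmm.
Qed.

Lemma betti_lex (lexI : lex_segment_ideal I) (i : nat) (j : int) :
  (betti F i.+1 (i%:Z + j))%:R = beta h n i.+1 (i%:Z + j).
Proof.
have pA := lex_presents hI lexI.
rewrite beta_pos; case: j => [[|e] | k]; try by rewrite (betti_neg pA).
have [d ed ->] := betti_koszul_at pA i e.
rewrite (koszul_betti_belowN K (fun k l u => mono_actC k l u) (@mono_dvd_act n 1)
  (@mono_dvd_neq n 1)).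
set s := lex_basis I.
pose a c j := size (below n (@mono_dvd n 1) s (n - j) c).
have sizeE c j : (j <= n)%N -> a (Posz c) j
  = count (box 0 (n - j)) (drop (\dim (ideal_part I c)) (monomials n c)).
  move=> jn; rewrite /a /below size_filter /s /= count_map; apply: eq_count => m /=.
  rewrite subKn //; apply/allP/boxP => [hm v vne | hm l].
    rewrite /=; apply: contraT; rewrite -leqNgt => le.
    have /hm : (v : nat) \in iota (n - j) j by rewrite mem_iota le subnK ?ltn_ord.
    by rewrite mono_dvdE lt0n vne.
  rewrite mem_iota subnK // => /andP[le ln]; rewrite -[l]/(val (Ordinal ln)) mono_dvdE.
  by rewrite lt0n negbK; apply: contraT => /hm; rewrite /= ltnNge le.
(* x_k m is larger than x_l m in the lex order when k < l, so if x_l m were in the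
   segment, x_k m would be *)
have stab l k c u : (k < l)%N -> (l < n)%N -> u \in s c -> mono_act k u \in s (succz c) ->
    mono_act l u \in s (succz c).
  move=> kl ln; have kn := ltn_trans kl ln; case: u => x m.
  rewrite /mono_act /= /s !mem_lex_basis // !mdegD !mdeg_var_mono // => _ /andP[-> mk] /=.
  apply: contra mk; rewrite !(lex_monomial hI lexI (erefl _)).
  rewrite !mdegD !mdeg_var_mono // => ml; apply: take_monomials_up ml _ _.
    by rewrite mem_monomials mdegD mdeg_var_mono.
  rewrite ltmc_add2r (var_monoU ln) (var_monoU kn); apply/ltmcP; first by rewrite !mdeg1.
  exists (Ordinal kn) => [v /= vk|]; rewrite !mnm1E -!val_eqE /=.
    by rewrite (gtn_eqF vk) (gtn_eqF (ltn_trans vk kl)).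
  by rewrite eqxx (gtn_eqF kl).
have := koszul_betti_below_stable K (fun k l u => mono_actC k l u) (@mono_act_inj n 1)
  (@mono_dvd_act n 1) (@mono_dvdP n 1)
  (@mono_dvd_neq n 1) (lex_basis_uniq I) (lex_basis_closed hI lexI) (leqnn n) i d stab.
rewrite ed -/s -/(bound_neg n i (a e.+1)) -/(bound_pos n i (a e) (a e.+1)) => main.
have [mm [smm cnt1]] := count_drop n e (\dim (ideal_part I e.+1)).
have a1 j : (j <= n)%N -> a e.+1 j = shifted_sum j e.+1 mm by move=> jn; rewrite sizeE // cnt1.
have a0 c : a (Posz c) 0 = h c.
  rewrite sizeE // /hilbert -size_drop; apply/eqP; rewrite -all_count; apply/allP => m _.
  by apply/boxP => v _; rewrite subn0 ltn_ord.
have vmm : shifted_sum 0 e.+1 mm = h e.+1 by rewrite -a1 // a0.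
have negE : bound_neg n i (a e.+1) = bound_neg n i (fun j => shifted_sum j e.+1 mm).
  by apply: eq_bigr => j _; rewrite a1 // ltnW.
case: e ed sizeE main mm smm cnt1 a1 vmm negE => [|e] ed sizeE main mm smm cnt1 a1 vmm negE.
  have am : mm 1 = h 1 by rewrite -vmm shifted_sum_linear subn0.
  have posE : bound_pos n i (a 0) (a 1) = bound_pos n i (fun=> 1) (fun j => h 1 - j)%N.
    apply: eq_bigr => j _; congr (_ * (_ + _))%N; last by rewrite a1 // shifted_sum_linear am.
    rewrite sizeE; last exact: ltnW.
    have := pres_zero hI pA; rewrite gdim_lex /hilbert {1}monomials0 => dim0.
    by rewrite (_ : \dim (ideal_part I 0) = 0%N) ?drop0 ?count_box0 //; move: dim0 => /=; lia.
  have nE : bound_neg n i (fun j => shifted_sum j 1 mm) = bound_neg n i (fun j => h 1 - j)%N.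
    by apply: eq_bigr => j _; rewrite shifted_sum_linear am.
  apply/eqP; rewrite eqr_nat -(eqn_add2r (bound_neg n i (fun j => h 1 - j)%N)).
  by rewrite -{1}nE -negE main posE addnC linear_bound // hilbert1_le.
have [nn [snn cnt0]] := count_drop n e (\dim (ideal_part I e.+1)).
have a2 j : (j <= n)%N -> a e.+1 j = shifted_sum j e.+1 nn by move=> jn; rewrite sizeE // cnt0.
have vnn : shifted_sum 0 e.+1 nn = h e.+1 by rewrite -a2 // a0.
rewrite (beta_main_sum _ _ _ _ snn vnn smm vmm) ?hilbert_le //; apply: rational_eq.
rewrite -negE main; apply: eq_bigr => j _.
by rewrite a1 // a2 // ltnW.
Qed.
End Fixed.
End Final.

Theorem theorem3p12 (K : fieldType) (n : nat) (I : {pred {mpoly K[n]}})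
    (HI : proper_homogeneous_ideal I) (F : graded_free_resolution I) :
  (forall i j : int,
     (betti F (i + 1) (i + j))%:R <= beta (hilbert I) n (i + 1) (i + j))
  /\
  (lex_segment_ideal I ->
   forall i j : int,
     (betti F (i + 1) (i + j))%:R = beta (hilbert I) n (i + 1) (i + j)).
Proof.
(* homological degrees at most 0 *)
have low k j : (betti F (Negz k + 1) (Negz k + j))%:R
  = beta (hilbert I) n (Negz k + 1) (Negz k + j).
  have pA := quo_presents HI; case: k => [|k]; last by rewrite (_ : Negz k.+1 + 1 = Negz k);
    last by lia.
  by rewrite (_ : Negz 0 + 1 = 0) // (betti0_value HI pA).
have pos (i : nat) : i%:Z + 1 = i.+1 by rewrite -PoszD addn1.
split=> [i j | lexI i j]; case: i => [i | k]; rewrite ?low // pos; first exact: betti_upper.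
exact: betti_lex.
Qed.
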